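(* Let $m\ge 1$. For $j=1,\dots,m$ let $X(\varphi_j)$ be a symmetric space on $[0,1]$ with fundamental function $\varphi_j$, let $\psi_j$ be a $\Phi$-function, and let $1\le\tau_j<+\infty$. Suppose $1<\alpha_{\psi_j}\le\beta_{\psi_j}<\alpha_{\varphi_j}\le\beta_{\varphi_j}<2$ for $j=1,\dots,m$. Then there is a constant $C>0$, independent of $f$, such that the following holds: if $f\in\overset{\circ}{X}(\bar\varphi)$ and $$\Bigl\{\prod_{j=1}^{m}\frac{\psi_j(2^{-s_j})}{\varphi_j(2^{-s_j})}\,\|\delta_{\bar s}(f)\|^{*}_{X(\bar\varphi)}\Bigr\}_{\bar s\in\mathbb{Z}_+^m}\in l_{\bar\tau},$$ then $f\in\overset{\circ}{L}{}^{*}_{\bar\psi,\bar\tau}(\mathbb{T}^m)$ and $$\|f\|^{*}_{\bar\psi,\bar\tau}\le C\,\Bigl\|\Bigl\{\prod_{j=1}^{m}\frac{\psi_j(2^{-s_j})}{\varphi_j(2^{-s_j})}\,\|\delta_{\bar s}(f)\|^{*}_{X(\bar\varphi)}\Bigr\}_{\bar s\in\mathbb{Z}_+^m}\Bigr\|_{l_{\bar\tau}}.$$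
   Context: $\mathbb{T}^m=[0,2\pi]^m$, $I^m=[0,1]^m$, $\mathbb{Z}_+=\{0,1,2,\dots\}$. Functions $f$ on $\mathbb{T}^m$ are measurable and $2\pi$-periodic in each variable. $\Phi$-function: a concave, non-decreasing, continuous function $\varphi$ on $[0,1]$ with $\varphi(0)=0$ (not identically zero). Put $\alpha_\varphi=\liminf_{t\to0}\varphi(2t)/\varphi(t)$ and $\beta_\varphi=\limsup_{t\to0}\varphi(2t)/\varphi(t)$. Rearrangement: for a nonnegative measurable $g$ on $[0,1]$, $g^*(t)=\inf\{\lambda>0:\mu\{x: g(x)>\lambda\}<t\}$, $\mu$ being Lebesgue measure. Symmetric space on $[0,1]$: a Banach space $X$ of Lebesgue measurable functions on $[0,1]$ such that (1) $|f|\le|g|$ a.e. and $g\in X$ imply $f\in X$ and $\|f\|_X\le\|g\|_X$; (2) if $g$ is measurable, $f\in X$ and $|f|,|g|$ are equimeasurable, then $g\in X$ and $\|g\|_X=\|f\|_X$. Its fundamental function is $\varphi(t)=\|\chi_{[0,t]}\|_X$, taken to be a $\Phi$-function; the space is then denoted $X(\varphi)$. Anisotropic symmetric space: for $\bar\varphi=(\varphi_1,\dots,\varphi_m)$, $X(\bar\varphi)$ is the space of functions $f$ on $\mathbb{T}^m$ with finite norm $\|f\|^*_{X(\bar\varphi)}=\|\cdots\|f^{*_1,\dots,*_m}\|_{X(\varphi_1)}\cdots\|_{X(\varphi_m)}$, where $f^{*_1,\dots,*_m}(t_1,\dots,t_m)$ is obtained from $|f(2\pi\bar x)|$, $\bar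 x\in I^m$, by taking the non-increasing rearrangement successively in $x_1$, then $x_2$, ..., then $x_m$, each time with the other variables fixed, and the norm of $X(\varphi_j)$ is applied in the variable $t_j$ (first $t_1$, ..., last $t_m$). Generalized anisotropic Lorentz space: $L^*_{\bar\psi,\bar\tau}(\mathbb{T}^m)$ is the set of $f$ with finite $$\|f\|^*_{\bar\psi,\bar\tau}=\Bigl[\int_0^1\psi_m^{\tau_m}(t_m)\Bigl[\cdots\Bigl[\int_0^1\psi_1^{\tau_1}(t_1)\bigl(f^{*_1,\dots,*_m}(t_1,\dots,t_m)\bigr)^{\tau_1}\frac{dt_1}{t_1}\Bigr]^{\tau_2/\tau_1}\cdots\Bigr]^{\tau_m/\tau_{m-1}}\frac{dt_m}{t_m}\Bigr]^{1/\tau_m}.$$ $\overset{\circ}{X}(\bar\varphi)$ and $\overset{\circ}{L}{}^*_{\bar\psi,\bar\tau}(\mathbb{T}^m)$ denote the subsets of functions $f$ in $X(\bar\varphi)$, respectively $L^*_{\bar\psi,\bar\tau}(\mathbb{T}^m)$, with $\int_0^{2\pi}f(\bar x)\,dx_j=0$ for every $j=1,\dots,m$. Dyadic blocks: $a_{\bar n}(f)$ are the Fourier coefficients of $f$ with respect to $\{e^{i\langle\bar n,\bar x\rangle}\}_{\bar n\in\mathbb{Z}^m}$; $\rho(\bar s)=\{\bar k\in\mathbb{Z}^m: 2^{s_j-1}\le|k_j|<2^{s_j},\ j=1,\dots,m\}$; $\delta_{\bar s}(f,\bar x)=\sum_{\bar n\in\rho(\bar s)}a_{\bar n}(f)e^{i\langle\bar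 n,\bar x\rangle}$ (an empty sum is $0$). Mixed sequence norm: $\|\{a_{\bar s}\}\|_{l_{\bar\tau}}=\bigl\{\sum_{s_m}\bigl[\cdots\bigl[\sum_{s_1}|a_{\bar s}|^{\tau_1}\bigr]^{\tau_2/\tau_1}\cdots\bigr]^{\tau_m/\tau_{m-1}}\bigr\}^{1/\tau_m}$, sums over $s_j\in\mathbb{Z}_+$. *)

(* Defs.v *)
From HB Require Import structures.
From mathcomp Require Import all_boot all_order all_algebra.
From mathcomp Require Import all_classical all_reals all_analysis.
From mathcomp Require Import measurable_realfun complex.
Set Implicit Arguments.
Unset Strict Implicit.
Unset Printing Implicit Defensive.
Import Order.TTheory GRing.Theory Num.Theory.
Import numFieldNormedType.Exports.
Import numFieldTopology.Exports.
Local Open Scope classical_set_scope.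
Local Open Scope ring_scope.
(* Points of R^m, multi-indices and frequencies are m-tuples over R, nat and
   int respectively. *)
Section tuples.
Context {m : nat} {T : Type}.

Definition upd (x : m.-tuple T) (j : 'I_m) (t : T) : m.-tuple T :=
  [tuple if i == j then t else tnth x i | i < m].

(* iterate Phi x0 F is Phi_m (fun t_m => ... Phi_1 (fun t_1 => F (t_1, ..., t_m))),
   the functional of the first variable being innermost. It does not depend on
   the base point x0, as every coordinate gets overwritten. *)
Definition iterate {E : Type} (Phi : 'I_m -> (T -> E) -> E)
    (x0 : m.-tuple T) (F : m.-tuple T -> E) : E :=
  foldl (fun G j x => Phi j (fun t => G (upd x j t))) F (enum 'I_m) x0.

End tuples.

Section lebesgue.
Context {R : realType}.

Fixpoint lebesgue_tuple (m : nat) : set (m.-tuple R) -> \bar R :=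
  match m with
  | 0 => \d_[tuple]
  | m'.+1 => pushforward (lebesgue_measure \x @lebesgue_tuple m')%E
               (fun p => [tuple of p.1 :: p.2])
  end.

Lemma lebesgue_tuple_sigma_finite (m : nat) :
  exists mu : {sigma_finite_measure set (m.-tuple R) -> \bar R},
    @lebesgue_tuple m = mu.
Proof.
elim: m => [|m [mu muE]] /=; first by exists (\d_[tuple])%E.
rewrite muE.
pose c (p : R * m.-tuple R) : m.+1.-tuple R := [tuple of p.1 :: p.2].
have mc : measurable_fun [set: R * m.-tuple R] c.
  exact: measurable_cons.
pose d (t : m.+1.-tuple R) : R * m.-tuple R := (thead t, [tuple of behead t]).
have md : measurable_fun [set: m.+1.-tuple R] d.
  apply/measurable_fun_pairP; split; first exact: measurable_tnth.
  exact: measurable_behead.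
have cd : cancel c d.
  by move=> [x t]; rewrite /d /c /= theadE; congr pair; apply/val_inj.
pose nu : {measure set (measurableTypeR R * m.-tuple R)%type -> \bar R} :=
  (@lebesgue_measure R \x mu)%E.
pose pm : {measure set (m.+1.-tuple R) -> \bar R} :=
   measure_function_pushforward__canonical__measure_function_Measure nu mc.
have [F FT mF] : sigma_finite setT nu.
  have /sigma_finiteP[F [TF ndF Foo]] := sigma_finiteT (@lebesgue_measure R).
  have /sigma_finiteP[G [TG ndG Goo]] := sigma_finiteT mu.
  exists (fun n => F n `*` G n).
    rewrite -setXTT TF TG predeqE => -[x y]; split.
      move=> [/= [n _ Fnx] [k _ Gky]]; exists (maxn n k) => //; split.
      - by move: x Fnx; exact/subsetPset/ndF/leq_maxl.
      - by move: y Gky; exact/subsetPset/ndG/leq_maxr.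
    by move=> [n _ []/= ? ?]; split; exists n.
  move=> k; have [? ?] := Foo k; have [? ?] := Goo k.
  split; first exact: measurableX.
  by rewrite /nu/= product_measure1E// lte_mul_pinfty// ge0_fin_numE.
have sf : sigma_finite setT pm.
  exists (fun k => d @^-1` (F k)).
    by rewrite -preimage_bigcup -FT preimage_setT.
  move=> k; have [mFk Fk] := mF k; split.
    by rewrite -[X in measurable X]setTI; exact: md.
  rewrite /pm/= /pushforward (_ : _ @^-1` _ = F k)//.
  by rewrite -comp_preimage; apply/seteqP; split => p /=; rewrite cd.
rewrite [X in exists _, X = _](_ : _ = pm :> (set (m.+1.-tuple R) -> \bar R))//.
case: pm sf => f pm sf.
pose H := Measure_isSigmaFinite.Build _ _ _ (Measure.Pack pm) sf.
pose g : {sigma_finite_measure set (m.+1.-tuple R) -> \bar R} :=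
  HB.pack f pm H.
by exists g.
Qed.

Section inst.
Variable m : nat.
Let l0 : lebesgue_tuple (m:=m) set0 = 0%E.
Proof. by have [mu ->] := lebesgue_tuple_sigma_finite m; exact: measure0. Qed.
Let l_ge0 A : (0 <= lebesgue_tuple (m:=m) A)%E.
Proof. by have [mu ->] := lebesgue_tuple_sigma_finite m; exact: measure_ge0. Qed.
Let l_sa : semi_sigma_additive (@lebesgue_tuple m).
Proof.
have [mu ->] := lebesgue_tuple_sigma_finite m.
exact: measure_semi_sigma_additive.
Qed.
HB.instance Definition _ :=
  isMeasure.Build _ _ _ (@lebesgue_tuple m) l0 l_ge0 l_sa.
Let l_sf : sigma_finite setT (@lebesgue_tuple m).
Proof.
by have [mu ->] := lebesgue_tuple_sigma_finite m; exact: sigma_finiteT.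
Qed.
HB.instance Definition _ :=
  Measure_isSigmaFinite.Build _ _ _ (@lebesgue_tuple m) l_sf.
End inst.
End lebesgue.

Section functions_on_unit_interval.
Context {R : realType}.
Implicit Types (f g : R -> R) (phi : R -> R).
Local Notation mu := (@lebesgue_measure R).

(* Measurability with respect to the completion of nu: for Lebesgue measure, this
   is Lebesgue (and not merely Borel) measurability. As lebesgue_measure is the
   outer measure on arbitrary sets, its values below are the Lebesgue measure of
   Lebesgue measurable sets. *)
Definition completed_measurable_fun d (T : measurableType d)
    (nu : set T -> \bar R) (D : set T) (f : T -> R) : Prop :=
  measurable_fun (D : set (g_sigma_algebraType (completed_algebra_gen nu))) f.

Definition Phi_function phi : Prop :=
  [/\ convex_function (`[0, 1]%classic : set R^o) (fun t => - phi t : R^o),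
      {in `[0, 1] &, {homo phi : s t / s <= t}},
      {within `[0, 1], continuous phi},
      phi 0 = 0 &
      exists2 t, t \in `[0, 1] & phi t != 0].

Definition alpha phi : \bar R :=
  limf_einf (fun t : R => (phi (2 * t) / phi t)%:E) 0^'+.

Definition beta phi : \bar R :=
  limf_esup (fun t : R => (phi (2 * t) / phi t)%:E) 0^'+.

(* At t = 0 the set is empty and the value is +oo, whence the codomain. *)
Definition rearrangement (g : R -> \bar R) (t : R) : \bar R :=
  ereal_inf [set l%:E | l in [set l : R | 0 < l /\
    (mu (`[0%R, 1%R] `&` [set x | l%:E < g x]) < t%:E)%E]].

Definition equimeasurable f g : Prop := forall l : R,
  mu (`[0, 1] `&` [set x | l < f x]) = mu (`[0, 1] `&` [set x | l < g x]).

(* Functions on [0, 1] are represented by functions on R, of which only the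
   restriction to [0, 1] matters, up to equality almost everywhere. *)
Record symmetric_space := SymmetricSpace {
  ss_mem : set (R -> R) ;
  ss_norm : (R -> R) -> R ;
  ss_measurable : forall f, ss_mem f -> completed_measurable_fun mu `[0, 1] f ;
  ss_mem0 : ss_mem (fun=> 0) ;
  ss_memD : forall f g, ss_mem f -> ss_mem g -> ss_mem (f \+ g) ;
  ss_memZ : forall (a : R) f, ss_mem f -> ss_mem (a \*o f) ;
  ss_normD : forall f g, ss_mem f -> ss_mem g ->
    ss_norm (f \+ g) <= ss_norm f + ss_norm g ;
  ss_normZ : forall (a : R) f, ss_mem f -> ss_norm (a \*o f) = `|a| * ss_norm f ;
  ss_norm0_eq0 : forall f, ss_mem f -> ss_norm f = 0 ->
    {ae mu, forall t, t \in `[0, 1] -> f t = 0} ;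
  ss_complete : forall u : nat -> R -> R, (forall n, ss_mem (u n)) ->
    (forall e : R, 0 < e -> exists N, forall n p, (N <= n)%N -> (N <= p)%N ->
      ss_norm (u n \- u p) < e) ->
    exists2 f, ss_mem f & (fun n => ss_norm (u n \- f)) @ \oo --> (0 : R) ;
  ss_ideal : forall f g, completed_measurable_fun mu `[0, 1] f -> ss_mem g ->
    {ae mu, forall t, t \in `[0, 1] -> `|f t| <= `|g t|} ->
    ss_mem f /\ ss_norm f <= ss_norm g ;
  ss_invariant : forall f g, ss_mem f -> completed_measurable_fun mu `[0, 1] g ->
    equimeasurable (fun t => `|f t|) (fun t => `|g t|) ->
    ss_mem g /\ ss_norm g = ss_norm f }.

(* phi is the fundamental function of X, defined on [0, 1]. *)
Definition fundamental_function (X : symmetric_space) phi : Prop :=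
  forall t, t \in `[0, 1] -> ss_mem X \1_(`[0, t]) /\ phi t = ss_norm X \1_(`[0, t]).

(* The norm of X on functions with values in [-oo, +oo]: +oo outside of X. The
   infimum is over the representatives of g in X, which all have the same norm. *)
Definition ss_enorm (X : symmetric_space) (g : R -> \bar R) : \bar R :=
  ereal_inf [set (ss_norm X h)%:E | h in [set h | ss_mem X h /\
    {ae mu, forall t, t \in `[0, 1] -> g t = (h t)%:E}]].

(* With N_j this functional for psi_j and tau_j, the composite
   N_m (... N_1 ( . )) is the iterated integral defining the Lorentz norm: in
   N_(j+1), the power tau_(j+1) of the value of N_j is the inner integral to the
   power tau_(j+1) / tau_j. The same holds for l_functional. *)
Definition lorentz_functional (psi : R -> R) (tau : R) (g : R -> \bar R) :
    \bar R :=
  ((\int[mu]_(t in `[0%R, 1%R])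
     ((psi t `^ tau)%:E * g t `^ tau * (t^-1)%:E)) `^ tau^-1)%E.

Definition l_functional (tau : R) (a : nat -> \bar R) : \bar R :=
  ((\sum_(0 <= k <oo) `|a k| `^ tau) `^ tau^-1)%E.

End functions_on_unit_interval.
Arguments symmetric_space : clear implicits.

Section functions_on_torus.
Context {R : realType} {m : nat}.
Local Notation mu := (@lebesgue_measure R).
Local Notation mu_m := (@lebesgue_tuple R m).
Implicit Types (f : m.-tuple R -> R[i]) (x : m.-tuple R).
Implicit Types (k : m.-tuple int) (s : m.-tuple nat).

Definition torus : set (m.-tuple R) :=
  [set x | forall j, tnth x j \in `[0, 2 * pi]].

Definition torus_function f : Prop :=
  [/\ completed_measurable_fun mu_m torus (fun x => complex.Re (f x)),
      completed_measurable_fun mu_m torus (fun x => complex.Im (f x)) &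
      forall x j, f (upd x j (tnth x j + 2 * pi)) = f x].

(* The rearrangement with respect to x_j, the other variables being fixed. *)
Definition rearrangement_in (F : m.-tuple R -> \bar R) (j : 'I_m) :
    m.-tuple R -> \bar R :=
  fun x => rearrangement (fun t => F (upd x j t)) (tnth x j).

Definition iterated_rearrangement f : m.-tuple R -> \bar R :=
  foldl rearrangement_in
    (fun x => (Normc.normc (f [tuple 2 * pi * tnth x i | i < m]))%:E)
    (enum 'I_m).

Definition X_norm (X : 'I_m -> symmetric_space R) f : \bar R :=
  iterate (fun j => ss_enorm (X j)) [tuple 0 | _ < m] (iterated_rearrangement f).

Definition lorentz_norm (psi : 'I_m -> R -> R) (tau : 'I_m -> R) f : \bar R :=
  iterate (fun j => lorentz_functional (psi j) (tau j)) [tuple 0 | _ < m]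
    (iterated_rearrangement f).

(* The integral over x_j vanishes for almost every value of the other variables;
   the extended integrals are 0 only for integrable sections, since
   +oo - +oo is -oo. *)
Definition mean_zero f : Prop := forall j : 'I_m,
  {ae mu_m, forall x, torus x ->
    (\int[mu]_(t in `[0%R, (2 * pi)%R]) (complex.Re (f (upd x j t)))%:E = 0)%E /\
    (\int[mu]_(t in `[0%R, (2 * pi)%R]) (complex.Im (f (upd x j t)))%:E = 0)%E}.

Definition X_space (X : 'I_m -> symmetric_space R) : set (m.-tuple R -> R[i]) :=
  [set f | torus_function f /\ (X_norm X f < +oo)%E].

Definition lorentz_space (psi : 'I_m -> R -> R) (tau : 'I_m -> R) :
    set (m.-tuple R -> R[i]) :=
  [set f | torus_function f /\ (lorentz_norm psi tau f < +oo)%E].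

Definition X_space0 (X : 'I_m -> symmetric_space R) := X_space X `&` mean_zero.

Definition lorentz_space0 (psi : 'I_m -> R -> R) (tau : 'I_m -> R) :=
  lorentz_space psi tau `&` mean_zero.

Definition pairing k x : R := \sum_(j < m) (tnth k j)%:~R * tnth x j.

Definition expi (theta : R) : R[i] := Complex (cos theta) (sin theta).

Definition torus_integral f : R[i] :=
  Complex (\int[mu_m]_(x in torus) complex.Re (f x))
          (\int[mu_m]_(x in torus) complex.Im (f x)).

Definition fourier_coef f k : R[i] :=
  real_complex R ((2 * pi) ^- m) *
    torus_integral (fun x => f x * expi (- pairing k x)).

Definition rho s : set (m.-tuple int) :=
  [set k | forall j, (2%:Q ^ ((tnth s j)%:Z - 1) <= `|tnth k j|%:~R :> rat) &&
                     (`|tnth k j|%:~R < 2%:Q ^ (tnth s j)%:Z :> rat)].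

Definition delta f s : m.-tuple R -> R[i] := fun x =>
  \sum_(k \in rho s) fourier_coef f k * expi (pairing k x).

Definition l_norm (tau : 'I_m -> R) (a : m.-tuple nat -> \bar R) : \bar R :=
  iterate (fun j => l_functional (tau j)) [tuple 0%N | _ < m] a.

Definition block_norms (X : 'I_m -> symmetric_space R) (phi psi : 'I_m -> R -> R)
    f s : \bar R :=
  ((\prod_(j < m) (psi j (2 ^- tnth s j) / phi j (2 ^- tnth s j)))%:E *
     X_norm X (delta f s))%E.

End functions_on_torus.

(* Main.v *)
Require Import Defs.
From mathcomp Require Import all_boot all_order all_algebra.
From mathcomp Require Import all_classical all_reals all_analysis complex.
From mathcomp Require Import measurable_realfun ring lra zify.
From mathcomp Require finmap.
Import Order.TTheory GRing.Theory Num.Theory.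
Import numFieldNormedType.Exports.
Local Open Scope classical_set_scope.
Local Open Scope ring_scope.
Set Implicit Arguments.
Unset Strict Implicit.
Unset Printing Implicit Defensive.

(** Write g* for the iterated rearrangement of g, let n_j be the integer such that
    2^-(n_j + 1) < t_j <= 2^-n_j, and let w_j(s) = psi_j(2^-s) / phi_j(2^-s).

    The norm of X is used only through the weak type estimate
    g*(t) prod_j phi_j(t_j) <= X_norm g (X_norm_weak): g* is nonincreasing in each variable,
    and phi_j(t) is the norm of the indicator of the interval from 0 to t.

    As beta_phi_j < 2, this estimate makes f and its blocks integrable, with summable norms
    for the blocks. Their sum has the Fourier coefficients of f, those with a vanishing
    frequency being zero by the mean value condition. Hence f is the sum of its blocks,
    and |f| <= sum_s |delta_s f| almost everywhere (norm_le_sum_blocks).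

    A block has frequencies |k_j| < 2^s_j, so that it does not vary much at scales below
    2^-s_j. Accordingly its weak type estimate improves: phi_j(t_j) may be replaced by
    phi_j(max(t_j, 2^-s_j)), at the cost of a constant (delta_nikolskii). The proof works
    directly on rearrangements. A sampling formula bounds the polynomial at x by its values
    on a translated grid of step comparable with 2^-s_j, with rapidly decreasing weights,
    and the translation can be chosen so that no node falls where the polynomial is
    unusually large.

    The conditions on alpha and beta say that psi_j(2^-n) decreases and w_j(s) increases at
    least geometrically. This is what is needed for
    psi_j(2^-n) / phi_j(max(2^-n, 2^-s)) <= C w_j(s) rho^|n - s| with rho < 1
    (kernel_bounds). Since sum_s h_s <= sup_s h_s / c_s as soon as sum_s c_s <= 1, and the
    rearrangement of a supremum at t is at most the supremum of the rearrangements at c_s t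
    as soon as sum_s c_s <= 1/2 (foldl_rearr_sup), choosing for c_s a multiple of
    prod_j rho^|n_j - s_j| gives
    f*(t) prod_j psi_j(2^-n_j) <= A sup_s a_s prod_j rho^|n_j - s_j|,
    up to the value of rho, where a_s is the sequence of the theorem
    (weighted_rearrangement_le).

    There remains an inequality between the Lorentz functionals and the l_tau functionals,
    which is proved one variable at a time, from the innermost one (lorentz_iterate). The
    geometric factors allow to exchange sums, powers and suprema freely. *)

(** * Outer Lebesgue measure and the nonincreasing rearrangement *)

Section outer_lebesgue.
Context {R : realType}.
Local Notation mu := (@lebesgue_measure R).

(** An affine map sends a cover of A by half-open intervals to such a cover of the
    image, so the bound holds for the outer measure of every set. *)
Lemma lebesgue_affine_le (a b : R) (A : set R) : 0 < a ->
  (mu ((fun x => (a * x + b)%R) @` A) <= a%:E * mu A)%E.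
Proof.
move=> a0; rewrite -lee_pdivrMl//; apply: le_ereal_inf_tmp => _ [B [mB AB] <-].
rewrite lee_pdivrMl//.
pose f x := a * x + b.
have key k : @measurable _ (ocitv_type R) (f @` B k) /\
    wlength idfun (f @` B k) = (a%:E * wlength idfun (B k))%E.
  have /ocitvP[->|[[x y] /= xy ->]] := mB k.
    by rewrite image_set0 wlength0 mule0; split.
  have -> : f @` `]x, y]%classic = `]f x, f y]%classic.
    apply/seteqP; split => [_ [z + <-]|z].
      by rewrite /= !in_itv/= /f => /andP[xz zy]; rewrite ltrD2r ltr_pM2l// xz lerD2r ler_pM2l.
    rewrite /= !in_itv/= /f => /andP[xz zy]; exists ((z - b) / a); last by field; rewrite gt_eqF.
    rewrite in_itv/= ltr_pdivlMr// ler_pdivrMr// ltrBrDr lerBlDr !(mulrC _ a).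
    by rewrite xz zy.
  have fxy : f x < f y by rewrite /f ltrD2r ltr_pM2l.
  split; first by apply/ocitvP; right; exists (f x, f y).
  rewrite !wlength_itv_bnd/= ?ltW// -EFinM /f; congr (_%:E); ring.
have Bmu : mu (f @` A) = ((wlength idfun)^*)%mu (f @` A) by [].
apply: (@le_trans _ _ (\sum_(0 <= k <oo) wlength idfun (f @` B k))%E).
  apply: ereal_inf_lbound; exists (fun k => f @` B k) => //; split.
    by move=> k; exact: (key k).1.
  by move=> _ [x /AB[k _ Bkx] <-]; exists k => //; exists x.
rewrite (eq_eseriesr (fun k _ => (key k).2)) nneseriesZl//.
Qed.

Lemma esumZl_le (T : choiceType) (S : set T) (c : R) (a : T -> \bar R) :
  0 <= c -> (forall i, (0 <= a i)%E) ->
  (\esum_(i in S) (c%:E * a i) <= c%:E * \esum_(i in S) a i)%E.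
Proof.
move=> c0 a0; apply: ge_ereal_sup => _ [X [fX XS] <-].
rewrite -ge0_mule_fsumr//; apply: lee_pmul => //.
  by apply: fsume_ge0.
by apply: ereal_sup_ubound; exists X.
Qed.

Lemma nneseries_pickle (I : countType) (a : I -> \bar R) :
  (forall i, (0 <= a i)%E) ->
  (\sum_(0 <= n <oo) (if pickle_inv n is Some i then a i else 0) =
   \esum_(i in [set: I]) a i)%E.
Proof.
move=> a0; rewrite nneseries_esumT; last by move=> n; case: pickle_inv.
rewrite [RHS](_ : _ = \esum_(n in @pickle I @` [set: I])
    (if pickle_inv n is Some i then a i else 0))%E.
  rewrite [RHS]esum_mkcond; apply: eq_esum => n _; case: ifPn => // /negP nI.
  case E: (pickle_inv n) => [i|//].
  have := @pickle_invK I n; rewrite E /= => ni.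
  by exfalso; apply: nI; apply/mem_set; exists i.
rewrite (@reindex_esum _ _ _ setT _ (@pickle I)).
  by apply: eq_esum => i _; rewrite pickleK_inv.
split => [i _|x y _ _ /(pcan_inj pickleK)//|n //].
by exists i.
Qed.

Lemma outer_bigcup_esum (I : countType) (A : I -> set R) :
  (mu (\bigcup_i A i) <= \esum_(i in [set: I]) mu (A i))%E.
Proof.
pose A' n := if pickle_inv n is Some i then A i else set0.
have -> : \bigcup_i A i = \bigcup_n A' n.
  apply/seteqP; split => [x [i _ Aix]|x [n _]].
    by exists (pickle i) => //; rewrite /A' pickleK_inv.
  by rewrite /A'; case: pickle_inv => // i Aix; exists i.
apply: le_trans (outer_measure_sigma_subadditive ((wlength idfun)^*)%mu A') _.
rewrite le_eqVlt; apply/orP; left; apply/eqP.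
rewrite -[RHS]nneseries_pickle; last by move=> i; exact: outer_measure_ge0.
by apply: eq_eseriesr => n _; rewrite /A'; case: pickle_inv => //; exact: outer_measure0.
Qed.

(** Countable subadditivity, in the form in which it serves to choose one translate of
    a grid that suits all its nodes. *)
Lemma outer_pigeonhole (I : countType) (A : I -> set R) (D : set R) :
  (\esum_(i in [set: I]) mu (A i) < mu D)%E -> exists2 x, D x & forall i, ~ A i x.
Proof.
move=> AD; apply: contrapT => /forall2NP DA.
have : (mu D <= mu (\bigcup_i A i))%E.
  apply: (le_outer_measure ((wlength idfun)^*)%mu) => x Dx.
  have [//|/existsNP[i /contrapT Aix]] := DA x; by exists i.
by move/le_trans => /(_ _ (outer_bigcup_esum A)); rewrite leNgt AD.
Qed.

End outer_lebesgue.

Section rearrangement_theory.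
Context {R : realType}.
Local Notation mu := (@lebesgue_measure R).
Implicit Types (g h : R -> \bar R) (t l c : R).

Lemma rearr_ge0 g t : (0 <= rearrangement g t)%E.
Proof.
by apply: le_ereal_inf_tmp => _ [l [l0 _] <-]; rewrite lee_fin ltW.
Qed.

Lemma rearr_nonpos g t : t <= 0 -> rearrangement g t = +oo%E.
Proof.
move=> t0; apply/ereal_inf_pinfty => _ [l [_ +] <-].
by rewrite ltNge (le_trans _ (measure_ge0 _ _))// lee_fin.
Qed.

Lemma rearr_lt g t l : (rearrangement g t < l%:E)%E ->
  (mu (`[0%R, 1%R] `&` [set x | l%:E < g x]) < t%:E)%E.
Proof.
move=> /ereal_inf_lt[_ [l' [l'0 +] <-]]; rewrite lte_fin => + l'l.
apply: le_lt_trans; apply: (le_outer_measure ((wlength idfun)^*)%mu) => x /= [-> lx].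
by split=> //; apply: lt_trans lx; rewrite lte_fin.
Qed.

Lemma rearr_le g t (B : \bar R) : (0 <= B)%E ->
  (forall l, 0 < l -> (B < l%:E)%E ->
    (mu (`[0%R, 1%R] `&` [set x | l%:E < g x]) < t%:E)%E) ->
  (rearrangement g t <= B)%E.
Proof.
case: B => [B|_ _|]; [move=> + gt|by rewrite leey|by []].
rewrite lee_fin => B0; apply/lee_addgt0Pr => e e0; apply: ereal_inf_lbound.
exists (B + e) => //=; split; first by rewrite ltr_wpDl.
by apply: gt; [rewrite ltr_wpDl|rewrite lte_fin ltrDl].
Qed.

Lemma rearr_le_ae g h (N : set R) t :
  mu (`[0%R, 1%R] `&` N) = 0%E ->
  (forall x, x \in `[0, 1] -> ~ N x -> (g x <= h x)%E) ->
  (rearrangement g t <= rearrangement h t)%E.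
Proof.
move=> N0 gh; apply: rearr_le; first exact: rearr_ge0.
move=> l l0 /rearr_lt; apply: le_lt_trans.
apply: (@le_trans _ _ (mu ((`[0%R, 1%R] `&` N) `|` (`[0%R, 1%R] `&` [set x | l%:E < h x]%E)))%E).
  apply: (le_outer_measure ((wlength idfun)^*)%mu) => x /= [x01 lx].
  have [Nx|Nx] := pselect (N x); first by left.
  by right; split => //; apply: lt_le_trans lx (gh _ _ _).
apply: le_trans (outer_measureU2 ((wlength idfun)^*)%mu _ _) _.
by rewrite [X in (X + _)%E]N0 add0e.
Qed.

Lemma rearr_mono g h t : (forall x, (g x <= h x)%E) ->
  (rearrangement g t <= rearrangement h t)%E.
Proof. by move=> gh; apply: (@rearr_le_ae _ _ set0); rewrite ?setI0 ?measure0. Qed.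

Lemma rearr_anti g s t : s <= t -> (rearrangement g t <= rearrangement g s)%E.
Proof.
move=> st; apply: rearr_le; first exact: rearr_ge0.
by move=> l l0 /rearr_lt/lt_le_trans; apply; rewrite lee_fin.
Qed.

Lemma rearrZ g t c : 0 < c ->
  rearrangement (fun x => c%:E * g x)%E t = (c%:E * rearrangement g t)%E.
Proof.
have le a k : 0 < a ->
    (rearrangement (fun x => a%:E * k x) t <= a%:E * rearrangement k t)%E.
  move=> a0; apply: rearr_le; first by rewrite mule_ge0 ?rearr_ge0// lee_fin ltW.
  move=> l l0; rewrite muleC -lte_pdivlMr// => /rearr_lt.
  congr (mu _ < _)%E; congr (_ `&` _); apply/seteqP.
  by split => x /=; rewrite EFinM lte_pdivrMr// muleC.
move=> c0; apply/eqP; rewrite eq_le le//=.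
rewrite -lee_pdivlMl//; apply: le_trans (le _ _ _); last by rewrite invr_gt0.
apply: rearr_mono => x.
by rewrite muleA -EFinM mulVf ?gt_eqF// mul1e.
Qed.

(** If g x > l then some G i x > l, so the level set of g at l is covered by those of
    the G i, of measures less than e i * t, which add up to at most t / 2. *)
Lemma rearr_sup (I : countType) (i0 : I) g (G : I -> R -> \bar R) (e : I -> R) t :
  (forall i, 0 < e i) -> (\esum_(i in [set: I]) (e i)%:E <= (2^-1)%:E)%E ->
  (forall x, x \in `[0, 1] -> (g x <= ereal_sup [set G i x | i in [set: I]])%E) ->
  (rearrangement g t <=
    ereal_sup [set rearrangement (G i) (e i * t)%R | i in [set: I]])%E.
Proof.
move=> e0 es gG.
have ub i : (rearrangement (G i) (e i * t)%R <=
    ereal_sup [set rearrangement (G i) (e i * t)%R | i in [set: I]])%E.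
  by apply: ereal_sup_ubound; exists i.
have [t0|t0] := leP t 0.
  by apply: le_trans (ub i0); rewrite !rearr_nonpos// pmulr_rle0.
apply: rearr_le; first exact: le_trans (rearr_ge0 _ _) (ub i0).
move=> l l0 Bl.
have Gl i := rearr_lt (le_lt_trans (ub i) Bl).
apply: (@le_lt_trans _ _ (mu (\bigcup_i (`[0%R, 1%R] `&` [set x | l%:E < G i x]%E)))).
  apply: (le_outer_measure ((wlength idfun)^*)%mu) => x /= [x01 lx].
  have /ereal_sup_gt[_ [i _ <-] lGi] := lt_le_trans lx (gG _ x01).
  by exists i.
apply: le_lt_trans (outer_bigcup_esum _) _.
apply: (@le_lt_trans _ _ (\esum_(i in [set: I]) (t%:E * (e i)%:E))%E).
  by apply: le_esum => i _; rewrite -EFinM mulrC ltW.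
apply: le_lt_trans (esumZl_le _ (ltW t0) _) _; first by move=> i; rewrite lee_fin ltW.
apply: (@le_lt_trans _ _ (t%:E * (2^-1)%:E)%E).
  by rewrite lee_pmul2l// lte_fin.
by rewrite -EFinM lte_fin gtr_pMr// invf_lt1// ltr1n.
Qed.

End rearrangement_theory.

(** * Iterated rearrangements *)

Section tuples.
Context {T : Type}.

Lemma tnth_upd m (x : m.-tuple T) j t i :
  tnth (upd x j t) i = if i == j then t else tnth x i.
Proof. by rewrite tnth_mktuple. Qed.

Lemma upd_upd m (x : m.-tuple T) j s t : upd (upd x j s) j t = upd x j t.
Proof.
by apply: eq_from_tnth => i; rewrite !tnth_upd; case: eqP.
Qed.

Lemma upd_cons0 m (x : m.-tuple T) s t :
  upd [tuple of s :: x] ord0 t = [tuple of t :: x].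
Proof.
apply: eq_from_tnth => i; rewrite tnth_upd.
by case: (unliftP ord0 i) => [k ->|->]; rewrite ?tnthS ?tnth0// eqxx.
Qed.

Lemma upd_consS m (x : m.-tuple T) s j t :
  upd [tuple of s :: x] (lift ord0 j) t = [tuple of s :: upd x j t].
Proof.
apply: eq_from_tnth => i; rewrite tnth_upd.
case: (unliftP ord0 i) => [k ->|->]; rewrite ?tnthS ?tnth0// tnth_upd.
by rewrite (inj_eq (@lift_inj _ _)).
Qed.

(** The common form of rearrangement_in, of the steps of iterate and of
    exceptional_step, so that one lemma peels off the first variable in all of them. *)
Definition coordinate_op m E (Phi : 'I_m -> (T -> E) -> T -> E)
    (F : m.-tuple T -> E) (j : 'I_m) : m.-tuple T -> E :=
  fun x => Phi j (fun t => F (upd x j t)) (tnth x j).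

Lemma foldl_coordinate_op_cons m E (Phi : 'I_m.+1 -> (T -> E) -> T -> E) F t
    (x : m.-tuple T) :
  foldl (coordinate_op Phi) F (enum 'I_m.+1) [tuple of t :: x] =
  foldl (coordinate_op (fun j => Phi (lift ord0 j)))
    (fun y => Phi ord0 (fun s => F [tuple of s :: y]) t) (enum 'I_m) x.
Proof.
rewrite enum_ordSl /=.
have step r G : foldl (coordinate_op Phi) G [seq lift ord0 j | j <- r] [tuple of t :: x] =
    foldl (coordinate_op (fun j => Phi (lift ord0 j)))
      (fun y => G [tuple of t :: y]) r x.
  elim: r G => [//|j r IH] G /=; rewrite IH; congr (foldl _ _ _ _).
  apply/funext => y; rewrite /coordinate_op tnthS; congr (Phi _ _ _).
  by apply/funext => s; rewrite upd_consS.
rewrite step; congr (foldl _ _ _ _); apply/funext => y.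
rewrite /coordinate_op tnth0; congr (Phi _ _ _).
by apply/funext => s; rewrite upd_cons0.
Qed.

Lemma iterate_cons m E (Phi : 'I_m.+1 -> (T -> E) -> E) F t (x : m.-tuple T) :
  iterate Phi [tuple of t :: x] F =
  iterate (fun j => Phi (lift ord0 j)) x
    (fun y => Phi ord0 (fun s => F [tuple of s :: y])).
Proof.
exact: (foldl_coordinate_op_cons (fun j g _ => Phi j g)).
Qed.

End tuples.

Section iterated_rearrangements.
Context {R : realType} {m : nat}.
Local Notation mu := (@lebesgue_measure R).
Implicit Types (F G : m.-tuple R -> \bar R) (x y : m.-tuple R) (j : 'I_m)
  (r : seq 'I_m).

(** If F <= G off Z, then the rearrangements in the j-th variable are comparable off
    this set. *)
Definition exceptional_step (Z : m.-tuple R -> Prop) j : m.-tuple R -> Prop :=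
  coordinate_op (fun _ (g : R -> Prop) _ => mu (`[0%R, 1%R] `&` g) <> 0%E) Z j.

Lemma foldl_rearr_ae F G Z r :
  (forall x, (forall j, j \in r -> tnth x j \in `[0, 1]) -> ~ Z x ->
    (F x <= G x)%E) ->
  forall x, ~ foldl exceptional_step Z r x ->
    (foldl rearrangement_in F r x <= foldl rearrangement_in G r x)%E.
Proof.
elim: r F G Z => [|j r IH] F G Z FG x /=; first exact: FG.
apply: IH => {}x xr /contrapT Z0.
rewrite /rearrangement_in; apply: rearr_le_ae Z0 _ => t t01 Zt.
apply: FG Zt => i; rewrite inE tnth_upd; case: eqP => //= _; exact: xr.
Qed.

Lemma foldl_rearrZ F c r : 0 < c ->
  foldl rearrangement_in (fun x => c%:E * F x)%E r =
  (fun x => c%:E * foldl rearrangement_in F r x)%E.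
Proof.
move=> c0; elim: r F => [//|j r IH] F /=; rewrite -IH; congr (foldl _ _ _).
by apply/funext => x; rewrite /rearrangement_in rearrZ.
Qed.

Lemma foldl_rearr_ge0 F r : (forall x, (0 <= F x)%E) ->
  forall x, (0 <= foldl rearrangement_in F r x)%E.
Proof.
elim: r F => [//|j r IH] F F0 x /=; apply: IH => {}x; exact: rearr_ge0.
Qed.

(** Each variable becomes monotone when it is rearranged and stays so in the later
    rearrangements. *)
Lemma foldl_rearr_anti F r x y :
  (forall i, i \in r -> tnth y i <= tnth x i) ->
  (forall i, i \notin r -> tnth y i = tnth x i) ->
  (foldl rearrangement_in F r x <= foldl rearrangement_in F r y)%E.
Proof.
suff gen (A : pred 'I_m) G : (forall x y, (forall i, A i -> tnth y i <= tnth x i) ->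
      (forall i, ~~ A i -> tnth y i = tnth x i) -> (G x <= G y)%E) ->
    (forall i, (A i || (i \in r)) -> tnth y i <= tnth x i) ->
    (forall i, ~~ (A i || (i \in r)) -> tnth y i = tnth x i) ->
    (foldl rearrangement_in G r x <= foldl rearrangement_in G r y)%E.
  apply: (gen pred0) => u v _ uv.
  by have -> : v = u by apply: eq_from_tnth => i; rewrite uv.
(* A is the set of the variables in which G is already nonincreasing. *)
elim: r A G => [|j r IH] A G GA /= Axy AxyC.
  by apply: GA => i Ai; [apply: Axy|apply: AxyC]; rewrite ?Ai// orbF.
apply: (IH (fun i => A i || (i == j))) => [u v uv uvC|i|i]; last 2 first.
- by rewrite -orbA -in_cons; exact: Axy.
- by rewrite -orbA -in_cons; exact: AxyC.
rewrite /rearrangement_in.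
apply: le_trans (rearr_anti _ (uv j _)) _; first by rewrite eqxx orbT.
apply: rearr_mono => t; apply: GA => i Ai; rewrite !tnth_upd; case: eqP => // ij.
  by apply: uv; rewrite Ai.
by apply: uvC; rewrite negb_or Ai; apply/eqP.
Qed.

Definition coordwise (s : 'I_m -> R -> R) x : m.-tuple R :=
  [tuple s i (tnth x i) | i < m].

Lemma tnth_coordwise s x i : tnth (coordwise s x) i = s i (tnth x i).
Proof. by rewrite tnth_mktuple. Qed.

Lemma rearr_in_sup (I : countType) (i0 : I) F (G : I -> m.-tuple R -> \bar R)
    (s : I -> 'I_m -> R -> R) (e : I -> R) j :
  (forall i, 0 < e i) -> (\esum_(i in [set: I]) (e i)%:E <= (2^-1)%:E)%E ->
  (forall i, s i j = id) -> forall x,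
  (forall t, t \in `[0, 1] -> (F (upd x j t) <=
    ereal_sup [set G i (coordwise (s i) (upd x j t)) | i in [set: I]])%E) ->
  (rearrangement_in F j x <= ereal_sup [set rearrangement_in (G i) j
    (coordwise (fun k => if k == j then *%R (e i) else s i k) x) | i in [set: I]])%E.
Proof.
move=> e0 es sj x FG; rewrite /rearrangement_in.
apply: le_trans (@rearr_sup R I i0 _ (fun i t => G i (coordwise (s i) (upd x j t))) e _ e0 es FG) _.
apply: ge_ereal_sup => _ [i _ <-]; apply: ereal_sup_ubound; exists i => //=.
rewrite tnth_coordwise eqxx; congr rearrangement; apply/funext => t; congr (G i _).
apply: eq_from_tnth => k; rewrite !(tnth_coordwise, tnth_upd).
by case: eqP => // ->; rewrite sj.
Qed.

(** Iterates rearr_sup over the variables in r. The map s i allows the functions under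
    the supremum to be evaluated at points with other coordinates outside r. *)
Lemma foldl_rearr_sup (I : countType) (i0 : I) F (G : I -> m.-tuple R -> \bar R)
    (s : I -> 'I_m -> R -> R) (e : I -> R) r :
  (forall i, 0 < e i) -> (\esum_(i in [set: I]) (e i)%:E <= (2^-1)%:E)%E ->
  uniq r -> (forall i j, j \in r -> s i j = id) ->
  (forall x, (forall j, j \in r -> tnth x j \in `[0, 1]) ->
    (F x <= ereal_sup [set G i (coordwise (s i) x) | i in [set: I]])%E) -> forall x,
  (foldl rearrangement_in F r x <= ereal_sup [set foldl rearrangement_in (G i) r
    (coordwise (fun k => if k \in r then *%R (e i) else s i k) x) | i in [set: I]])%E.
Proof.
move=> e0 es; elim: r F G s => [|j r IH] F G s /= => [_ _ FG x|].
  apply: le_trans (FG _ _) _; first by move=> j; rewrite in_nil.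
  apply: ge_ereal_sup => _ [i _ <-].
  by apply: ereal_sup_ubound; exists i.
move=> /andP[jr ur] sr FG x.
apply: le_trans (IH _ (fun i => rearrangement_in (G i) j)
  (fun i k => if k == j then *%R (e i) else s i k) ur _ _ _) _.
- move=> i k kr; case: eqP => [kj|_]; first by rewrite -kj kr in jr.
  by apply: sr; rewrite inE kr orbT.
- move=> {}x xr.
  apply: rearr_in_sup => // [i|t t01]; first by apply: sr; rewrite inE eqxx.
  apply: FG => k; rewrite inE tnth_upd; case: eqP => //= _; exact: xr.
apply: ge_ereal_sup => _ [i _ <-]; apply: ereal_sup_ubound; exists i => //=.
congr (foldl _ _ _ _); apply: eq_from_tnth => k; rewrite !tnth_coordwise inE.
by case: eqP => [->|]//=; rewrite (negbTE jr).
Qed.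

End iterated_rearrangements.

(** * Tonelli on tuples and null sections *)

Section tuple_measure.
Context {R : realType}.
Local Notation mu := (@lebesgue_measure R).
Local Notation mu_ n := (@lebesgue_tuple R n).

Lemma measurable_cons_pair m : measurable_fun [set: measurableTypeR R * m.-tuple R]
  (fun p => [tuple of p.1 :: p.2] : m.+1.-tuple R).
Proof. by apply: measurable_cons => //; exact: measurable_fst. Qed.

Lemma measurable_cons1 m (x : m.-tuple R) : measurable_fun [set: measurableTypeR R]
  (fun t => [tuple of t :: x] : m.+1.-tuple R).
Proof. by apply: measurable_cons. Qed.

Lemma tonelli_cons m (F : m.+1.-tuple R -> \bar R) : measurable_fun [set: m.+1.-tuple R] F ->
  (forall x, (0 <= F x)%E) ->
  (\int[mu_ m.+1]_x F x = \int[mu_ m]_x \int[mu]_t F [tuple of t :: x])%E /\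
  (\int[mu_ m.+1]_x F x = \int[mu]_t \int[mu_ m]_x F [tuple of t :: x])%E.
Proof.
move=> mF F0.
have -> : (\int[mu_ m.+1]_x F x = \int[mu \x mu_ m]_p F [tuple of p.1 :: p.2])%E.
  pose nu : {measure set (measurableTypeR R * m.-tuple R)%type -> \bar R} :=
    (@lebesgue_measure R \x mu_ m)%E.
  have := @ge0_integral_pushforward _ _ _ _ _ _ (@measurable_cons_pair m)
    nu setT F measurableT mF (fun x _ => F0 x).
  by rewrite preimage_setT.
have mF' : measurable_fun setT (fun p : measurableTypeR R * m.-tuple R => F [tuple of p.1 :: p.2]).
  exact: measurableT_comp mF (@measurable_cons_pair m).
split; first by rewrite (fubini_tonelli2 _ mF').
by rewrite (fubini_tonelli1 _ mF').
Qed.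

Lemma lebesgue_tuple_section m (A : set (m.+1.-tuple R)) : measurable A ->
  (mu_ m.+1 A = \int[mu_ m]_x mu [set t | A [tuple of t :: x]])%E /\
  measurable_fun setT (fun x : m.-tuple R => mu [set t | A [tuple of t :: x]]).
Proof.
move=> mA.
pose B := [set p : measurableTypeR R * m.-tuple R | A [tuple of p.1 :: p.2]].
have mB : measurable B.
  have := @measurable_cons_pair m measurableT A mA.
  by rewrite setTI.
have BE x : ysection B x = [set t | A [tuple of t :: x]].
  by apply/seteqP; split => t; rewrite /ysection /= inE.
split; last first.
  have := measurable_fun_ysection (@lebesgue_measure R) mB.
  by apply: eq_measurable_fun => x _ /=; rewrite BE.
have -> : (mu_ m.+1 A = \int[mu_ m.+1]_x (\1_A x)%:E)%E.
  by rewrite integral_indic// setIT.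
have [|//|-> _] := @tonelli_cons m (fun x => (\1_A x)%:E).
  by apply/measurable_EFinP.
apply: eq_integral => x _.
rewrite -BE.
have -> : (mu (ysection B x) = \int[mu]_t (\1_(ysection B x) t)%:E)%E.
  by rewrite integral_indic ?setIT//; exact: measurable_ysection.
by apply: eq_integral => t _; rewrite BE.
Qed.

(** By Tonelli, almost every section of a null set in the first variable is null;
    hence the first exceptional step leads again to a null set, in one variable less. *)
Lemma exceptional_null m (N : set (m.-tuple R)) (Z : m.-tuple R -> Prop) :
  measurable N -> mu_ m N = 0%E ->
  (forall x, Z x -> N [tuple (2 * pi) * tnth x i | i < m]) ->
  forall x, ~ foldl exceptional_step Z (enum 'I_m) x.
Proof.
elim: m N Z => [|m IH] N Z mN N0 ZN x.
  rewrite enum_ord0 /= => /ZN; rewrite (tuple0 (mktuple _)) => Nt.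
  move: N0; rewrite /lebesgue_tuple /= diracE mem_set// => /eqP.
  by rewrite eqe oner_eq0.
rewrite (tuple_eta x) foldl_coordinate_op_cons.
have [muN mS] := lebesgue_tuple_section mN.
pose N' := [set x : m.-tuple R | mu [set t | N [tuple of t :: x]] != 0%E].
have pi2 : 0 < 2 * pi :> R by rewrite mulr_gt0// pi_gt0.
have N'E : N' = [set: m.-tuple R] `&` [set x : m.-tuple R | mu [set t | N [tuple of t :: x]] != 0%E].
  by rewrite setTI.
apply: (IH N').
- by rewrite N'E; exact: emeasurable_neq.
- apply/eqP; rewrite -measure_le0 leNgt; apply/negP => N'0.
  move: muN; rewrite N0 => /esym/eqP; apply/negP; rewrite gt_eqF//.
  rewrite lt_def integral_ge0 ?andbT//.
  apply/negP => /eqP I0.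
  have : ae_eq (mu_ m) setT (fun x : m.-tuple R => mu [set t | N [tuple of t :: x]]) (cst 0%E).
    apply/ae_eq_integral_abs => //.
    by under eq_integral do rewrite gee0_abs//.
  move=> [N2 [mN2 N20 sN2]].
  move: N'0; apply/negP; rewrite -leNgt -N20; apply: le_measure; rewrite ?inE//.
    by rewrite N'E; exact: emeasurable_neq.
  by move=> y /= /eqP yN; apply: sN2 => /= /(_ I).
move=> y; apply: contra_notP => /negP/negPn/eqP N'0.
apply/eqP; rewrite -measure_le0.
pose f (s : R) := (2 * pi)^-1 * s + 0.
rewrite (@le_trans _ _ (mu (f @` [set t | N [tuple of t :: [tuple (2 * pi) * tnth y i | i < m]]])))//.
  apply: (le_outer_measure ((wlength idfun)^*)%mu) => t [_ /ZN Nt].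
  exists (2 * pi * t); last by rewrite /f addr0 mulrA mulVf ?mul1r// gt_eqF.
  rewrite /=; congr N: Nt; apply: eq_from_tnth => i; rewrite tnth_mktuple.
  by case: (unliftP ord0 i) => [k ->|->]; rewrite ?tnthS ?tnth0// tnth_mktuple.
apply: le_trans (lebesgue_affine_le _ _ _) _; first by rewrite invr_gt0.
by rewrite N'0 mule0.
Qed.

End tuple_measure.

(** * Integrals bounded by iterated rearrangements *)

Section integral_bound.
Context {R : realType}.
Local Notation mu := (@lebesgue_measure R).
Local Notation mu_ n := (@lebesgue_tuple R n).

Lemma nneseries_ub (a : nat -> \bar R) (B : \bar R) : (forall k, (0 <= a k)%E) ->
  (forall n, (\sum_(0 <= k < n) a k <= B)%E) -> (\sum_(0 <= k <oo) a k <= B)%E.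
Proof.
move=> a0 aB; apply: lime_le; first exact: is_cvg_nneseries.
by apply: nearW.
Qed.

Lemma nneseries_term (a : nat -> \bar R) n : (forall k, (0 <= a k)%E) ->
  (a n <= \sum_(0 <= k <oo) a k)%E.
Proof.
move=> a0; apply: le_trans (nneseries_lim_ge n.+1 _) => //.
by rewrite big_nat_recr//= leeDr// sume_ge0.
Qed.

Lemma geometric_half : (\sum_(0 <= k <oo) (2^-1 ^+ k)%:E <= 2%:E :> \bar R)%E.
Proof.
apply: nneseries_ub => [k|n]; first by rewrite lee_fin exprn_ge0.
rewrite sumEFin lee_fin.
suff : \sum_(0 <= k < n) (2^-1 ^+ k) = 2 - 2 * 2^-1 ^+ n :> R.
  by move=> ->; rewrite gerBl mulr_ge0// exprn_ge0.
elim: n => [|n IH]; first by rewrite big_nil expr0; ring.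
by rewrite big_nat_recr//= IH exprS; field.
Qed.

(** The set where g exceeds by d its rearrangement at 2^-(k+1) has measure at most pi
    2^-k, and off the intersection of these sets g is bounded by one of the levels. *)
Lemma ge0_integral_le_rearr (g : measurableTypeR R -> \bar R) :
  measurable_fun setT g -> (forall x, (0 <= g x)%E) ->
  (\int[mu]_(x in `[0%R, (2 * pi)%R]) g x <=
   (2 * pi)%:E * \sum_(0 <= k <oo) (2^-1 ^+ k)%:E *
     rearrangement (fun s => g (2 * pi * s)%R) (2^-1 ^+ k.+1))%E.
Proof.
move=> mg g0; have pi2 : 0 < 2 * pi :> R by rewrite mulr_gt0// pi_gt0.
pose r k := rearrangement (fun s => g (2 * pi * s)) (2^-1 ^+ k.+1).
have r0 k : (0 <= r k)%E by exact: rearr_ge0.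
have p0 k : (0 <= (2^-1 ^+ k)%:E :> \bar R)%E by rewrite lee_fin exprn_ge0.
apply/lee_addgt0Pr => e e0.
pose d := e / (2 * pi) / 2.
have d0 : 0 < d by rewrite !divr_gt0.
pose L k := (r k + d%:E)%E.
have L0 k : (0 <= L k)%E by rewrite adde_ge0// lee_fin ltW.
pose E k : set (measurableTypeR R) := `[0%R, (2 * pi)%R] `&` [set x | (L k < g x)%E].
have mE k : measurable (E k).
  by apply: emeasurable_fun_o_infty => //; exact: measurable_funTS.
have muE k : (mu (E k) <= (2 * pi * 2^-1 ^+ k.+1)%:E)%E.
  have [rk|rk] := eqVneq (r k) +oo%E.
    rewrite (_ : E k = set0) ?measure0 ?lee_fin ?mulr_ge0 ?exprn_ge0 ?pi_ge0//.
    by rewrite -subset0 => x [_ /=]; rewrite /L rk addye// ltNge leey.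
  have rfin : r k \is a fin_num by rewrite ge0_fin_numE// ltey.
  have : (r k < (fine (r k) + d)%:E)%E by rewrite EFinD fineK// lteDl// lte_fin.
  move=> /rearr_lt; rewrite EFinD fineK// => rE.
  pose f (s : R) := 2 * pi * s + 0.
  apply: (@le_trans _ _ (mu (f @` (`[0%R, 1%R] `&` [set x | (r k + d%:E < g (2 * pi * x)%R)%E])))%E).
    apply: (le_outer_measure ((wlength idfun)^*)%mu) => x [/=].
    rewrite in_itv/= => /andP[x0 x1] Lx; exists (x / (2 * pi)).
      split => /=; last by rewrite mulrC divfK ?gt_eqF.
      by rewrite in_itv/= divr_ge0 ?pi_ge0//= ?mulr_ge0 ?pi_ge0// ler_pdivrMr// mul1r.
    by rewrite /f addr0 mulrC divfK// gt_eqF.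
  apply: le_trans (lebesgue_affine_le _ _ pi2) _.
  by rewrite [leRHS]EFinM lee_pmul2l ?lte_fin// ltW.
pose h k := if k is k'.+1 then (fun x => L k * (\1_(E k') x)%:E)%E else cst (L 0%N).
have h0 k x : (0 <= h k x)%E by case: k => [|k]; rewrite /h; [exact: L0|rewrite mule_ge0// lee_fin].
have mh k : measurable_fun (`[0%R, (2 * pi)%R]%classic : set (measurableTypeR R)) (h k).
  case: k => [|k]; rewrite /h; first exact: measurable_cst.
  apply: emeasurable_funM => //; apply/measurable_EFinP; apply: measurable_funTS.
  exact: measurable_indic.
have Ih k : (\int[mu]_(x in `[0%R, (2 * pi)%R]) h k x <= (2 * pi)%:E * ((2^-1 ^+ k)%:E * L k))%E.
  case: k => [|k].
    rewrite integral_cst//= lebesgue_measure_itv/= lte_fin pi2 oppr0 adde0.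
    by rewrite expr0 mul1e muleC.
  rewrite /h ge0_integralZl//; last first.
    by apply/measurable_EFinP; apply: measurable_funTS; exact: measurable_indic.
  rewrite integral_indic// muleA muleC; apply: lee_pmul => //.
  rewrite -EFinM; apply: le_trans (muE k).
  by apply: (le_outer_measure ((wlength idfun)^*)%mu); exact: subIsetl.
apply: (@le_trans _ _ (\int[mu]_(x in `[0%R, (2 * pi)%R]) \sum_(0 <= k <oo) h k x)%E).
  apply: ae_ge0_le_integral => //.
  - exact: measurable_funTS.
  - by move=> x _; exact: nneseries_ge0.
  - exact: ge0_emeasurable_sum.
  - exists (\bigcap_k E k); split.
    + exact: bigcapT_measurable.
    + apply/eqP; rewrite -measure_le0; apply/lee_addgt0Pr => a a0.
      rewrite add0e; pose k := Num.truncn (a^-1 * (2 * pi)).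
      apply: (@le_trans _ _ (mu (E k))).
        by apply: (le_outer_measure ((wlength idfun)^*)%mu); exact: bigcap_inf.
      apply: le_trans (muE k) _; rewrite lee_fin exprVn ler_pdivrMr ?exprn_gt0//.
      rewrite -ler_pdivrMl// (le_trans (ltW (truncnS_gt _)))//.
      by rewrite -(natrX R 2) ler_nat ltnW// ltn_expl.
    + move=> x /= /not_implyP[x01]; apply: contra_notP => /existsNP[k0 Ek0].
      have /ex_minnP[k /asboolP Ek kmin] : exists k, `[< ~ E k x >].
        by exists k0; apply/asboolP => Ek; apply: Ek0.
      have gk : (g x <= L k)%E.
        by rewrite leNgt; apply/negP => Lg; apply: Ek; split.
      suff : (L k <= h k x)%E.
        by move=> Lh; apply: le_trans gk (le_trans Lh _); exact: nneseries_term.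
      case: k Ek kmin gk => [|k] Ek kmin gk; rewrite /h//.
      rewrite indicE mem_set ?mule1//; apply: contrapT => nEk.
      by have := kmin k; rewrite asboolT// ltnn => /(_ isT).
rewrite integral_nneseries//.
apply: (@le_trans _ _ (\sum_(0 <= k <oo) (2 * pi)%:E * ((2^-1 ^+ k)%:E * L k))%E).
  by apply: lee_nneseries => // k _ _; apply: integral_ge0.
rewrite nneseriesZl; last by move=> k _; rewrite mule_ge0.
under eq_eseriesr do rewrite /L ge0_muleDr// ?lee_fin ?(ltW d0)//.
rewrite nneseriesD; last 2 first.
  by move=> k _; rewrite mule_ge0// r0.
  by move=> k _; rewrite mule_ge0// lee_fin ltW.
rewrite ge0_muleDr; last 2 first.
  by apply: nneseries_ge0 => k _ _; rewrite mule_ge0// r0.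
  by apply: nneseries_ge0 => k _ _; rewrite mule_ge0// lee_fin ltW.
apply: leeD2l.
under eq_eseriesr do rewrite muleC.
rewrite nneseriesZl// muleA; apply: (@le_trans _ _ ((2 * pi)%:E * d%:E * 2%:E)%E).
  apply: lee_pmul => //; [| |exact: geometric_half].
    by rewrite -EFinM lee_fin mulr_ge0 ?ltW.
  exact: nneseries_ge0.
rewrite -!EFinM lee_fin /d.
have half (a b : R) : b != 0 -> b * (a / b / 2) * 2 = a by move=> b0; field.
by rewrite half// gt_eqF.
Qed.

End integral_bound.

Section torus_tonelli.
Context {R : realType}.
Local Notation mu := (@lebesgue_measure R).
Local Notation mu_ n := (@lebesgue_tuple R n).

(** The infimum over real levels is an infimum over rational ones, hence a countable
    infimum of measurable functions. *)
Lemma measurable_rearr_section m (F : m.+1.-tuple R -> \bar R) u :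
  measurable_fun [set: m.+1.-tuple R] F ->
  measurable_fun [set: m.-tuple R]
    (fun x : m.-tuple R => rearrangement (fun s => F [tuple of 2 * pi * s :: x]) u).
Proof.
move=> mF.
pose A (q : R) : set (measurableTypeR R * m.-tuple R) := [set p : measurableTypeR R * m.-tuple R |
  p.1 \in `[0, 1] /\ (q%:E < F [tuple of (2 * pi * p.1)%R :: p.2])%E].
have mA q : measurable (A q).
  rewrite (_ : A q = fst @^-1` `[0%R, 1%R] `&`
    [set p : measurableTypeR R * m.-tuple R | (q%:E < F [tuple of (2 * pi * p.1)%R :: p.2])%E]); last first.
    by apply/seteqP; split.
  apply: measurableI.
    by rewrite -[X in measurable X]setTI; apply: measurable_fst.
  rewrite -[X in measurable X]setTI; apply: emeasurable_fun_o_infty => //.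
  apply: (measurableT_comp mF); apply: measurable_cons => //.
  exact: measurable_funM (measurable_cst _) measurable_fst.
have yA q x : ysection (A q) x =
    `[0%R, 1%R] `&` [set s | (q%:E < F [tuple of (2 * pi * s)%R :: x])%E].
  by apply/seteqP; split => s; rewrite /ysection /= inE.
pose h n (x : m.-tuple R) : \bar R := if unpickle n is Some q then
  if (0 < (q : rat)) && (mu (ysection (A (ratr q)) x) < u%:E)%E then (ratr q)%:E else +oo%E
  else +oo%E.
have mh n : measurable_fun setT (h n).
  rewrite /h; case: unpickle => [q|]; last exact: measurable_cst.
  apply: measurable_fun_ifT => //.
  case: (0 < q) => //=; apply: (measurable_fun_bool true).
  rewrite [X in measurable X](_ : _ = setT `&`
    [set x : m.-tuple R | (mu (ysection (A (ratr q)) x) < u%:E)%E]); last first.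
    by apply/seteqP; split.
  by apply: emeasurable_fun_infty_o => //; exact: measurable_fun_ysection.
have -> : (fun x : m.-tuple R => rearrangement (fun s => F [tuple of 2 * pi * s :: x]) u) =
    (fun x => einfs (h ^~ x) 0).
  apply/funext => x; apply/eqP; rewrite eq_le; apply/andP; split.
    apply: le_ereal_inf_tmp => _ [n _ <-]; rewrite /h.
    case: unpickle => [q|]; last by rewrite leey.
    case: ifPn => [/andP[q0]|_]; last by rewrite leey.
    rewrite yA => qu; apply: ereal_inf_lbound; exists (ratr q) => //; split => //.
    by rewrite /= ltr0q.
  apply: le_ereal_inf_tmp => _ [l [/= l0 lu] <-]; apply/lee_addgt0Pr => e e0.
  have /rat_in_itvoo[q] : l < l + e by rewrite ltrDl.
  rewrite in_itv/= => /andP[lq qe].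
  apply: (@le_trans _ _ (ratr q)%:E); last by rewrite lee_fin ltW.
  apply: ereal_inf_lbound; exists (pickle q) => //; rewrite /h pickleK.
  rewrite -(ltr0q R) (lt_trans l0 lq) yA /= ifT//.
  apply: le_lt_trans lu; apply: (le_outer_measure ((wlength idfun)^*)%mu) => s /= [-> qs].
  by split => //; apply: lt_trans qs; rewrite lte_fin.
exact: measurable_fun_einfs.
Qed.

Lemma torus_cons m (t : R) (x : m.-tuple R) :
  torus [tuple of t :: x] <-> t \in `[0, 2 * pi] /\ torus x.
Proof.
split=> [tx|[t0 tx] j].
  split; first by have := tx ord0; rewrite tnth0.
  by move=> j; have := tx (lift ord0 j); rewrite tnthS.
by case: (unliftP ord0 j) => [k ->|->]; rewrite ?tnthS ?tnth0//; exact: tx.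
Qed.

Lemma measurable_torus m : measurable (@torus R m).
Proof.
rewrite (_ : torus = \bigcap_(j in [set: 'I_m])
    ((fun x : m.-tuple R => tnth x j) @^-1` `[0, 2 * pi])); last first.
  by apply/seteqP; split => [x tx j _|x tx j]; [exact: tx|exact: (tx j)].
apply: fin_bigcap_measurable => // j _.
rewrite -[X in measurable X]setTI; exact: measurable_tnth.
Qed.

Lemma tonelli_torus_cons m (F : m.+1.-tuple R -> \bar R) :
  measurable_fun [set: m.+1.-tuple R] F -> (forall x, (0 <= F x)%E) ->
  (\int[mu_ m.+1]_(x in torus) F x = \int[mu_ m]_(x in torus)
    \int[mu]_(t in `[0%R, (2 * pi)%R]) F [tuple of t :: x])%E.
Proof.
move=> mF F0; rewrite integral_mkcond.
have mT := measurable_torus.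
have [||-> _] := @tonelli_cons R m (F \_ torus).
- by apply: (measurable_restrictT F (@measurable_torus m.+1)).1; apply: measurable_funTS.
- by move=> x; rewrite patchE; case: ifP.
rewrite [RHS]integral_mkcond; apply: eq_integral => x _.
rewrite patchE; case: ifPn => [/set_mem xT|/negP xT].
  rewrite [RHS]integral_mkcond; apply: eq_integral => t _.
  rewrite !patchE; case: ifPn => [/set_mem/torus_cons[tT _]|/negP tT].
    by rewrite ifT// inE.
  rewrite ifF//; apply/negP; rewrite inE => t01; apply: tT; apply/mem_set.
  exact/torus_cons.
apply: integral0_eq => t _; rewrite patchE ifF//; apply/negP => /set_mem/torus_cons[_ xT'].
by apply: xT; rewrite inE.
Qed.

End torus_tonelli.

Section integral_weak_bound.
Context {R : realType}.
Local Notation mu := (@lebesgue_measure R).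
Local Notation mu_ n := (@lebesgue_tuple R n).

Lemma dilate_cons m (s : R) (y : m.-tuple R) :
  [tuple 2 * pi * tnth [tuple of s :: y] i | i < m.+1] =
  [tuple of 2 * pi * s :: [tuple 2 * pi * tnth y i | i < m]].
Proof.
apply: eq_from_tnth => i; rewrite tnth_mktuple.
by case: (unliftP ord0 i) => [k ->|->]; rewrite ?tnthS ?tnth0// tnth_mktuple.
Qed.

Lemma measurable_integral_param d (T : measurableType d)
    (f : measurableTypeR R * T -> \bar R) (D : set R) (E : set T) :
  measurable_fun setT f -> (forall x, (0 <= f x)%E) ->
  measurable (D : set (measurableTypeR R)) ->
  measurable_fun E (fun x => \int[mu]_(t in D) f (t, x))%E.
Proof.
move=> mf f0 mD; apply: measurable_funTS.
pose g (p : measurableTypeR R * T) := (f p * (\1_D p.1)%:E)%E.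
have mg : measurable_fun setT g.
  apply: emeasurable_funM => //.
  apply/measurable_EFinP; apply: measurableT_comp measurable_fst.
  exact: measurable_indic.
have g0 x : (0 <= g x)%E by rewrite mule_ge0// lee_fin.
have := @measurable_fun_fubini_tonelli_G _ _ _ _ R (@lebesgue_measure R) g mg g0.
apply: eq_measurable_fun => x _.
rewrite [RHS]integral_mkcond; apply: eq_integral => t _.
by rewrite patchE /g indicE/=; case: ifP => _; rewrite ?mule1 ?mule0.
Qed.

Lemma measurable_integral_section m (F : m.+1.-tuple R -> \bar R) (D : set R) :
  measurable_fun [set: m.+1.-tuple R] F -> (forall x, (0 <= F x)%E) ->
  measurable (D : set (measurableTypeR R)) ->
  forall E, measurable_fun E (fun x : m.-tuple R => \int[mu]_(t in D) F [tuple of t :: x])%E.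
Proof.
move=> mF F0 mD E; apply: (@measurable_integral_param _ _
  (fun p : measurableTypeR R * m.-tuple R => F [tuple of p.1 :: p.2])) => //.
exact: measurableT_comp mF (@measurable_cons_pair R m).
Qed.

(** Induction on the dimension: the integral in the first variable is bounded by a
    series of rearrangements in that variable, and each of them satisfies a bound of
    the same kind in the other variables. *)
Lemma integral_le_weak_bound m (F : m.-tuple R -> \bar R) (A : R)
    (q : 'I_m -> R -> R) (S : 'I_m -> R) :
  measurable_fun [set: m.-tuple R] F -> (forall x, (0 <= F x)%E) -> 0 <= A ->
  (forall j (u : R), 0 < u -> u <= 1 -> 0 <= q j u) -> (forall j, 0 <= S j) ->
  (forall j, (\sum_(0 <= k <oo) (2^-1 ^+ k * q j (2^-1 ^+ k.+1))%:E <= (S j)%:E)%E) ->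
  (forall t : m.-tuple R, (forall j, 0 < tnth t j <= 1) ->
    (foldl rearrangement_in (fun x => F [tuple (2 * pi * tnth x i)%R | i < m]) (enum 'I_m) t
     <= (A * \prod_j q j (tnth t j))%:E)%E) ->
  (\int[mu_ m]_(x in torus) F x <= (A * \prod_(j < m) (2 * pi * S j))%:E)%E.
Proof.
have pi2 : 0 < 2 * pi :> R by rewrite mulr_gt0// pi_gt0.
elim: m F A q S => [|m IH] F A q S mF F0 A0 q0 S0 qS Fq.
  rewrite [torus](_ : _ = setT); last by apply/seteqP; split => // x _ [].
  have /= -> := @integral_dirac _ _ [tuple] R setT measurableT F mF.
  rewrite diracT mul1e big_ord0 mulr1.
  have := Fq [tuple] (fun j => ltac:(by case: j)).
  by rewrite enum_ord0 /= big_ord0 mulr1 (tuple0 (mktuple _)).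
rewrite tonelli_torus_cons//.
pose u k : R := 2^-1 ^+ k.+1.
have u01 k : 0 < u k <= 1 
  by apply/andP; split; [apply: exprn_gt0; lra|apply: exprn_ile1; lra].
pose G k (x : m.-tuple R) := rearrangement (fun s => F [tuple of 2 * pi * s :: x]) (u k).
have mG k : measurable_fun setT (G k) by exact: measurable_rearr_section.
have G0 k x : (0 <= G k x)%E by exact: rearr_ge0.
have p0 k : (0 <= (2^-1 ^+ k)%:E :> \bar R)%E by rewrite lee_fin exprn_ge0.
have mT := @measurable_torus R m.
apply: (@le_trans _ _ (\int[mu_ m]_(x in torus) ((2 * pi)%:E * \sum_(0 <= k <oo) (2^-1 ^+ k)%:E * G k x))%E).
  have mFc : measurable_fun setT (fun p : measurableTypeR R * m.-tuple R => F [tuple of p.1 :: p.2]).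
    exact: measurableT_comp mF (@measurable_cons_pair R m).
  apply: ge0_le_integral => //.
  - by move=> x _; apply: integral_ge0.
  - exact: measurable_integral_section.
  - apply: emeasurable_funM => //; apply: measurable_funTS.
    apply: ge0_emeasurable_sum => [k x _ _|k]; first by rewrite mule_ge0.
    by move=> _; exact: emeasurable_funM.
  - move=> x _; apply: ge0_integral_le_rearr => //.
    exact: measurableT_comp mF (measurable_cons1 x).
have mpG k : measurable_fun torus (fun x => (2^-1 ^+ k)%:E * G k x)%E.
  by apply: measurable_funTS; apply: emeasurable_funM.
rewrite ge0_integralZl//; last 3 first.
- by apply: ge0_emeasurable_sum => // k x _ _; rewrite mule_ge0.
- by move=> x _; apply: nneseries_ge0 => k _ _; rewrite mule_ge0.
- by rewrite lee_fin ltW.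
rewrite integral_nneseries//; last by move=> k x _; rewrite mule_ge0.
pose P := \prod_(j < m) (2 * pi * S (lift ord0 j)).
have P0 : 0 <= P by apply: prodr_ge0 => j _; rewrite mulr_ge0// ltW.
apply: (@le_trans _ _ ((2 * pi)%:E * \sum_(0 <= k <oo) (A * P)%:E * (2^-1 ^+ k * q ord0 (u k))%:E)%E).
  apply: lee_pmul => //; first by rewrite lee_fin ltW.
    by apply: nneseries_ge0 => k _ _; apply: integral_ge0 => x _; rewrite mule_ge0.
  apply: lee_nneseries => [k _ _|k _]; first by apply: integral_ge0 => x _; rewrite mule_ge0.
  rewrite ge0_integralZl//; last exact: measurable_funTS.
  rewrite -EFinM mulrCA EFinM; apply: lee_pmul => //; first exact: integral_ge0.
  have -> : A * P * q ord0 (u k) = A * q ord0 (u k) * P by ring.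
  have /andP[uk0 uk1] := u01 k.
  apply: (IH _ _ (fun j => q (lift ord0 j))) => //.
  - by rewrite mulr_ge0// q0.
  - by move=> j v; exact: q0.
  - move=> t t01.
    have := Fq [tuple of u k :: t].
    have -> : \prod_j q j (tnth [tuple of u k :: t] j) =
        q ord0 (u k) * \prod_j q (lift ord0 j) (tnth t j).
      rewrite big_ord_recl tnth0; congr (_ * _).
      by apply: eq_bigr => j _; rewrite tnthS.
    rewrite (@foldl_coordinate_op_cons R m _ (fun _ => rearrangement)) mulrA.
    have -> : (fun y : m.-tuple R => rearrangement (fun s : R => F [tuple (2 * pi *
        tnth [tuple of s :: y] i)%R | i < m.+1]) (u k)) =
        (fun x => G k [tuple (2 * pi * tnth x i)%R | i < m]).
      apply/funext => y; congr rearrangement; apply/funext => s.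
      by rewrite dilate_cons.
    apply => j.
    by case: (unliftP ord0 j) => [i ->|->]; rewrite ?tnthS ?tnth0.
rewrite nneseriesZl; last by move=> k _; rewrite lee_fin mulr_ge0 ?exprn_ge0// q0; case/andP: (u01 k).
have -> : A * \prod_(j < m.+1) (2 * pi * S j) = 2 * pi * (A * P * S ord0).
  by rewrite big_ord_recl -/P; ring.
rewrite [leRHS]EFinM lee_pmul2l ?lte_fin// [leRHS]EFinM; apply: lee_pmul => //.
- by rewrite lee_fin mulr_ge0.
- by apply: nneseries_ge0 => k _ _; rewrite lee_fin mulr_ge0 ?exprn_ge0// q0; case/andP: (u01 k).
Qed.

End integral_weak_bound.

(** * Lebesgue measurable functions and their Borel representatives *)

Section nonmeasurable_integrals.
Context d (T : measurableType d) (R : realType) (nu : {measure set T -> \bar R}).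
Local Open Scope ereal_scope.

(** The integral of a nonnegative function is a supremum over the simple functions
    below it, hence monotone on all functions. *)
Lemma ge0_le_integral_nm (D : set T) (f g : T -> \bar R) :
  (forall x, D x -> 0 <= f x) -> (forall x, D x -> f x <= g x) ->
  \int[nu]_(x in D) f x <= \int[nu]_(x in D) g x.
Proof.
move=> f0 fg; have g0 x : D x -> 0 <= g x by move=> Dx; exact: le_trans (f0 _ Dx) (fg _ Dx).
rewrite !ge0_integralE//; apply: ereal_sup_le => _ [h hf <-]; exists h => //= x.
apply: le_trans (hf x) _; rewrite !patchE; case: ifPn => // /set_mem; exact: fg.
Qed.

(** f lies between the two measurable functions that agree with f0 off N and are 0,
    respectively +oo, on N. *)
Lemma ge0_integral_ae_nm (D N : set T) (f f0 : T -> \bar R) :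
  measurable D -> measurable N -> nu N = 0 -> measurable_fun D f0 ->
  (forall x, D x -> 0 <= f0 x) -> (forall x, D x -> 0 <= f x) ->
  (forall x, D x -> ~ N x -> f x = f0 x) ->
  \int[nu]_(x in D) f x = \int[nu]_(x in D) f0 x.
Proof.
move=> mD mN N0 mf0 f00 fpos ff0.
have aeN : {ae nu, forall x, D x -> ~ N x}.
  by exists N; split => // x /=; apply: contra_notP.
have mind (A : set T) : measurable A -> measurable_fun D (fun x => (\1_A x)%:E : \bar R).
  by move=> mA; apply/measurable_EFinP; exact: measurable_indic.
(* lo and hi agree with f0 off N, and are 0 and +oo on N. *)
pose lo x := f0 x * (\1_(~` N) x)%:E.
pose hi x := f0 x + +oo * (\1_N x)%:E.
have mlo : measurable_fun D lo by apply: emeasurable_funM => //; apply: mind; exact: measurableC.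
have mhi : measurable_fun D hi.
  by apply: emeasurable_funD => //; apply: emeasurable_funM => //; exact: mind.
have lo0 x : D x -> 0 <= lo x by move=> Dx; rewrite mule_ge0 ?f00// lee_fin.
have hi0 x : D x -> 0 <= hi x by move=> Dx; rewrite adde_ge0 ?f00// mule_ge0// lee_fin.
have Elo : \int[nu]_(x in D) lo x = \int[nu]_(x in D) f0 x.
  apply: ge0_ae_eq_integral => //; move: aeN; apply: filterS => x NDx Dx.
  by rewrite /lo indicE mem_set ?mule1//; exact: NDx.
have Ehi : \int[nu]_(x in D) hi x = \int[nu]_(x in D) f0 x.
  apply: ge0_ae_eq_integral => //; move: aeN; apply: filterS => x NDx Dx.
  by rewrite /hi indicE memNset ?mule0 ?adde0//; exact: NDx.
apply/eqP; rewrite eq_le; apply/andP; split.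
  rewrite -Ehi; apply: ge0_le_integral_nm => // x Dx.
  rewrite /hi indicE; have [Nx|Nx] := pselect (N x).
    by rewrite mem_set// mule1 addey ?leey// -ltNye (lt_le_trans _ (f00 _ Dx)).
  by rewrite memNset// mule0 adde0 ff0.
rewrite -Elo; apply: ge0_le_integral_nm => // x Dx.
rewrite /lo indicE; have [Nx|Nx] := pselect (N x).
  by rewrite memNset ?mule0 ?fpos//= => /(_ Nx).
by rewrite mem_set// mule1 ff0.
Qed.

Lemma integral_ae_nm (D N : set T) (f f0 : T -> \bar R) :
  measurable D -> measurable N -> nu N = 0 -> measurable_fun D f0 ->
  (forall x, D x -> ~ N x -> f x = f0 x) ->
  \int[nu]_(x in D) f x = \int[nu]_(x in D) f0 x.
Proof.
move=> mD mN N0 mf0 ff0; rewrite integralE [RHS]integralE; congr (_ - _).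
  apply: (@ge0_integral_ae_nm D N) => //; first exact: measurable_funepos.
  by move=> x Dx Nx; rewrite !funeposE ff0.
apply: (@ge0_integral_ae_nm D N) => //; first exact: measurable_funeneg.
by move=> x Dx Nx; rewrite !funenegE ff0.
Qed.

(** The sets that are Borel up to a null set form a sigma-algebra. *)
Lemma completed_measurable_borel (A : set T) :
  (completed_algebra_gen nu).-sigma.-measurable A ->
  exists B N, [/\ measurable B, measurable N, nu N = 0 &
    forall x, ~ N x -> (A x <-> B x)].
Proof.
move: A; suff H : <<s completed_algebra_gen nu >> `<=` [set A | exists B N,
    [/\ measurable B, measurable N, nu N = 0 & forall x, ~ N x -> (A x <-> B x)]].
  exact: H.
apply: smallest_sub => /=.
  split.
  - by exists set0, set0; split.
  - move=> A [B [N [mB mN N0 AB]]]; exists (~` B), N; split => //.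
      exact: measurableC.
    by move=> x /AB [AB1 AB2]; rewrite setTD; split => [nA /AB2//|nB /AB1].
  - move=> A /choice[B /choice[N BN]].
    exists (\bigcup_n B n), (\bigcup_n N n); split.
    + by apply: bigcupT_measurable => n; have [] := BN n.
    + by apply: bigcupT_measurable => n; have [] := BN n.
    + apply/measure_negligible; first by apply: bigcupT_measurable => n; have [] := BN n.
      apply: negligible_bigcup => n.
      by have [_ mN N0 _] := BN n; exists (N n); split.
    + move=> x Nx; split=> -[n _ Anx]; exists n => //; have [_ _ _ /(_ x)] := BN n.
        by case=> [|+ _]; [move=> Nnx; apply: Nx; exists n|exact].
      by case=> [|_]; [move=> Nnx; apply: Nx; exists n|exact].
move=> _ [B mB [N [N' [mN' N'0 NN']]] <-]; exists B, N'; split => // x N'x.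
by split=> [[//|/NN']//|Bx]; left.
Qed.

(** It suffices to correct f on the null sets attached to its countably many level
    sets at rational levels. *)
Lemma completed_measurable_fun_ae_borel (D : set T) (f : T -> R) :
  measurable D -> completed_measurable_fun nu D f ->
  exists (f0 : T -> R) N, [/\ measurable_fun setT f0, measurable N, nu N = 0 &
    forall x, D x -> ~ N x -> f x = f0 x].
Proof.
move=> mD mf.
have mDc : (completed_algebra_gen nu).-sigma.-measurable D.
  apply: sub_sigma_algebra; exists D => //; exists set0; last by rewrite setU0.
  exact: negligible_set0.
pose q n : R := ratr (odflt (0%R : rat) (unpickle n)).
have /choice[B /choice[N BN]] n : exists B N, [/\ measurable B, measurable N, nu N = 0 &
    forall x, ~ N x -> ((D `&` f @^-1` `]-oo, q n[%classic) x <-> B x)].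
  apply: completed_measurable_borel; exact: (mf mDc).
pose NN := \bigcup_n N n.
have mNN : measurable NN by apply: bigcupT_measurable => n; have [] := BN n.
have NN0 : nu NN = 0.
  apply/measure_negligible => //; apply: negligible_bigcup => n.
  by have [_ mN N0 _] := BN n; exists (N n); split.
exists (f \_ (D `\` NN)), NN; split => //; last first.
  by move=> x Dx Nx; rewrite patchE mem_set//.
have mDN : measurable (D `\` NN) by exact: measurableD.
apply/(measurable_restrictT _ mDN).1.
apply: (measurability _ (RGenInftyO.measurableE R)) => // _ [_ [r ->] <-].
rewrite (_ : _ `&` _ = (D `\` NN) `&` \bigcup_(n in [set n | (q n <= r)%R]) B n).
  apply: measurableI => //; apply: bigcup_measurable => n _.
  by have [] := BN n.
apply/seteqP; split => [x [[Dx Nx] /=]|x [[Dx Nx] [n /= qr Bx]]].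
  rewrite in_itv/= => fr; split => //.
  have /rat_in_itvoo[p] := fr; rewrite in_itv/= => /andP[fp pr].
  have qp : q (pickle p) = ratr p by rewrite /q pickleK.
  exists (pickle p); first by rewrite /= qp ltW.
  have [_ _ _ /(_ x)[|+ _]] := BN (pickle p).
    by move=> Npx; apply: Nx; exists (pickle p).
  by apply; split => //=; rewrite qp in_itv.
split => //=; have [_ _ _ /(_ x)[|_ /(_ Bx)[_ /=]]] := BN n.
  by move=> Nnx; apply: Nx; exists n.
by rewrite !in_itv/= => /lt_le_trans; exact.
Qed.

End nonmeasurable_integrals.

(** * Integration over the torus in one direction *)

Section coordinate_tonelli.
Context {R : realType}.
Local Notation mu := (@lebesgue_measure R).
Local Notation mu_ n := (@lebesgue_tuple R n).
Let pi2 : 0 < 2 * pi :> R. Proof. by rewrite mulr_gt0// pi_gt0. Qed.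

Lemma measurable_upd m (j : 'I_m) :
  measurable_fun [set: measurableTypeR R * m.-tuple R]
    (fun p => upd p.2 j p.1 : m.-tuple R).
Proof.
apply/measurable_fun_tnthP => i.
rewrite (_ : _ \o _ = fun p => if i == j then p.1 else tnth p.2 i); last first.
  by apply/funext => p /=; rewrite tnth_upd.
case: (i == j); first exact: measurable_fst.
exact: measurableT_comp (measurable_tnth i) measurable_snd.
Qed.

Lemma tonelli_torus_cons_swap m (F : m.+1.-tuple R -> \bar R) :
  measurable_fun [set: m.+1.-tuple R] F -> (forall x, (0 <= F x)%E) ->
  (\int[mu_ m.+1]_(x in torus) F x = \int[mu]_(t in `[0%R, (2 * pi)%R])
    \int[mu_ m]_(x in torus) F [tuple of t :: x])%E.
Proof.
move=> mF F0; rewrite integral_mkcond.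
have [||_ ->] := @tonelli_cons R m (F \_ torus).
- by apply: (measurable_restrictT F (@measurable_torus R m.+1)).1; apply: measurable_funTS.
- by move=> x; rewrite patchE; case: ifP.
rewrite [RHS]integral_mkcond; apply: eq_integral => t _.
rewrite patchE; case: ifPn => [/set_mem tT|/negP tT].
  rewrite [RHS]integral_mkcond; apply: eq_integral => x _.
  rewrite !patchE; case: ifPn => [/set_mem/torus_cons[_ xT]|/negP xT].
    by rewrite ifT// inE.
  rewrite ifF//; apply/negP; rewrite inE => t01; apply: xT; apply/mem_set.
  exact/torus_cons.
apply: integral0_eq => x _; rewrite patchE ifF//; apply/negP => /set_mem/torus_cons[tT' _].
by apply: tT; rewrite inE.
Qed.

(** The inner integral does not depend on the j-th coordinate of x, whose integration
    gives the factor 2 pi. *)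
Lemma integral_torus_upd m (F : m.-tuple R -> \bar R) (j : 'I_m) :
  measurable_fun [set: m.-tuple R] F -> (forall x, (0 <= F x)%E) ->
  (\int[mu_ m]_(x in torus) \int[mu]_(t in `[0%R, (2 * pi)%R]) F (upd x j t) =
   (2 * pi)%:E * \int[mu_ m]_(x in torus) F x)%E.
Proof.
elim: m F j => [|m IH] F j mF F0; first by case: j.
have mupd i : measurable_fun [set: m.+1.-tuple R]
    (fun x => \int[mu]_(t in `[0%R, (2 * pi)%R]) F (upd x i t))%E.
  apply: (@measurable_integral_param _ _ _ (fun p => F (upd p.2 i p.1))) => //.
  exact: measurableT_comp mF (measurable_upd i).
have I0 i x : (0 <= \int[mu]_(t in `[0%R, (2 * pi)%R]) F (upd x i t))%E.
  by apply: integral_ge0.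
case: (unliftP ord0 j) => [i ->|->].
  rewrite tonelli_torus_cons_swap//.
  have mFt t : measurable_fun setT (fun x : m.-tuple R => F [tuple of t :: x]).
    by apply: (measurableT_comp mF); apply: measurable_cons.
  transitivity (\int[mu]_(t in `[0%R, (2 * pi)%R])
      ((2 * pi)%:E * \int[mu_ m]_(x in torus) F [tuple of t :: x]))%E.
    apply: eq_integral => t _; rewrite -(IH (fun x => F [tuple of t :: x]) i)//.
    by apply: eq_integral => x _; apply: eq_integral => u _; rewrite upd_consS.
  have mFc : measurable_fun setT (fun p : measurableTypeR R * m.-tuple R =>
      (F [tuple of p.1 :: p.2] * (\1_(@torus R m) p.2)%:E)%E).
    apply: emeasurable_funM; first exact: measurableT_comp mF (@measurable_cons_pair R m).
    apply/measurable_EFinP; apply: measurableT_comp measurable_snd.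
    exact: measurable_indic (@measurable_torus R m).
  rewrite ge0_integralZl//; last 3 first.
  - apply: measurable_funTS.
    have := @measurable_fun_fubini_tonelli_F _ _ _ _ R (mu_ m) _ mFc.
    move=> /(_ (fun x => ltac:(by rewrite mule_ge0// lee_fin))).
    apply: eq_measurable_fun => t _; rewrite [RHS]integral_mkcond.
    apply: eq_integral => x _; rewrite patchE indicE/=.
    by case: ifP => _; rewrite ?mule1 ?mule0.
  - by move=> t _; apply: integral_ge0.
  - by rewrite lee_fin ltW.
  by rewrite tonelli_torus_cons_swap.
rewrite !tonelli_torus_cons//.
transitivity (\int[mu_ m]_(x in torus)
    ((2 * pi)%:E * \int[mu]_(t in `[0%R, (2 * pi)%R]) F [tuple of t :: x]))%E.
  apply: eq_integral => x _.
  transitivity (\int[mu]_(s in `[0%R, (2 * pi)%R])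
    (cst (\int[mu]_(t in `[0%R, (2 * pi)%R]) F [tuple of t :: x]) s))%E.
    by apply: eq_integral => t _; apply: eq_integral => u _; rewrite upd_cons0.
  by rewrite integral_cst//= lebesgue_measure_itv/= lte_fin pi2 oppr0 adde0 muleC.
rewrite ge0_integralZl//.
- exact: measurable_torus.
- by apply: (measurable_integral_section mF).
- by move=> t _; apply: integral_ge0.
- by rewrite lee_fin ltW.
Qed.
End coordinate_tonelli.

Section torus_means.
Context {R : realType}.
Local Notation mu := (@lebesgue_measure R).
Local Notation mu_ n := (@lebesgue_tuple R n).
Let pi2 : 0 < 2 * pi :> R. Proof. by rewrite mulr_gt0// pi_gt0. Qed.

Lemma sin_cos_period (n : int) (x : R) :
  sin (x + n%:~R * (2 * pi)) = sin x /\ cos (x + n%:~R * (2 * pi)) = cos x.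
Proof.
have nat (k : nat) (y : R) : sin (y + k%:R * (2 * pi)) = sin y /\ cos (y + k%:R * (2 * pi)) = cos y.
  have -> : k%:R * (2 * pi) = (pi *+ 2) *+ k :> R.
    by rewrite mulr_natl; congr (_ *+ _); rewrite mulr_natl.
  by rewrite (periodicn (@sinD2pi R)) (periodicn (@cosD2pi R)).
case: n => k; first exact: nat.
have [] := nat k.+1 (x + (Negz k)%:~R * (2 * pi)).
rewrite NegzE rmorphN /= mulNr subrK.
by [].
Qed.

Lemma integral_cos_period (a : R) (n : int) : n != 0 ->
  (\int[mu]_(t in `[0%R, (2 * pi)%R]) (cos (a + n%:~R * t))%:E = 0)%E.
Proof.
move=> n0; pose N : R := n%:~R.
have N0 : N != 0 by rewrite intr_eq0.
pose F t : R := N^-1 * sin (a + N * t).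
have dl (t : R) : is_derive t 1 (fun t : R => a + N * t) N.
  have H1 := @is_derive_cst R R^o R^o a t 1; have H2 := @is_derive_id R R^o t 1.
  have := is_deriveD H1 (is_deriveZ N H2).
  by rewrite add0r /GRing.scale /= mulr1.
have dF (t : R) : is_derive t 1 F (cos (a + N * t)).
  have -> : cos (a + N * t) = N^-1 *: (cos (a + N * t) * N) :> R.
    by rewrite /GRing.scale /=; field.
  have H := @is_derive1_comp R (@sin R) (fun t : R => a + N * t) t _ _ (is_derive_sin _) (dl t).
  exact: (is_deriveZ N^-1 H).
have cF (t : R) : {for t, continuous F}.
  by apply/differentiable_continuous/derivable1_diffP; have [] := dF t.
rewrite (@continuous_FTC2 _ _ F)//.
- by rewrite /F mulr0 addr0 (sin_cos_period n a).1 -EFinB subrr.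
- apply: continuous_subspaceT => t.
  have dcl : {for t, continuous (fun t : R => a + N * t)}.
    by apply/differentiable_continuous/derivable1_diffP; have [] := dl t.
  exact: (@continuous_comp R R R (fun t : R => a + N * t) (@cos R) t dcl (@continuous_cos R _)).
- split; first by move=> t _; have [] := dF t.
  + exact/cvg_at_right_filter/cF.
  + exact/cvg_at_left_filter/cF.
- by move=> t _; rewrite derive1E; exact: derive_val.
Qed.

Lemma integral_sin_period (a : R) (n : int) : n != 0 ->
  (\int[mu]_(t in `[0%R, (2 * pi)%R]) (sin (a + n%:~R * t))%:E = 0)%E.
Proof.
move=> n0; rewrite -(integral_cos_period (a - pi / 2) n0).
by apply: eq_integral => t _; rewrite -cosBpihalf addrAC.
Qed.

Lemma torus_volume m : mu_ m (@torus R m) = ((2 * pi) ^+ m)%:E.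
Proof.
have -> : mu_ m (@torus R m) = (\int[mu_ m]_(x in torus) 1)%E.
  by rewrite integral_cst ?mul1e//; exact: measurable_torus.
elim: m => [|m IH].
  rewrite integral_cst ?mul1e; last exact: measurable_torus.
  by rewrite /= diracE mem_set// => -[].
rewrite tonelli_torus_cons//.
transitivity (\int[mu_ m]_(x in torus) ((2 * pi)%:E * 1))%E.
  apply: eq_integral => x _.
  by rewrite integral_cst//= lebesgue_measure_itv/= lte_fin pi2 oppr0 adde0 mul1e mule1.
rewrite ge0_integralZl ?lee_fin ?(ltW pi2)//; last exact: measurable_torus.
by rewrite IH exprS EFinM.
Qed.

(** The positive and the negative part of u have the same integral in the j-th
    variable, hence the same integral. *)
Lemma integral_torus_mean_zero m (u : m.-tuple R -> R) (j : 'I_m) :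
  measurable_fun [set: m.-tuple R] u ->
  (mu_ m).-integrable torus (EFin \o u) ->
  {ae mu_ m, forall x, torus x ->
    (\int[mu]_(t in `[0%R, (2 * pi)%R]) (u (upd x j t))%:E = 0)%E} ->
  (\int[mu_ m]_(x in torus) (u x)%:E = 0)%E.
Proof.
move=> mu0 iu u0.
pose up := ((EFin \o u)^\+)%E; pose un := ((EFin \o u)^\-)%E.
have mup : measurable_fun setT up by apply: measurable_funepos; exact/measurable_EFinP.
have mun : measurable_fun setT un by apply: measurable_funeneg; exact/measurable_EFinP.
have up0 x : (0 <= up x)%E by exact: funepos_ge0.
have un0 x : (0 <= un x)%E by exact: funeneg_ge0.
have mT := @measurable_torus R m.
have mI (F : m.-tuple R -> \bar R) : measurable_fun setT F -> (forall x, (0 <= F x)%E) ->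
    measurable_fun torus (fun x => \int[mu]_(t in `[0%R, (2 * pi)%R]) F (upd x j t))%E.
  move=> mF F0; apply: (@measurable_integral_param _ _ _ (fun p => F (upd p.2 j p.1))) => //.
  exact: measurableT_comp mF (measurable_upd j).
rewrite integralE -/up -/un.
suff -> : (\int[mu_ m]_(x in torus) up x = \int[mu_ m]_(x in torus) un x)%E.
  by rewrite subee//; exact: integrable_neg_fin_num.
have E : (\int[mu_ m]_(x in torus) \int[mu]_(t in `[0%R, (2 * pi)%R]) up (upd x j t) =
    \int[mu_ m]_(x in torus) \int[mu]_(t in `[0%R, (2 * pi)%R]) un (upd x j t))%E.
  apply: ge0_ae_eq_integral => //; [exact: mI|exact: mI| | |].
  - by move=> x _; apply: integral_ge0.
  - by move=> x _; apply: integral_ge0.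
  move: u0; apply: filterS => x ux /ux; rewrite integralE.
  rewrite (_ : ((fun t => (u (upd x j t))%:E)^\+)%E = fun t => up (upd x j t)); last first.
    by apply/funext => t; rewrite /up !funeposE.
  rewrite (_ : ((fun t => (u (upd x j t))%:E)^\-)%E = fun t => un (upd x j t)); last first.
    by apply/funext => t; rewrite /un !funenegE.
  have : (0 <= \int[mu]_(t in `[0%R, (2 * pi)%R]) up (upd x j t))%E by apply: integral_ge0.
  have : (0 <= \int[mu]_(t in `[0%R, (2 * pi)%R]) un (upd x j t))%E by apply: integral_ge0.
  move: (integral _ _ _) (integral _ _ _) => [a| |] [b| |]//=.
  by move=> _ _ /eqP; rewrite -EFinB eqe subr_eq0 => /eqP ->.
move: E; rewrite !integral_torus_upd// => /(congr1 (fun z => ((2 * pi)^-1%:E * z)%E)).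
by rewrite !muleA -!EFinM mulVf ?gt_eqF// !mul1e.
Qed.

End torus_means.

(** * Uniqueness of Fourier coefficients *)

Section trigonometric_polynomials.
Context {R : realType} {m : nat}.
Local Notation mu := (@lebesgue_measure R).
Local Notation mu_m := (@lebesgue_tuple R m).
Let pi2 : 0 < 2 * pi :> R. Proof. by rewrite mulr_gt0// pi_gt0. Qed.

(** Only the closure properties matter below, whence an inductive predicate instead of
    finite sums of coefficients. *)
Inductive trig_poly : (m.-tuple R -> R) -> Prop :=
| trig_cos k : trig_poly (fun x => cos (pairing k x))
| trig_sin k : trig_poly (fun x => sin (pairing k x))
| trig_add P Q : trig_poly P -> trig_poly Q -> trig_poly (fun x => P x + Q x)
| trig_scale a P : trig_poly P -> trig_poly (fun x => a * P x).

Lemma pairingD k l (x : m.-tuple R) :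
  pairing [tuple tnth k j + tnth l j | j < m] x = pairing k x + pairing l x.
Proof.
rewrite /pairing -big_split /=; apply: eq_bigr => j _.
by rewrite tnth_mktuple intrD mulrDl.
Qed.

Lemma pairingB k l (x : m.-tuple R) :
  pairing [tuple tnth k j - tnth l j | j < m] x = pairing k x - pairing l x.
Proof.
rewrite /pairing -sumrB; apply: eq_bigr => j _.
by rewrite tnth_mktuple rmorphB mulrBl.
Qed.

Lemma pairing0 (x : m.-tuple R) : pairing [tuple 0 | _ < m] x = 0.
Proof. by rewrite /pairing big1// => j _; rewrite tnth_mktuple mul0r. Qed.

Lemma measurable_pairing k : measurable_fun [set: m.-tuple R] (pairing k).
Proof.
rewrite /pairing; apply: measurable_sum => j.
by apply: measurable_funM => //; exact: measurable_tnth.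
Qed.

Lemma trig_cst a : trig_poly (fun=> a).
Proof.
have -> : (fun=> a) = (fun x : m.-tuple R => a * cos (pairing [tuple 0 | _ < m] x)).
  by apply/funext => x; rewrite pairing0 cos0 mulr1.
by apply: trig_scale; exact: trig_cos.
Qed.

(** By the product-to-sum formulas. *)
Lemma trig_mul P Q : trig_poly P -> trig_poly Q -> trig_poly (fun x => P x * Q x).
Proof.
have ext (A B : m.-tuple R -> R) : A =1 B -> trig_poly A -> trig_poly B.
  by move=> /funext ->.
move=> tP; elim: tP Q => {P}[k|k|P P' _ IHP _ IHP'|a P _ IH] Q tQ.
- elim: tQ => {Q}[l|l|Q Q' _ IHQ _ IHQ'|a Q _ IH].
  + apply: (ext (fun x => 2^-1 * (cos (pairing [tuple tnth k j - tnth l j | j < m] x) +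
      cos (pairing [tuple tnth k j + tnth l j | j < m] x)))).
      by move=> x; rewrite pairingB pairingD cosB cosD; field.
    by apply: trig_scale; apply: trig_add; exact: trig_cos.
  + apply: (ext (fun x => 2^-1 * (sin (pairing [tuple tnth k j + tnth l j | j < m] x) +
      (-1) * sin (pairing [tuple tnth k j - tnth l j | j < m] x)))).
      by move=> x; rewrite pairingB pairingD sinB sinD; field.
    by apply: trig_scale; apply: trig_add; [|apply: trig_scale]; exact: trig_sin.
  + apply: (ext (fun x => cos (pairing k x) * Q x + cos (pairing k x) * Q' x)).
      by move=> x; rewrite mulrDr.
    exact: trig_add.
  + apply: (ext (fun x => a * (cos (pairing k x) * Q x))); last exact: trig_scale.
    by move=> x; rewrite mulrCA.
- elim: tQ => {Q}[l|l|Q Q' _ IHQ _ IHQ'|a Q _ IH].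
  + apply: (ext (fun x => 2^-1 * (sin (pairing [tuple tnth k j + tnth l j | j < m] x) +
      sin (pairing [tuple tnth k j - tnth l j | j < m] x)))).
      by move=> x; rewrite pairingB pairingD sinB sinD; field.
    by apply: trig_scale; apply: trig_add; exact: trig_sin.
  + apply: (ext (fun x => 2^-1 * (cos (pairing [tuple tnth k j - tnth l j | j < m] x) +
      (-1) * cos (pairing [tuple tnth k j + tnth l j | j < m] x)))).
      by move=> x; rewrite pairingB pairingD cosB cosD; field.
    by apply: trig_scale; apply: trig_add; [|apply: trig_scale]; exact: trig_cos.
  + apply: (ext (fun x => sin (pairing k x) * Q x + sin (pairing k x) * Q' x)).
      by move=> x; rewrite mulrDr.
    exact: trig_add.
  + apply: (ext (fun x => a * (sin (pairing k x) * Q x))); last exact: trig_scale.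
    by move=> x; rewrite mulrCA.
- apply: (ext (fun x => P x * Q x + P' x * Q x)); first by move=> x; rewrite mulrDl.
  by apply: trig_add; [exact: IHP|exact: IHP'].
- apply: (ext (fun x => a * (P x * Q x))); first by move=> x; rewrite mulrA.
  by apply: trig_scale; exact: IH.
Qed.

Lemma trig_exp P n : trig_poly P -> trig_poly (fun x => P x ^+ n).
Proof.
move=> tP; elim: n => [|n IH]; first exact: trig_cst.
have -> : (fun x => P x ^+ n.+1) = (fun x => P x * P x ^+ n).
  by apply/funext => x; rewrite exprS.
exact: trig_mul.
Qed.

Lemma trig_prod (r : seq 'I_m) (P : 'I_m -> m.-tuple R -> R) :
  (forall j, trig_poly (P j)) -> trig_poly (fun x => \prod_(j <- r) P j x).
Proof.
move=> tP; elim: r => [|j r IH].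
  have -> : (fun x => \prod_(j <- [::]) P j x) = (fun=> 1).
    by apply/funext => x; rewrite big_nil.
  exact: trig_cst.
have -> : (fun x => \prod_(i <- j :: r) P i x) = (fun x => P j x * \prod_(i <- r) P i x).
  by apply/funext => x; rewrite big_cons.
exact: trig_mul.
Qed.

Lemma trig_poly_bounded P : trig_poly P ->
  measurable_fun [set: m.-tuple R] P /\ exists2 B, 0 <= B & forall x, `|P x| <= B.
Proof.
elim=> {P}[k|k|P Q _ [mP [B B0 PB]] _ [mQ [B' B'0 QB]]|a P _ [mP [B B0 PB]]].
- split; last by exists 1 => // x; rewrite cos_max.
  exact: measurableT_comp (continuous_measurable_fun (@continuous_cos R)) (measurable_pairing k).
- split; last by exists 1 => // x; rewrite sin_max.
  exact: measurableT_comp (continuous_measurable_fun (@continuous_sin R)) (measurable_pairing k).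
- split; first exact: measurable_funD.
  exists (B + B'); first by rewrite addr_ge0.
  by move=> x; rewrite (le_trans (ler_normD _ _))// lerD.
- split; first exact: measurable_funM.
  exists (`|a| * B); first by rewrite mulr_ge0.
  by move=> x; rewrite normrM ler_wpM2l.
Qed.

Lemma integrable_mul_bounded (u P : m.-tuple R -> R) (B : R) :
  mu_m.-integrable torus (EFin \o u) -> measurable_fun [set: m.-tuple R] P ->
  (forall x, `|P x| <= B) -> mu_m.-integrable torus (fun x => (u x * P x)%:E).
Proof.
move=> iu mP PB.
have bP : [bounded P x | x in torus].
  exists B; split; first exact: num_real.
  by move=> M BM x _ /=; rewrite (le_trans (PB x))// ltW.
exact: (integrableMl (@measurable_torus R m) iu (measurable_funTS mP) bP).
Qed.

Lemma integral_trig_poly (u : m.-tuple R -> R) P :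
  mu_m.-integrable torus (EFin \o u) ->
  (forall k, \int[mu_m]_(x in torus) (u x * cos (pairing k x))%:E = 0)%E ->
  (forall k, \int[mu_m]_(x in torus) (u x * sin (pairing k x))%:E = 0)%E ->
  trig_poly P -> (\int[mu_m]_(x in torus) (u x * P x)%:E = 0)%E.
Proof.
move=> iu uc us; have mT := @measurable_torus R m.
have iuP P' : trig_poly P' -> mu_m.-integrable torus (fun x => (u x * P' x)%:E).
  by move=> /trig_poly_bounded[mP' [B _ PB]]; exact: integrable_mul_bounded mP' PB.
elim=> {P}[k|k|P Q tP IHP tQ IHQ|a P tP IHP] //.
- under eq_integral do rewrite mulrDr EFinD.
  by rewrite (integralD mT (iuP _ tP) (iuP _ tQ)) IHP IHQ adde0.
- under eq_integral do rewrite mulrCA EFinM.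
  by rewrite (integralZl mT (iuP _ tP)) IHP mule0.
Qed.

End trigonometric_polynomials.

Section step_approximation.
Context {R : realType}.

Lemma cvg_expr_half (z : R) : 0 <= z -> z < 1 -> z ^+ n @[n --> \oo] --> (0 : R).
Proof. by move=> z0 z1; apply: cvg_expr; rewrite ger0_norm. Qed.

Lemma bernoulli_le (t : R) n : -1 <= t -> 1 + n%:R * t <= (1 + t) ^+ n.
Proof.
move=> t1; elim: n => [|n IH]; first by rewrite mul0r addr0 expr0.
rewrite exprS; apply: (@le_trans _ _ ((1 + t) * (1 + n%:R * t))); last first.
  by rewrite ler_wpM2l//; lra.
have : 0 <= n%:R * t ^+ 2 by rewrite mulr_ge0// sqr_ge0.
by rewrite -natr1; nra.
Qed.

(** For y between 0 and 1, this tends to 1 if y < 1/2 and to 0 if y > 1/2, which turns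
    polynomials into indicators. *)
Definition step_poly n (y : R) : R := (1 - y ^+ n) ^+ (2 ^ n).

Lemma step_poly01 n y : 0 <= y -> y <= 1 -> 0 <= step_poly n y <= 1.
Proof.
move=> y0 y1; have : 0 <= 1 - y ^+ n <= 1.
  by rewrite subr_ge0 exprn_ile1//= gerBl exprn_ge0.
by move=> /andP[a b]; rewrite exprn_ge0//= exprn_ile1.
Qed.

Lemma step_poly_lt y : 0 <= y -> y < 2^-1 -> step_poly n y @[n --> \oo] --> (1 : R).
Proof.
move=> y0 y1; have y2 : 2 * y < 1 by lra.
apply: (@squeeze_cvgr _ _ _ _ (fun n => 1 - (2 * y) ^+ n) (fun=> 1)).
- apply: nearW => n; apply/andP; split; last by case/andP: (@step_poly01 n y y0 ltac:(lra)).
  have := @bernoulli_le (- y ^+ n) (2 ^ n).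
  rewrite natrX mulrN -exprMn; apply.
  by rewrite lerN2 exprn_ile1//; lra.
- rewrite -[X in _ --> X]subr0; apply: cvgB; first exact: cvg_cst.
  by apply: cvg_expr_half => //; lra.
- exact: cvg_cst.
Qed.

Lemma step_poly_gt y : 2^-1 < y -> y <= 1 -> step_poly n y @[n --> \oo] --> (0 : R).
Proof.
move=> y0 y1; have y2 : 1 < 2 * y by lra.
apply: (@squeeze_cvgr _ _ _ _ (fun=> 0) (fun n => ((2 * y)^-1) ^+ n)).
- apply: nearW => n; apply/andP; split; first by case/andP: (@step_poly01 n y ltac:(lra) y1).
  have yn : 0 <= y ^+ n <= 1 by rewrite exprn_ge0 ?exprn_ile1//; lra.
  have B := @bernoulli_le (y ^+ n) (2 ^ n) ltac:(lra).
  rewrite natrX -exprMn in B.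
  rewrite exprVn -[leRHS]mul1r ler_pdivlMr; last by rewrite exprn_gt0//; lra.
  apply: (@le_trans _ _ (step_poly n y * (1 + y ^+ n) ^+ (2 ^ n))).
    apply: ler_wpM2l; first by case/andP: (@step_poly01 n y ltac:(lra) y1).
    by apply: le_trans B; rewrite lerDr.
  rewrite /step_poly -exprMn exprn_ile1//; nra.
- exact: cvg_cst.
- apply: cvg_expr_half; first by rewrite invr_ge0; lra.
  by rewrite invf_lt1//; lra.
Qed.

(** A trigonometric polynomial of degree one with values between 0 and 1, less than
    1/2 exactly on the arc between 0 and a. *)
Definition arc_fun (a x : R) : R := 2^-1 - (cos (x - a / 2) - cos (a / 2)) / 4.

Lemma arc_fun01 a x : 0 <= arc_fun a x <= 1.
Proof.
rewrite /arc_fun; have := cos_geN1 (x - a / 2); have := cos_le1 (x - a / 2).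
by have := cos_geN1 (a / 2); have := cos_le1 (a / 2); lra.
Qed.

Lemma arc_fun_lt a x : 0 < a -> a <= 2 * pi -> 0 < x -> x < a -> arc_fun a x < 2^-1.
Proof.
move=> a0 a2 x0 xa; rewrite /arc_fun.
suff : cos (a / 2) < cos (x - a / 2) by lra.
rewrite -cos_norm.
have n1 : `|x - a / 2| < a / 2 by rewrite ltr_norml; lra.
rewrite -(cos_norm (x - a / 2)) (ger0_norm (_ : 0 <= a / 2)); last lra.
rewrite ltr_cos ?in_itv//= ?normr_ge0//=; lra.
Qed.

Lemma arc_fun_gt a x : 0 < a -> a < x -> x < 2 * pi -> 2^-1 < arc_fun a x.
Proof.
move=> a0 ax x2; rewrite /arc_fun.
suff : cos (x - a / 2) < cos (a / 2) by lra.
have [xpi|xpi] := leP (x - a / 2) pi.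
  by rewrite ltr_cos ?in_itv//=; lra.
have -> : cos (x - a / 2) = cos (2 * pi - (x - a / 2)).
  rewrite -(sin_cos_period (-1) (x - a / 2)).2 -cosN; congr cos.
  by rewrite rmorphN1; ring.
rewrite ltr_cos ?in_itv//=; lra.
Qed.

End step_approximation.

Section box_approximation.
Context {R : realType} {m : nat}.
Local Notation mu := (@lebesgue_measure R).
Local Notation mu_m := (@lebesgue_tuple R m).
Let pi2 : 0 < 2 * pi :> R. Proof. by rewrite mulr_gt0// pi_gt0. Qed.

Definition frequency (j : 'I_m) : m.-tuple int := [tuple (i == j)%:Z | i < m].

Lemma pairing_frequency j (x : m.-tuple R) : pairing (frequency j) x = tnth x j.
Proof.
rewrite /pairing (bigD1 j)//= big1 => [|i ij]; rewrite tnth_mktuple.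
  by rewrite eqxx mul1r addr0.
by rewrite (negbTE ij) mul0r.
Qed.

Lemma trig_arc_fun a j : trig_poly (fun x : m.-tuple R => arc_fun a (tnth x j)).
Proof.
have -> : (fun x : m.-tuple R => arc_fun a (tnth x j)) = (fun x =>
    (2^-1 + cos (a / 2) / 4) + (- cos (a / 2) / 4 * cos (pairing (frequency j) x) +
      (- sin (a / 2) / 4) * sin (pairing (frequency j) x))).
  by apply/funext => x; rewrite pairing_frequency /arc_fun cosB; ring.
apply: trig_add; first exact: trig_cst.
by apply: trig_add; apply: trig_scale; [exact: trig_cos|exact: trig_sin].
Qed.

Lemma trig_step_poly n P : trig_poly P ->
  trig_poly (fun x : m.-tuple R => step_poly n (P x)).
Proof.
move=> tP; apply: trig_exp.
have -> : (fun x => 1 - P x ^+ n) = (fun x : m.-tuple R => 1 + (-1) * P x ^+ n).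
  by apply/funext => x; rewrite mulN1r.
by apply: trig_add; [exact: trig_cst|apply: trig_scale; exact: trig_exp].
Qed.

Lemma torus_hyperplane_null (j : 'I_m) c :
  mu_m (torus `&` [set x | tnth x j = c]) = 0%E.
Proof.
pose F (x : m.-tuple R) : \bar R := (\1_[set c] (tnth x j))%:E.
have mF : measurable_fun setT F.
  apply/measurable_EFinP; apply: measurableT_comp (measurable_tnth j).
  exact: measurable_indic.
have := integral_torus_upd j mF (fun x => ltac:(by rewrite lee_fin)).
rewrite [LHS](_ : _ = 0%E); last first.
  apply: integral0_eq => x _.
  transitivity (\int[mu]_(t in `[0%R, (2 * pi)%R]) (\1_[set c] t)%:E)%E.
    by apply: eq_integral => t _; rewrite /F tnth_upd eqxx.
  rewrite integral_indic//; apply/eqP; rewrite -measure_le0.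
  rewrite -(lebesgue_measure_set1 c); apply: le_measure; rewrite ?inE//.
  exact: measurableI.
have mset : measurable [set x : m.-tuple R | tnth x j = c].
  rewrite (_ : [set x | _] = setT `&` (fun x : m.-tuple R => tnth x j) @^-1` [set c]).
    exact: (measurable_tnth j) measurableT _ (measurable_set1 c).
  by rewrite setTI.
have -> : (\int[mu_m]_(x in torus) F x = mu_m (torus `&` [set x | tnth x j = c]))%E.
  transitivity (\int[mu_m]_(x in torus) (\1_[set x : m.-tuple R | tnth x j = c] x)%:E)%E.
    by [].
  by rewrite integral_indic 1?setIC//; exact: measurable_torus.
move=> /esym/eqP; rewrite mule_eq0 => /orP[|/eqP//].
by rewrite eqe gt_eqF.
Qed.

Definition lower_boxes : set (set (m.-tuple R)) :=
  [set [set x | forall j, tnth x j < a j] | a in [set: 'I_m -> R]].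

Lemma setI_closed_lower_boxes : setI_closed lower_boxes.
Proof.
move=> _ _ [a _ <-] [b _ <-]; exists (fun j => Num.min (a j) (b j)) => //.
apply/seteqP; split => [x /= xab|x [/= xa xb] j]; last by rewrite lt_min xa xb.
by split=> j; have := xab j; rewrite lt_min => /andP[].
Qed.

(** Coordinates are measurable for the sigma-algebra generated by the boxes, as their
    lower level sets are increasing unions of boxes. *)
Lemma measurable_lower_boxes (A : set (m.-tuple R)) :
  measurable A -> <<s lower_boxes >> A.
Proof.
have mid : measurable_fun [set: g_sigma_algebraType lower_boxes] (fun x : m.-tuple R => x).
  apply/measurable_fun_tnthP => j.
  apply: (measurability _ (RGenInftyO.measurableE R)) => // _ [_ [r ->] <-].
  rewrite setTI (_ : _ @^-1` _ = \bigcup_(n : nat)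
      [set x : m.-tuple R | forall i, tnth x i < (if i == j then r else n%:R)]).
    apply: bigcupT_measurable => n; apply: sub_sigma_algebra.
    by exists (fun i => if i == j then r else n%:R).
  apply/seteqP; split => x; last first.
    by move=> [n _ /(_ j)]; rewrite eqxx /preimage /= in_itv.
  rewrite /preimage /= in_itv/= => xr; exists (\max_(i < m) (Num.truncn (tnth x i)).+1)%N => // i /=.
  case: eqP => [->//|_]; apply: lt_le_trans (truncnS_gt _) _.
  by rewrite ler_nat (leq_bigmax i).
by move=> mA; have := mid measurableT A mA; rewrite setTI.
Qed.

End box_approximation.

Section vanishing_coefficients.
Context {R : realType} {m : nat}.
Local Notation mu_m := (@lebesgue_tuple R m).
Let pi2 : 0 < 2 * pi :> R. Proof. by rewrite mulr_gt0// pi_gt0. Qed.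
Variable u : m.-tuple R -> R.
Hypothesis mu_u : measurable_fun [set: m.-tuple R] u.
Hypothesis iu : mu_m.-integrable torus (EFin \o u).
Hypothesis uc : (forall k, \int[mu_m]_(x in torus) (u x * cos (pairing k x))%:E = 0)%E.
Hypothesis us : (forall k, \int[mu_m]_(x in torus) (u x * sin (pairing k x))%:E = 0)%E.

Lemma ae_torus_coordinate (c : 'I_m -> R) :
  {ae mu_m, forall x, torus x -> forall j, tnth x j != c j}.
Proof.
have : {ae mu_m, forall x, forall n, torus x -> forall j : 'I_m, j = n :> nat -> tnth x j != c j}.
  apply: ae_foralln => n.
  have [nm|nm] := ltnP n m; last first.
    apply: filterE => x _ j jn; have := ltn_ord j.
    by rewrite jn ltnNge nm.
  pose j := Ordinal nm.
  exists (torus `&` [set x | tnth x j = c j]); split.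
  - apply: measurableI; first exact: measurable_torus.
    rewrite (_ : [set x | _] = setT `&` (fun x : m.-tuple R => tnth x j) @^-1` [set c j]).
      exact: (measurable_tnth j) measurableT _ (measurable_set1 _).
    by rewrite setTI.
  - exact: torus_hyperplane_null.
  - move=> x /= /not_implyP[xT /existsNP[i /not_implyP[ij /negP/negPn/eqP xj]]].
    by have -> : j = i by exact/val_inj.
by apply: filterS => x H xT j; exact: (H j xT j).
Qed.

Lemma measurable_prod_indicator (a : 'I_m -> R) : measurable_fun setT
  (fun x : m.-tuple R => \prod_(j < m) (tnth x j < a j)%R%:R : R).
Proof.
apply: measurable_prod => j _.
have -> : (fun x : m.-tuple R => (tnth x j < a j)%R%:R) =
    (\1_(`]-oo, a j[%classic : set R) \o (fun x : m.-tuple R => tnth x j)) :> (_ -> R).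
  by apply/funext => x /=; rewrite indicE mem_setE in_itv.
apply: measurableT_comp (measurable_tnth j).
exact: measurable_indic.
Qed.

Lemma measurable_lower_box (a : 'I_m -> R) :
  measurable [set x : m.-tuple R | forall j, tnth x j < a j].
Proof.
rewrite (_ : [set x | _] = \bigcap_(j in [set: 'I_m])
    ((fun x : m.-tuple R => tnth x j) @^-1` `]-oo, a j[)); last first.
  apply/seteqP; split => x xa j; first by move=> _; rewrite /preimage /= in_itv/=.
  by have := xa j I; rewrite /preimage /= in_itv.
apply: fin_bigcap_measurable => // j _.
rewrite -[X in measurable X]setTI; exact: measurable_tnth.
Qed.

(** On the torus, off finitely many hyperplanes, the indicator of the box is the
    bounded limit of the products of the trigonometric polynomials step_poly n
    (arc_fun (a j) x_j), against which u integrates to 0. *)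
Lemma integral_small_box (a : 'I_m -> R) : (forall j, 0 < a j <= 2 * pi) ->
  (\int[mu_m]_(x in torus) (u x * \prod_(j < m) (tnth x j < a j)%R%:R)%:E = 0)%E.
Proof.
move=> a2; have mT := @measurable_torus R m.
pose P n (x : m.-tuple R) : R := \prod_(j <- index_enum 'I_m) step_poly n (arc_fun (a j) (tnth x j)).
have tP n : trig_poly (P n).
  by apply: trig_prod => j; apply: trig_step_poly; exact: trig_arc_fun.
have P01 n x : 0 <= P n x <= 1.
  rewrite /P; elim/big_ind : _ => [|y z /andP[y0 y1] /andP[z0 z1]|j _].
  - by rewrite ler01 lexx.
  - by rewrite mulr_ge0// mulr_ile1.
  - by have /andP[y0 y1] := arc_fun01 (a j) (tnth x j); exact: step_poly01.
pose L (x : m.-tuple R) : R := \prod_(j <- index_enum 'I_m) (tnth x j < a j)%R%:R.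
have mL : measurable_fun setT L by exact: measurable_prod_indicator.
have cP x : torus x -> (forall j, tnth x j != 0) -> (forall j, tnth x j != 2 * pi) ->
    (forall j, tnth x j != a j) -> P n x @[n --> \oo] --> L x.
  move=> xT x0 x2 xa; rewrite /P /L; elim: (index_enum 'I_m) => [|j r IH].
    under eq_cvg do rewrite big_nil. rewrite big_nil; exact: cvg_cst.
  under eq_cvg do rewrite big_cons.
  rewrite big_cons; apply: cvgM; last exact: IH.
  have /andP[aj0 aj2] := a2 j.
  have /andP[f0 f1] := arc_fun01 (a j) (tnth x j).
  have := xT j; rewrite in_itv/= !le_eqVlt (eq_sym 0) (negbTE (x0 j)) (negbTE (x2 j))/=.
  move=> /andP[xj0 xj2]; case: ltP => [xja|].
    by apply: step_poly_lt => //; exact: arc_fun_lt.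
  rewrite le_eqVlt eq_sym (negbTE (xa j)) /= => axj.
  by apply: step_poly_gt => //; exact: arc_fun_gt.
have mEu : measurable_fun torus (EFin \o u) by case/integrableP: iu.
have mu_P n : measurable_fun torus (fun x => (u x * P n x)%:E).
  apply/measurable_EFinP/measurable_funM; first exact: measurable_funTS.
  by apply: measurable_funTS; have [] := trig_poly_bounded (tP n).
have mu_L : measurable_fun torus (fun x => (u x * L x)%:E).
  by apply/measurable_EFinP/measurable_funM; exact: measurable_funTS.
have iabs : mu_m.-integrable torus (fun x => `|(u x)%:E|)%E.
  exact: integrable_abse.
have [||_ _] := dominated_convergence mT mu_P mu_L _ iabs.
- have := ae_torus_coordinate (fun=> 0); have := ae_torus_coordinate (fun=> 2 * pi).
  have := ae_torus_coordinate a.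
  apply: filterS3 => x xa x2 x0 xT.
  apply: cvg_EFin; first exact: nearW.
  apply: cvgM; first exact: cvg_cst.
  exact: cP xT (x0 xT) (x2 xT) (xa xT).
- apply: aeW => x n xT /=; rewrite lee_fin normrM ler_piMr//.
  by have /andP[p0 p1] := P01 n x; rewrite ger0_norm.
have -> : (fun n => \int[mu_m]_(x in torus) (u x * P n x)%:E)%E = (fun=> 0%E).
  by apply/funext => n; exact: integral_trig_poly.
by move=> /cvg_lim <- //; rewrite lim_cst.
Qed.

Lemma integral_lower_box (a : 'I_m -> R) :
  (\int[mu_m]_(x in torus `&` [set x : m.-tuple R | forall j, (tnth x j < a j)%R]) (u x)%:E = 0)%E.
Proof.
have mT := @measurable_torus R m.
have [[j aj]|aP] := pselect (exists j, a j <= 0).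
  rewrite (_ : _ `&` _ = set0) ?integral_set0// -subset0 => x [xT /(_ j) xa].
  have := xT j; rewrite in_itv/= => /andP[+ _].
  by rewrite leNgt (lt_le_trans xa aj).
have a0 j : 0 < a j by rewrite ltNge; apply/negP => aj; apply: aP; exists j.
pose b j := Num.min (a j) (2 * pi).
have b0 j : 0 < b j <= 2 * pi by rewrite lt_min a0 pi2 ge_min lexx orbT.
rewrite -(integral_small_box b0) integral_mkcondr.
apply: ae_eq_integral => //.
- apply/(measurable_restrict _ _ _).1 => //; first exact: measurable_lower_box.
  by apply: measurable_funS (measurable_int _ iu).
- apply/measurable_EFinP/measurable_funM; first exact: measurable_funTS.
  by apply: measurable_funTS; exact: measurable_prod_indicator.
have := ae_torus_coordinate (fun=> 2 * pi).
apply: filterS => x /[swap] xT /(_ xT) x2; rewrite patchE.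
have -> : \prod_(j < m) (tnth x j < b j)%R%:R = (x \in [set x : m.-tuple R | forall j, tnth x j < a j])%:R :> R.
  have xb j : (tnth x j < b j) = (tnth x j < a j).
    rewrite lt_min; have := xT j; rewrite in_itv/= => /andP[_].
    by rewrite le_eqVlt (negbTE (x2 j))/= => ->; rewrite andbT.
  under eq_bigr do rewrite xb.
  have [/set_mem xa|/negP xa] := boolP (x \in _).
    by rewrite big1// => j _; rewrite xa.
  have /existsNP[j /negP xj] : ~ forall j, tnth x j < a j by move=> xa'; apply: xa; apply/mem_set.
  by rewrite (bigD1 j)//= (negbTE xj) mul0r.
by case: ifPn => _; rewrite ?mulr1 ?mulr0.
Qed.

(** The integral of u over the boxes is 0, hence over every Borel set by the pi-lambda
    theorem. *)
Lemma fourier_uniqueness : {ae mu_m, forall x, torus x -> u x = 0}.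
Proof.
have mT := @measurable_torus R m.
pose H : set (set (m.-tuple R)) := [set A | measurable A /\
  (\int[mu_m]_(x in torus `&` A) (u x)%:E = 0)%E].
have uT : (\int[mu_m]_(x in torus) (u x)%:E = 0)%E.
  rewrite -(uc [tuple 0 | _ < m]).
  by apply: eq_integral => x _; rewrite pairing0 cos0 mulr1.
have dH : lambda_system setT H.
  apply/dynkin_lambda_system; split.
  - by split => //; rewrite setIT.
  - move=> A [mA A0]; split; first exact: measurableC.
    have mTA : measurable (torus `&` A) by exact: measurableI.
    have mTA' : measurable (torus `&` ~` A) by apply: measurableI => //; exact: measurableC.
    move: uT; rewrite -{1}(setIT torus) -(setUv A) setIUr integral_setU//.
    + by rewrite A0 add0e.
    + by apply/measurable_EFinP; exact: measurable_funTS.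
    + apply/disj_setPS => x [[_ Ax] [_ nAx]]; exact: nAx.
  - move=> F tF HF; split; first by apply: bigcupT_measurable => k; have [] := HF k.
    rewrite setI_bigcupr integral_bigcup//.
    + by apply: eseries0 => k _ _; have [] := HF k.
    + by apply: trivIset_setIl.
    + by move=> k; apply: measurableI => //; have [] := HF k.
    + apply: integrableS iu => //; first by apply: bigcupT_measurable => k; apply: measurableI => //; have [] := HF k.
      by move=> x [k _ []].
have GH : lower_boxes `<=` H.
  move=> _ [a _ <-]; split; last exact: integral_lower_box.
  exact: measurable_lower_box.
have AH A : measurable A -> H A.
  move=> /measurable_lower_boxes; apply: (lambda_system_subset _ dH GH) => //.
  exact: setI_closed_lower_boxes.
have [] := @integral_ae_eq _ _ R mu_m torus mT (cst 0%E) (EFin \o u) iu.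
- exact: measurable_cst.
- move=> E ET mE; have [_] := AH _ mE.
  by rewrite setIidr// => ->; rewrite integral_cst// mul0e.
move=> N [mN N0 sN]; exists N; split => // x /= /not_implyP[xT ux].
by apply: sN => /= /(_ xT) []; exact: ux.
Qed.

End vanishing_coefficients.

(** * Fourier coefficients of the dyadic blocks *)

Section complex_torus_integral.
Context {R : realType} {m : nat}.
Local Notation mu := (@lebesgue_measure R).
Local Notation mu_m := (@lebesgue_tuple R m).
Local Notation Re := complex.Re.
Local Notation Im := complex.Im.
Let mT := @measurable_torus R m.
Let pi2 : 0 < 2 * pi :> R. Proof. by rewrite mulr_gt0// pi_gt0. Qed.
Implicit Types (F G : m.-tuple R -> R[i]) (c : R[i]).

Definition cintegrable F :=
  mu_m.-integrable torus (EFin \o (fun x => Re (F x))) /\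
  mu_m.-integrable torus (EFin \o (fun x => Im (F x))).

Lemma Re_mul (a b : R[i]) : Re (a * b) = Re a * Re b - Im a * Im b.
Proof. by case: a b => [? ?] [? ?]. Qed.

Lemma Im_mul (a b : R[i]) : Im (a * b) = Re a * Im b + Im a * Re b.
Proof. by case: a b => [? ?] [? ?]. Qed.

Lemma Re_add (a b : R[i]) : Re (a + b) = Re a + Re b.
Proof. by case: a b => [? ?] [? ?]. Qed.

Lemma Im_add (a b : R[i]) : Im (a + b) = Im a + Im b.
Proof. by case: a b => [? ?] [? ?]. Qed.

Lemma complex_eq (a b : R[i]) : Re a = Re b -> Im a = Im b -> a = b.
Proof. by case: a b => [? ?] [? ?] /= -> ->. Qed.

Lemma cintegrableD F G : cintegrable F -> cintegrable G -> cintegrable (fun x => F x + G x).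
Proof.
move=> [iF1 iF2] [iG1 iG2]; split.
  apply: eq_integrable (integrableD mT iF1 iG1) => // x _ /=; by rewrite Re_add.
by apply: eq_integrable (integrableD mT iF2 iG2) => // x _ /=; rewrite Im_add.
Qed.

Lemma cintegrableZ c F : cintegrable F -> cintegrable (fun x => c * F x).
Proof.
move=> [iF1 iF2]; split.
  apply: eq_integrable (integrableB mT (integrableZl mT (Re c) iF1) (integrableZl mT (Im c) iF2)) => // x _ /=.
  by rewrite Re_mul.
apply: eq_integrable (integrableD mT (integrableZl mT (Re c) iF2) (integrableZl mT (Im c) iF1)) => // x _ /=.
by rewrite Im_mul.
Qed.

Lemma torus_integralD F G : cintegrable F -> cintegrable G ->
  torus_integral (fun x => F x + G x) = torus_integral F + torus_integral G.
Proof.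
move=> [iF1 iF2] [iG1 iG2]; apply: complex_eq; rewrite ?Re_add ?Im_add /=.
  by rewrite -(RintegralD mT iF1 iG1); apply: eq_Rintegral => x _; rewrite Re_add.
by rewrite -(RintegralD mT iF2 iG2); apply: eq_Rintegral => x _; rewrite Im_add.
Qed.

Lemma torus_integralZ c F : cintegrable F ->
  torus_integral (fun x => c * F x) = c * torus_integral F.
Proof.
move=> [iF1 iF2]; apply: complex_eq; rewrite ?Re_mul ?Im_mul /=.
  rewrite -(RintegralZl _ mT iF1) -(RintegralZl _ mT iF2).
  rewrite -(RintegralB mT (integrableZl mT (Re c) iF1) (integrableZl mT (Im c) iF2)).
  by apply: eq_Rintegral => x _; rewrite Re_mul.
rewrite -(RintegralZl _ mT iF1) -(RintegralZl _ mT iF2).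
rewrite -(RintegralD mT (integrableZl mT (Re c) iF2) (integrableZl mT (Im c) iF1)).
by apply: eq_Rintegral => x _; rewrite Im_mul.
Qed.

Lemma cintegrable0 : cintegrable (fun=> 0).
Proof. by split; exact: integrable0. Qed.

Lemma torus_integral0 : torus_integral (fun=> 0 : R[i]) (m := m) = 0 :> R[i].
Proof.
by apply: complex_eq; rewrite /= Rintegral_cst ?mul0r//.
Qed.

Lemma cintegrable_sum (I : eqType) (r : seq I) (F : I -> m.-tuple R -> R[i]) :
  (forall i, i \in r -> cintegrable (F i)) ->
  cintegrable (fun x => \sum_(i <- r) F i x) /\
  torus_integral (fun x => \sum_(i <- r) F i x) = \sum_(i <- r) torus_integral (F i).
Proof.
elim: r => [_|i r IH iF].
  under eq_fun do rewrite big_nil.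
  by rewrite big_nil torus_integral0; split => //; exact: cintegrable0.
under eq_fun do rewrite big_cons.
have iFi := iF i (mem_head _ _).
have [|ir Ir] := IH; first by move=> j jr; apply: iF; rewrite inE jr orbT.
by rewrite torus_integralD// big_cons Ir; split => //; exact: cintegrableD.
Qed.

Lemma expiD a b : expi (a + b) = expi a * expi b :> R[i].
Proof. by apply: complex_eq; rewrite ?Re_mul ?Im_mul /= ?cosD ?sinD//; ring. Qed.

Lemma normc_expi t : Normc.normc (expi t : R[i]) = 1.
Proof. by rewrite /= cos2Dsin2 sqrtr1. Qed.

Lemma expi_neq0 t : expi t != 0 :> R[i].
Proof.
apply/eqP => t0; have := normc_expi t.
by rewrite t0 Normc.normc0 => /esym/eqP; rewrite oner_eq0.
Qed.

Lemma torus_finite : (mu_m torus < +oo)%E.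
Proof. by rewrite torus_volume ltry. Qed.

Lemma integrable_cos_sin k :
  mu_m.-integrable torus (EFin \o (fun x => cos (pairing k x))) /\
  mu_m.-integrable torus (EFin \o (fun x => sin (pairing k x))).
Proof.
have bnd (P : m.-tuple R -> R) : trig_poly P -> mu_m.-integrable torus (EFin \o P).
  move=> /trig_poly_bounded[mP [B B0 PB]].
  apply: measurable_bounded_integrable => //; first exact: torus_finite.
    exact: measurable_funTS.
  exists B; split; first exact: num_real.
  by move=> M BM x _ /=; rewrite (le_trans (PB x))// ltW.
by split; [exact: (bnd _ (@trig_cos R m k))|exact: (bnd _ (@trig_sin R m k))].
Qed.

Lemma cintegrable_expi k : cintegrable (fun x : m.-tuple R => expi (pairing k x)).
Proof. exact: integrable_cos_sin. Qed.

Lemma cintegrableM_expi F k : cintegrable F ->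
  cintegrable (fun x => F x * expi (- pairing k x)).
Proof.
move=> [iF1 iF2].
have [mc _] := trig_poly_bounded (@trig_cos R m k).
have [ms _] := trig_poly_bounded (@trig_sin R m k).
have cb (x : m.-tuple R) : `|cos (pairing k x)| <= 1 by exact: cos_max.
have sb (x : m.-tuple R) : `|sin (pairing k x)| <= 1 by exact: sin_max.
split.
  apply: eq_integrable (integrableD mT (integrable_mul_bounded iF1 mc cb)
    (integrable_mul_bounded iF2 ms sb)) => // x _ /=.
  by rewrite Re_mul /= cosN sinN mulrN opprK.
apply: eq_integrable (integrableB mT (integrable_mul_bounded iF2 mc cb)
  (integrable_mul_bounded iF1 ms sb)) => // x _ /=.
by rewrite Im_mul /= cosN sinN mulrN addrC.
Qed.

Lemma pairing_upd k (x : m.-tuple R) j t :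
  pairing k (upd x j t) = pairing k (upd x j 0) + (tnth k j)%:~R * t.
Proof.
rewrite /pairing (bigD1 j)//= [in RHS](bigD1 j)//= !tnth_upd eqxx mulr0 add0r addrC.
by congr (_ + _); apply: eq_bigr => i ij; rewrite !tnth_upd (negbTE ij).
Qed.

Lemma torus_integral_expi k : torus_integral (fun x : m.-tuple R => expi (pairing k x)) =
  if [forall j, tnth k j == 0] then real_complex R ((2 * pi) ^+ m) else 0.
Proof.
case: ifPn => [/forallP k0|].
  have p0 (x : m.-tuple R) : pairing k x = 0.
    by rewrite /pairing big1// => j _; rewrite (eqP (k0 j)) mul0r.
  apply: complex_eq => /=; under eq_Rintegral do rewrite p0.
    by rewrite cos0 Rintegral_cst// mul1r /= torus_volume.
  by rewrite sin0 Rintegral_cst// mul0r.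
rewrite negb_forall => /existsP[j kj].
have [ikc iks] := integrable_cos_sin k.
have mc := (trig_poly_bounded (@trig_cos R m k)).1.
have ms := (trig_poly_bounded (@trig_sin R m k)).1.
apply: complex_eq => /=; rewrite /Rintegral.
  rewrite (integral_torus_mean_zero mc ikc (j := j))//.
  apply: aeW => x _; rewrite -[RHS](@integral_cos_period _ (pairing k (upd x j 0)) _ kj).
  by apply: eq_integral => t _; rewrite pairing_upd.
rewrite (integral_torus_mean_zero ms iks (j := j))//.
apply: aeW => x _; rewrite -[RHS](@integral_sin_period _ (pairing k (upd x j 0)) _ kj).
by apply: eq_integral => t _; rewrite pairing_upd.
Qed.

Lemma torus_integral_orthogonal k l :
  torus_integral (fun x : m.-tuple R => expi (pairing l x) * expi (- pairing k x)) =
  if l == k then real_complex R ((2 * pi) ^+ m) else 0.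
Proof.
have -> : (fun x => expi (pairing l x) * expi (- pairing k x)) =
    (fun x => expi (pairing [tuple tnth l j - tnth k j | j < m] x)) :> (m.-tuple R -> R[i]).
  by apply/funext => x; rewrite pairingB expiD.
rewrite torus_integral_expi; congr (if _ then _ else _).
apply/forallP/eqP => [lk|-> j]; last by rewrite tnth_mktuple subrr.
by apply: eq_from_tnth => j; have := lk j; rewrite tnth_mktuple subr_eq0 => /eqP.
Qed.

End complex_torus_integral.

Section dyadic_blocks.
Import finmap.
Context {R : realType} {m : nat}.
Implicit Types (k : m.-tuple int) (s : m.-tuple nat).

(** No integer satisfies 2^-1 <= |z| < 1, so blocks with a zero index are empty. *)
Lemma dyadic_condition (s : nat) (z : int) :
  ((2%:Q ^ (s%:Z - 1) <= `|z|%:~R :> rat) && (`|z|%:~R < 2%:Q ^ s%:Z :> rat)) =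
  [&& (0 < s)%N, (2 ^ s.-1 <= `|z|%N)%N & (`|z|%N < 2 ^ s)%N].
Proof.
rewrite -abszE; move: `|z|%N => n.
have lt2 (i : nat) : ((n%:Z)%:~R < 2%:Q ^ i%:Z :> rat) = (n < 2 ^ i)%N.
  by rewrite -exprnP -[2%:Q]/(2%:R) -natrX -[(n%:Z)%:~R]/(n%:R : rat) ltr_nat.
case: s => [|s] /=; rewrite lt2.
  rewrite expn0 ltnS leqn0; case: (n =P 0%N) => [->|_]; last by rewrite andbF.
  by rewrite andbT; apply/negbTE; rewrite -ltNge.
have -> : s.+1%:Z - 1 = s%:Z by rewrite -addn1 PoszD addrK.
by rewrite leNgt lt2 -leqNgt.
Qed.

Definition block_of k : m.-tuple nat := [tuple (trunc_log 2 `|tnth k j|%N).+1 | j < m].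

(** The blocks partition the frequencies that have no zero coordinate. *)
Lemma rhoP s k : rho s k <-> (forall j, tnth k j != 0) /\ s = block_of k.
Proof.
rewrite /rho /=; split=> [ks|[k0 ->] j]; last first.
  rewrite dyadic_condition tnth_mktuple /=.
  by apply: trunc_log_bounds => //; rewrite absz_gt0.
have kj j := ks j; split=> [j|].
  move: (kj j); rewrite dyadic_condition => /and3P[_ + _].
  by case: eqP => // ->; rewrite absz0 leqn0 expn_eq0.
apply: eq_from_tnth => j; move: (kj j); rewrite dyadic_condition tnth_mktuple.
case: (tnth s j) => // i /and3P[_ a b].
by rewrite (@trunc_log_eq 2 i)//= a.
Qed.

Lemma finite_rho s : finite_set (@rho m s).
Proof.
pose B := (\max_(j < m) 2 ^ tnth s j)%N.
pose f (t : m.-tuple 'I_(B + B).+1) : m.-tuple int := [tuple (tnth t j)%:Z - B%:Z | j < m].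
apply: (@sub_finite_set _ _ (f @` [set: m.-tuple 'I_(B + B).+1])); last first.
  by apply: finite_image; exact: finite_finset.
move=> k ks.
have kB j : (`|tnth k j| < B)%N.
  move: (ks j); rewrite dyadic_condition => /and3P[_ _ /leq_trans]; apply.
  exact: (leq_bigmax j).
exists [tuple inord (absz (tnth k j + B%:Z)) | j < m] => //.
apply: eq_from_tnth => j; rewrite !tnth_mktuple inordK; last first.
  by rewrite ltnS; have := kB j; lia.
by have := kB j; lia.
Qed.

Lemma deltaE f s : delta f s =
  (fun x : m.-tuple R => \sum_(k <- fset_set (rho s)) fourier_coef f k * expi (pairing k x)).
Proof. by apply/funext => x; rewrite /delta fsbig_finite//; exact: finite_rho. Qed.

Lemma cintegrable_delta (f : m.-tuple R -> R[i]) s : cintegrable (delta f s).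
Proof.
rewrite deltaE; apply: (cintegrable_sum _).1 => k _.
by apply: cintegrableZ; exact: cintegrable_expi.
Qed.

Lemma measurable_delta (f : m.-tuple R -> R[i]) s :
  measurable_fun [set: m.-tuple R] (fun x => complex.Re (delta f s x)) /\
  measurable_fun [set: m.-tuple R] (fun x => complex.Im (delta f s x)).
Proof.
have mc k := (trig_poly_bounded (@trig_cos R m k)).1.
have ms k := (trig_poly_bounded (@trig_sin R m k)).1.
rewrite deltaE; elim: (fset_set _ : seq _) => [|k r [IH1 IH2]].
  by under eq_fun do rewrite big_nil; under [X in _ /\ measurable_fun _ X]eq_fun do rewrite big_nil.
have E (x : m.-tuple R) : \sum_(l <- k :: r) fourier_coef f l * expi (pairing l x) =
    fourier_coef f k * expi (pairing k x) + \sum_(l <- r) fourier_coef f l * expi (pairing l x).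
  by rewrite big_cons.
have mre : measurable_fun setT (fun x : m.-tuple R => complex.Re (expi (pairing k x))) := mc k.
have mim : measurable_fun setT (fun x : m.-tuple R => complex.Im (expi (pairing k x))) := ms k.
split.
  under eq_fun do rewrite E Re_add Re_mul.
  by apply: measurable_funD => //; apply: measurable_funB; apply: measurable_funM.
under eq_fun do rewrite E Im_add Im_mul.
by apply: measurable_funD => //; apply: measurable_funD; apply: measurable_funM.
Qed.

Lemma torus_integral_delta (f : m.-tuple R -> R[i]) s k :
  torus_integral (fun x : m.-tuple R => delta f s x * expi (- pairing k x)) =
  if `[< rho s k >] then real_complex R ((2 * pi) ^+ m) * fourier_coef f k else 0.
Proof.
have ie l : cintegrable (fun x : m.-tuple R => expi (pairing l x) * expi (- pairing k x)).
  by apply: cintegrableM_expi; exact: cintegrable_expi.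
have -> : (fun x : m.-tuple R => delta f s x * expi (- pairing k x)) =
    (fun x => \sum_(l <- fset_set (rho s)) fourier_coef f l * (expi (pairing l x) * expi (- pairing k x))).
  apply/funext => x; rewrite deltaE mulr_suml.
  by apply: eq_bigr => l _; rewrite mulrA.
have [|_ ->] := @cintegrable_sum R m _ (fset_set (rho s))
    (fun l (x : m.-tuple R) => fourier_coef f l * (expi (pairing l x) * expi (- pairing k x))).
  by move=> l _; apply: cintegrableZ; exact: ie.
under eq_bigr => l _ do rewrite (torus_integralZ _ (ie l)) torus_integral_orthogonal.
have [ks|ks] := pselect (rho s k).
  rewrite asboolT// (bigD1_seq k) ?fset_uniq//=; last first.
    by rewrite in_fset_set; [exact/mem_set|exact: finite_rho].
  rewrite eqxx big1 => [|l lk]; last by rewrite (negbTE lk) mulr0.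
  rewrite addr0; exact: mulrC.
rewrite asboolF// big_seq big1// => l; rewrite in_fset_set; last exact: finite_rho.
move=> /set_mem ls; case: eqP => [lk|_]; last by rewrite mulr0.
by exfalso; apply: ks; rewrite -lk.
Qed.

End dyadic_blocks.

(** * A function is dominated by the sum of the moduli of its blocks *)

Section borel_representative.
Context {R : realType} {m : nat}.
Local Notation mu := (@lebesgue_measure R).
Local Notation mu_m := (@lebesgue_tuple R m).
Local Notation Re := complex.Re.
Local Notation Im := complex.Im.
Local Notation normc := Normc.normc.
Let mT := @measurable_torus R m.
Let pi2 : 0 < 2 * pi :> R. Proof. by rewrite mulr_gt0// pi_gt0. Qed.

(** A weak type bound; for a function g of X it holds with q j = 1 / phi_j and with
    the norm of g as A. *)
Definition weak_bound (q : 'I_m -> R -> R) (A : R) (g : m.-tuple R -> R[i]) : Prop :=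
  forall t : m.-tuple R, (forall j, 0 < tnth t j <= 1) ->
  (iterated_rearrangement g t <= (A * \prod_j q j (tnth t j))%:E)%E.

Lemma torus_function_borel (f : m.-tuple R -> R[i]) : torus_function f ->
  exists (f0 : m.-tuple R -> R[i]) (N : set (m.-tuple R)),
  [/\ measurable_fun [set: m.-tuple R] (fun x => Re (f0 x)),
      measurable_fun [set: m.-tuple R] (fun x => Im (f0 x)),
      measurable N, mu_m N = 0%E & forall x, torus x -> ~ N x -> f x = f0 x].
Proof.
move=> [mre mim _].
have [fr [N [mfr mN N0 fN]]] := completed_measurable_fun_ae_borel mT mre.
have [fi [N' [mfi mN' N'0 fN']]] := completed_measurable_fun_ae_borel mT mim.
exists (fun x => Complex (fr x) (fi x)), (N `|` N'); split => //.
- exact: measurableU.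
- by rewrite measureU0.
- move=> x xT /not_orP[Nx N'x]; apply: complex_eq => /=; [exact: fN|exact: fN'].
Qed.

Lemma measurable_normc (g : m.-tuple R -> R[i]) :
  measurable_fun [set: m.-tuple R] (fun x => Re (g x)) ->
  measurable_fun [set: m.-tuple R] (fun x => Im (g x)) ->
  measurable_fun [set: m.-tuple R] (fun x => normc (g x)).
Proof.
move=> mr mi.
have -> : (fun x => normc (g x)) = (fun x => Num.sqrt (Re (g x) ^+ 2 + Im (g x) ^+ 2)).
  by apply/funext => x; case: (g x).
apply: (measurableT_comp (continuous_measurable_fun (@sqrt_continuous R))).
by apply: measurable_funD; exact: measurable_funX.
Qed.

Lemma normc_nneg (a : R[i]) : 0 <= normc a.
Proof. by case: a => x y; exact: sqrtr_ge0. Qed.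

Lemma Re_le_normc (a : R[i]) : `|Re a| <= normc a.
Proof.
case: a => x y /=; rewrite -sqrtr_sqr ler_wsqrtr//.
by rewrite lerDl sqr_ge0.
Qed.

Lemma Im_le_normc (a : R[i]) : `|Im a| <= normc a.
Proof.
case: a => x y /=; rewrite -sqrtr_sqr ler_wsqrtr//.
by rewrite lerDr sqr_ge0.
Qed.

Lemma torus_dilate (x : m.-tuple R) : (forall j, tnth x j \in `[0, 1]) ->
  torus [tuple 2 * pi * tnth x i | i < m].
Proof.
move=> x01 j; rewrite tnth_mktuple; have := x01 j; rewrite !in_itv/= => /andP[a b].
by rewrite mulr_ge0 ?(ltW pi2)//= -[leRHS]mulr1 ler_pM2l.
Qed.

Lemma iterated_rearrangement_ae (F G : m.-tuple R -> \bar R) (N : set (m.-tuple R)) :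
  measurable N -> mu_m N = 0%E ->
  (forall x, torus x -> ~ N x -> (F x <= G x)%E) -> forall t,
  (foldl rearrangement_in (fun x => F [tuple (2 * pi * tnth x i)%R | i < m]) (enum 'I_m) t <=
   foldl rearrangement_in (fun x => G [tuple (2 * pi * tnth x i)%R | i < m]) (enum 'I_m) t)%E.
Proof.
move=> mN N0 FG t.
apply: (@foldl_rearr_ae _ _ _ _ (fun x => N [tuple (2 * pi * tnth x i)%R | i < m])).
  move=> x x01 Nx; apply: FG => //; apply: torus_dilate => j; apply: x01.
  by rewrite mem_enum.
exact: (exceptional_null mN N0).
Qed.

Section weak.
Variables (q : 'I_m -> R -> R) (S : 'I_m -> R).
Hypothesis q0 : forall j (u : R), 0 < u -> u <= 1 -> 0 <= q j u.
Hypothesis S0 : forall j, 0 <= S j.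
Hypothesis qS : forall j,
  (\sum_(0 <= k <oo) (2^-1 ^+ k * q j (2^-1 ^+ k.+1))%:E <= (S j)%:E)%E.

Lemma integral_normc_le (f f0 : m.-tuple R -> R[i]) (N : set (m.-tuple R)) A :
  measurable_fun [set: m.-tuple R] (fun x => Re (f0 x)) ->
  measurable_fun [set: m.-tuple R] (fun x => Im (f0 x)) ->
  measurable N -> mu_m N = 0%E -> (forall x, torus x -> ~ N x -> f x = f0 x) ->
  0 <= A -> weak_bound q A f ->
  (\int[mu_m]_(x in torus) (normc (f0 x))%:E <= (A * \prod_(j < m) (2 * pi * S j))%:E)%E.
Proof.
move=> mr mi mN N0 ff0 A0 fA.
apply: (integral_le_weak_bound (q := q)) => //.
- by apply/measurable_EFinP; exact: measurable_normc.
- by move=> x; rewrite lee_fin normc_nneg.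
move=> t t01; apply: le_trans (fA t t01).
apply: (@iterated_rearrangement_ae (fun x => (normc (f0 x))%:E) (fun x => (normc (f x))%:E) N) => //.
by move=> x xT Nx; rewrite ff0.
Qed.

Lemma cintegrable_weak (f0 : m.-tuple R -> R[i]) A :
  measurable_fun [set: m.-tuple R] (fun x => Re (f0 x)) ->
  measurable_fun [set: m.-tuple R] (fun x => Im (f0 x)) ->
  (\int[mu_m]_(x in torus) (normc (f0 x))%:E <= A%:E)%E -> cintegrable f0.
Proof.
move=> mr mi fA; have mn := measurable_normc mr mi.
have inorm : mu_m.-integrable torus (fun x => (normc (f0 x))%:E).
  apply/integrableP; split; first by apply/measurable_EFinP; exact: measurable_funTS.
  under eq_integral => x _ do rewrite gee0_abs ?lee_fin ?normc_nneg//.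
  by apply: le_lt_trans fA _; rewrite ltry.
split; apply: le_integrable inorm => //.
- by apply/measurable_EFinP; exact: measurable_funTS.
- by move=> x _ /=; rewrite lee_fin (le_trans (Re_le_normc _))// ler_norm.
- by apply/measurable_EFinP; exact: measurable_funTS.
- by move=> x _ /=; rewrite lee_fin (le_trans (Im_le_normc _))// ler_norm.
Qed.

End weak.

Lemma torus_integral_ae (F F0 : m.-tuple R -> R[i]) (N : set (m.-tuple R)) :
  measurable N -> mu_m N = 0%E -> cintegrable F0 ->
  (forall x, torus x -> ~ N x -> F x = F0 x) -> torus_integral F = torus_integral F0.
Proof.
move=> mN N0 [i1 i2] FF0; apply: complex_eq; rewrite /= /Rintegral; congr fine.
  apply: (integral_ae_nm mT mN N0); first exact: measurable_int i1.
  by move=> x xT Nx; rewrite FF0.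
apply: (integral_ae_nm mT mN N0); first exact: measurable_int i2.
by move=> x xT Nx; rewrite FF0.
Qed.

(** The integral of a function that is not integrable is infinite. *)
Lemma integrable_of_integral0 (D : set R) (g : R -> R) :
  measurable (D : set (measurableTypeR R)) ->
  measurable_fun (D : set (measurableTypeR R)) g ->
  (\int[mu]_(t in D) (g t)%:E = 0)%E -> mu.-integrable D (EFin \o g).
Proof.
move=> mD mg; rewrite integralE => g0; apply/integrableP.
have mEg : measurable_fun (D : set (measurableTypeR R)) (EFin \o g).
  exact/measurable_EFinP.
split => //; under eq_integral => t _ do rewrite -/((abse \o (EFin \o g)) t) fune_abse.
rewrite ge0_integralD//; [|exact: measurable_funepos|exact: measurable_funeneg].
have : (0 <= \int[mu]_(t in D) ((EFin \o g)^\+)%E t)%E by apply: integral_ge0.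
have : (0 <= \int[mu]_(t in D) ((EFin \o g)^\-)%E t)%E by apply: integral_ge0.
by move: g0; move: (integral _ _ _) (integral _ _ _) => [a| |] [b| |]//= _ _ _; rewrite ltry.
Qed.

(** When the j-th frequency is 0, the exponential is constant in the j-th variable,
    and the integral of f in that variable is 0. *)
Lemma fourier_coef_mean_zero (f f0 : m.-tuple R -> R[i]) (N : set (m.-tuple R)) k j :
  measurable_fun [set: m.-tuple R] (fun x => Re (f0 x)) ->
  measurable_fun [set: m.-tuple R] (fun x => Im (f0 x)) ->
  measurable N -> mu_m N = 0%E -> (forall x, torus x -> ~ N x -> f x = f0 x) ->
  cintegrable f0 -> mean_zero f -> tnth k j = 0 ->
  torus_integral (fun x => f0 x * expi (- pairing k x)) = 0.
Proof.
move=> mr mi mN N0 ff0 if0 f0mean kj.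
have [mc _] := trig_poly_bounded (@trig_cos R m k).
have [ms _] := trig_poly_bounded (@trig_sin R m k).
have sec (x : m.-tuple R) : measurable_fun setT (fun t : measurableTypeR R => upd x j t).
  have := measurableT_comp (measurable_upd j) (@pair2_measurable _ _ (measurableTypeR R) (m.-tuple R) x).
  by [].
have Nsec : {ae mu_m, forall x, torus x -> mu (`[0, 2 * pi] `&` [set t | N (upd x j t)]) = 0%E}.
  have m1N : measurable_fun setT (fun x => (\1_N x)%:E : \bar R).
    by apply/measurable_EFinP; exact: measurable_indic.
  have := @integral_torus_upd R m _ j m1N (fun x => ltac:(by rewrite lee_fin)).
  have NT0 : (\int[mu_m]_(x in torus) (\1_N x)%:E = 0)%E.
    rewrite integral_indic//; apply: (subset_measure0 _ mN _ N0) => //.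
    exact: measurableI.
  rewrite NT0 mule0 => I0.
  have mI : measurable_fun torus (fun x => \int[mu]_(t in `[0%R, (2 * pi)%R]) (\1_N (upd x j t))%:E)%E.
    apply: (@measurable_integral_param _ _ _ (fun p => (\1_N (upd p.2 j p.1))%:E)) => //.
    exact: measurableT_comp m1N (measurable_upd j).
  have : ae_eq mu_m torus (fun x => \int[mu]_(t in `[0%R, (2 * pi)%R]) (\1_N (upd x j t))%:E)%E (cst 0%E).
    apply/ae_eq_integral_abs => //.
    by under eq_integral => x _ do rewrite gee0_abs ?integral_ge0//.
  apply: filterS => x /[swap] xT /(_ xT) /= <-.
  transitivity (\int[mu]_(t in `[0%R, (2 * pi)%R]) (\1_[set t | N (upd x j t)] t)%:E)%E; last by [].
  rewrite integral_indic 1?setIC//.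
  have := sec x measurableT N mN; by rewrite setTI.
have zero : {ae mu_m, forall x, torus x ->
    (forall c d : R, \int[mu]_(t in `[0%R, (2 * pi)%R])
      (c * Re (f0 (upd x j t)) + d * Im (f0 (upd x j t)))%:E = 0)%E}.
  move: (f0mean j) Nsec; apply: filterS2 => x fx Nx xT c d.
  have [f1 f2] := fx xT.
  have mNx : measurable ([set t : measurableTypeR R | N (upd x j t)]).
    by have := sec x measurableT N mN; rewrite setTI.
  have mNx' : measurable (`[0, 2 * pi] `&` [set t : measurableTypeR R | N (upd x j t)]).
    exact: measurableI.
  have mr' : measurable_fun (`[0, 2 * pi]%classic : set (measurableTypeR R)) (fun t => Re (f0 (upd x j t))).
    by apply: measurable_funTS; exact: measurableT_comp mr (sec x).
  have mi' : measurable_fun (`[0, 2 * pi]%classic : set (measurableTypeR R)) (fun t => Im (f0 (upd x j t))).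
    by apply: measurable_funTS; exact: measurableT_comp mi (sec x).
  have updT t : t \in `[0, 2 * pi] -> torus (upd x j t).
    by move=> t01 i; rewrite tnth_upd; case: eqP => // _; exact: xT.
  have g1 : (\int[mu]_(t in `[0%R, (2 * pi)%R]) (Re (f0 (upd x j t)))%:E = 0)%E.
    rewrite -f1; symmetry.
    apply: (@integral_ae_nm _ _ R mu _ _ _ _ (measurable_itv `[0, 2 * pi]) mNx' (Nx xT)).
      exact/measurable_EFinP.
    by move=> t t01 nN; rewrite ff0//; [exact: updT|move=> Nt; apply: nN].
  have g2 : (\int[mu]_(t in `[0%R, (2 * pi)%R]) (Im (f0 (upd x j t)))%:E = 0)%E.
    rewrite -f2; symmetry.
    apply: (@integral_ae_nm _ _ R mu _ _ _ _ (measurable_itv `[0, 2 * pi]) mNx' (Nx xT)).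
      exact/measurable_EFinP.
    by move=> t t01 nN; rewrite ff0//; [exact: updT|move=> Nt; apply: nN].
  have i1 := integrable_of_integral0 (measurable_itv `[0, 2 * pi]) mr' g1.
  have i2 := integrable_of_integral0 (measurable_itv `[0, 2 * pi]) mi' g2.
  under eq_integral => t _ do rewrite EFinD !EFinM.
  rewrite integralD//; [|exact: integrableZl|exact: integrableZl].
  by rewrite !integralZl// g1 g2 !mule0 adde0.
have kupd (x : m.-tuple R) t : pairing k (upd x j t) = pairing k (upd x j 0).
  by rewrite pairing_upd kj mul0r addr0.
have [ir ii] := cintegrableM_expi k if0.
have reE x : Re (f0 x * expi (- pairing k x)) =
    cos (pairing k x) * Re (f0 x) + sin (pairing k x) * Im (f0 x).
  by rewrite Re_mul /= cosN sinN; ring.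
have imE x : Im (f0 x * expi (- pairing k x)) =
    - sin (pairing k x) * Re (f0 x) + cos (pairing k x) * Im (f0 x).
  by rewrite Im_mul /= cosN sinN; ring.
apply: complex_eq; rewrite /= /Rintegral.
  rewrite (@integral_torus_mean_zero R m (fun x => Re (f0 x * expi (- pairing k x))) j)//.
    under eq_fun do rewrite reE.
    by apply: measurable_funD; exact: measurable_funM.
  move: zero; apply: filterS => x xz /xz {}xz.
  rewrite -[RHS](xz (cos (pairing k (upd x j 0))) (sin (pairing k (upd x j 0)))).
  by apply: eq_integral => t _; rewrite reE kupd.
rewrite (@integral_torus_mean_zero R m (fun x => Im (f0 x * expi (- pairing k x))) j)//.
  under eq_fun do rewrite imE.
  apply: measurable_funD; apply: measurable_funM => //.
  exact: measurable_funN.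
move: zero; apply: filterS => x xz /xz {}xz.
rewrite -[RHS](xz (- sin (pairing k (upd x j 0))) (cos (pairing k (upd x j 0)))).
by apply: eq_integral => t _; rewrite imE kupd.
Qed.

End borel_representative.

Section series_lemmas.
Context {R : realType}.

Lemma dominated_series_cvg (u v : nat -> R) : (forall n, `|u n| <= v n) ->
  (\sum_(0 <= n <oo) (v n)%:E < +oo)%E -> cvgn (fun n => \sum_(0 <= i < n) u i).
Proof.
move=> uv vfin; apply: normed_cvg.
have v0 n : (0 <= (v n)%:E)%E by rewrite lee_fin (le_trans _ (uv n)).
apply: nondecreasing_is_cvgn.
  by apply: nondecreasing_series => n _ _; exact: normr_ge0.
exists (fine (\sum_(0 <= n <oo) (v n)%:E)%E) => _ [n _ <-] /=.
rewrite -lee_fin fineK; last by rewrite ge0_fin_numE// nneseries_ge0.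
apply: le_trans (nneseries_lim_ge n _) => //.
by rewrite /series /= -sumEFin lee_sum// => i _; rewrite lee_fin.
Qed.

Lemma cos_sin_cancel (a b c d : R) : a + d = 0 -> c - b = 0 -> a - d = 0 -> c + b = 0 ->
  [/\ a = 0, b = 0, c = 0 & d = 0].
Proof. by move=> *; split; lra. Qed.

Lemma normc_sum_le (r : seq nat) (F : nat -> R[i]) :
  Normc.normc (\sum_(i <- r) F i) <= \sum_(i <- r) Normc.normc (F i).
Proof.
elim: r => [|i r IH]; first by rewrite !big_nil Normc.normc0.
by rewrite !big_cons (le_trans (le_normcD _ _))// lerD2l.
Qed.

End series_lemmas.

Section dominated_real.
Context {R : realType} {m : nat}.
Local Notation mu_m := (@lebesgue_tuple R m).
Let mT := @measurable_torus R m.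

(** Subtracting partial sums of blocks from f removes any given Fourier coefficient
    from some rank on, so that dominated convergence is needed for integrals that are
    eventually 0. *)
Lemma dominated_eventually_zero (F_ : nat -> m.-tuple R -> R) (F : m.-tuple R -> R)
    (D : m.-tuple R -> \bar R) n0 :
  (forall n, measurable_fun [set: m.-tuple R] (F_ n)) ->
  (forall x, F_ n x @[n --> \oo] --> F x) ->
  mu_m.-integrable torus D ->
  (forall n x, (`|F_ n x|%:E <= D x)%E) ->
  (forall n, (n0 <= n)%N -> \int[mu_m]_(x in torus) F_ n x = 0) ->
  mu_m.-integrable torus (EFin \o F) /\ \int[mu_m]_(x in torus) F x = 0.
Proof.
move=> mF FF iD FD F0.
have mlim : measurable_fun setT F by apply: (measurable_fun_cvg mF) => x _; exact: FF.
have mF_ n : measurable_fun torus (fun x => (F_ n x)%:E).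
  by apply/measurable_EFinP; apply: measurable_funTS; exact: mF.
have mF' : measurable_fun torus (fun x => (F x)%:E).
  by apply/measurable_EFinP; apply: measurable_funTS.
have [||iF _ cF] := dominated_convergence mT mF_ mF' _ iD.
- apply: aeW => x _; apply: cvg_EFin; first exact: nearW.
  exact: FF.
- by apply: aeW => x n _ /=; exact: FD.
split => //.
have iFn n : mu_m.-integrable torus (fun x => (F_ n x)%:E).
  apply: le_integrable iD => // x _ /=.
  by rewrite (le_trans (FD n x))// lee_abs.
suff : (\int[mu_m]_(x in torus) (F x)%:E = 0)%E by rewrite /Rintegral => ->.
move/cvg_lim: cF => <- //; apply: cvg_lim => //.
apply: cvg_near_cst; exists n0 => // n /= n0n.
have fin := integrable_fin_num mT (iFn n).
by rewrite -(fineK fin); have := F0 n n0n; rewrite /Rintegral => ->.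
Qed.

End dominated_real.

Section sum_of_blocks.
Context {R : realType} {m : nat}.
Local Notation mu := (@lebesgue_measure R).
Local Notation mu_m := (@lebesgue_tuple R m).
Local Notation Re := complex.Re.
Local Notation Im := complex.Im.
Local Notation normc := Normc.normc.
Let mT := @measurable_torus R m.
Let pi2 : 0 < 2 * pi :> R. Proof. by rewrite mulr_gt0// pi_gt0. Qed.
Variables (q : 'I_m -> R -> R) (S : 'I_m -> R).
Hypothesis q0 : forall j (u : R), 0 < u -> u <= 1 -> 0 <= q j u.
Hypothesis S0 : forall j, 0 <= S j.
Hypothesis qS : forall j,
  (\sum_(0 <= k <oo) (2^-1 ^+ k * q j (2^-1 ^+ k.+1))%:E <= (S j)%:E)%E.
Variables (f : m.-tuple R -> R[i]) (A : R) (B : m.-tuple nat -> R).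
Hypothesis tf : torus_function f.
Hypothesis mf : mean_zero f.
Hypothesis A0 : 0 <= A.
Hypothesis fA : weak_bound q A f.
Hypothesis B0 : forall s, 0 <= B s.
Hypothesis fB : forall s, weak_bound q (B s) (delta f s).
Hypothesis Bfin : (\esum_(s in [set: m.-tuple nat]) (B s)%:E < +oo)%E.

Let D n (x : m.-tuple R) : R[i] := if pickle_inv n is Some s then delta f s x else 0.
Let g n x : R[i] := \sum_(0 <= i < n) D i x.
Let G x : \bar R := (\sum_(0 <= n <oo) (normc (D n x))%:E)%E.

Let mD n : measurable_fun [set: m.-tuple R] (fun x => Re (D n x)) /\
  measurable_fun [set: m.-tuple R] (fun x => Im (D n x)).
Proof.
rewrite /D; case: pickle_inv => [s|]; first exact: measurable_delta.
by split; exact: measurable_cst.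
Qed.

Let iD n : cintegrable (D n).
Proof.
rewrite /D; case: pickle_inv => [s|]; first exact: cintegrable_delta.
exact: cintegrable0.
Qed.

Let normc_ge0 x n : (0 <= (normc (D n x))%:E)%E.
Proof. by rewrite lee_fin normc_nneg. Qed.

Let mG : measurable_fun [set: m.-tuple R] G.
Proof.
apply: ge0_emeasurable_sum => [k x _ _|k _]; first exact: normc_ge0.
by apply/measurable_EFinP; apply: measurable_normc; have [] := mD k.
Qed.

Let G0 x : (0 <= G x)%E.
Proof. by apply: nneseries_ge0 => n _ _; exact: normc_ge0. Qed.

Let iG : mu_m.-integrable torus G.
Proof.
apply/integrableP; split; first exact: measurable_funTS.
under eq_integral => x _ do rewrite gee0_abs//.
rewrite integral_nneseries//; last first.
  by move=> n; apply/measurable_EFinP; apply: measurable_funTS; apply: measurable_normc; have [] := mD n.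
pose K := \prod_(j < m) (2 * pi * S j).
have K0 : 0 <= K by apply: prodr_ge0 => j _; rewrite mulr_ge0// ltW.
apply: (@le_lt_trans _ _ (\sum_(0 <= n <oo) (K%:E *
    (if @pickle_inv (m.-tuple nat) n is Some s then (B s)%:E else 0)))%E).
  apply: lee_nneseries => [n _ _|n _]; first by apply: integral_ge0.
  rewrite /D; case: pickle_inv => [s|]; last first.
    by rewrite Normc.normc0 integral0 mule0.
  have [mr mi] := measurable_delta f s.
  rewrite muleC -EFinM.
  by apply: (@integral_normc_le _ _ _ _ q0 S0 qS (delta f s) _ set0).
rewrite nneseriesZl; last by move=> n _; case: pickle_inv => // s; rewrite lee_fin.
rewrite nneseries_pickle; last by move=> s; rewrite lee_fin.
by rewrite lte_mul_pinfty// lee_fin.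
Qed.

Let Re_sum (r : seq nat) x : Re (\sum_(i <- r) D i x) = \sum_(i <- r) Re (D i x).
Proof. by elim: r => [|i r IH]; rewrite ?big_nil// !big_cons Re_add IH. Qed.

Let Im_sum (r : seq nat) x : Im (\sum_(i <- r) D i x) = \sum_(i <- r) Im (D i x).
Proof. by elim: r => [|i r IH]; rewrite ?big_nil// !big_cons Im_add IH. Qed.

Let hn n x : R[i] := if (G x < +oo)%E then g n x else 0.
Let h x : R[i] := Complex (limn (fun n => Re (hn n x))) (limn (fun n => Im (hn n x))).

Let hn_cvg x : Re (hn n x) @[n --> \oo] --> Re (h x) /\ Im (hn n x) @[n --> \oo] --> Im (h x).
Proof.
suff [cr ci] : cvgn (fun n => Re (hn n x)) /\ cvgn (fun n => Im (hn n x)) by split.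
have [Gx|/negbTE Gx] := boolP (G x < +oo)%E; last first.
  rewrite (_ : (fun n => Re (hn n x)) = (fun=> 0)); last first.
    by apply/funext => n; rewrite /hn Gx.
  rewrite (_ : (fun n => Im (hn n x)) = (fun=> 0)); last first.
    by apply/funext => n; rewrite /hn Gx.
  by split; apply: is_cvg_cst.
split.
  rewrite (_ : (fun n => Re (hn n x)) = (fun n => \sum_(0 <= i < n) Re (D i x))).
    exact: (dominated_series_cvg (fun n => Re_le_normc _) Gx).
  by apply/funext => n; rewrite /hn Gx Re_sum.
rewrite (_ : (fun n => Im (hn n x)) = (fun n => \sum_(0 <= i < n) Im (D i x))).
  exact: (dominated_series_cvg (fun n => Im_le_normc _) Gx).
by apply/funext => n; rewrite /hn Gx Im_sum.
Qed.

Let hn_le n x : ((normc (hn n x))%:E <= G x)%E.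
Proof.
rewrite /hn; case: ifPn => Gx; last by rewrite Normc.normc0.
apply: (@le_trans _ _ (\sum_(0 <= i < n) normc (D i x))%:E).
  by rewrite lee_fin normc_sum_le.
rewrite -sumEFin; apply: nneseries_lim_ge => k _ _; exact: normc_ge0.
Qed.

Let mhn n : measurable_fun [set: m.-tuple R] (fun x => Re (hn n x)) /\
  measurable_fun [set: m.-tuple R] (fun x => Im (hn n x)).
Proof.
have mE : measurable_fun setT (fun x : m.-tuple R => (G x < +oo)%E).
  apply: (measurable_fun_bool true).
  rewrite [X in measurable X](_ : _ = setT `&` [set x | (G x < +oo)%E]); last first.
    by apply/seteqP; split.
  exact: emeasurable_fun_infty_o.
split.
  have -> : (fun x => Re (hn n x)) = (fun x => if (G x < +oo)%E then \sum_(0 <= i < n) Re (D i x) else 0).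
    by apply/funext => x; rewrite /hn /g; case: ifP => // _; rewrite Re_sum.
  apply: measurable_fun_ifT => //; apply: measurable_sum => i.
  by have [] := mD i.
have -> : (fun x => Im (hn n x)) = (fun x => if (G x < +oo)%E then \sum_(0 <= i < n) Im (D i x) else 0).
  by apply/funext => x; rewrite /hn /g; case: ifP => // _; rewrite Im_sum.
apply: measurable_fun_ifT => //; apply: measurable_sum => i.
by have [] := mD i.
Qed.

Let mh : measurable_fun [set: m.-tuple R] (fun x => Re (h x)) /\
  measurable_fun [set: m.-tuple R] (fun x => Im (h x)).
Proof.
split.
  apply: (measurable_fun_cvg (fun n => (mhn n).1)) => x _; exact: (hn_cvg x).1.
apply: (measurable_fun_cvg (fun n => (mhn n).2)) => x _; exact: (hn_cvg x).2.
Qed.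

Let normc_h_le x : ((normc (h x))%:E <= G x)%E.
Proof.
have [Gx|] := ltP (G x) +oo%E; last by rewrite leye_eq => /eqP ->; rewrite leey.
have Gfin : G x \is a fin_num by rewrite ge0_fin_numE.
rewrite -(fineK Gfin) lee_fin.
have [cr ci] := hn_cvg x.
have c : Num.sqrt (Re (hn n x) ^+ 2 + Im (hn n x) ^+ 2) @[n --> \oo] -->
    Num.sqrt (Re (h x) ^+ 2 + Im (h x) ^+ 2).
  apply: (@cvg_comp _ _ _ (fun n => Re (hn n x) ^+ 2 + Im (hn n x) ^+ 2)); last exact: sqrt_continuous.
  by rewrite !expr2; under eq_cvg do rewrite !expr2; apply: cvgD; apply: cvgM.
have -> : normc (h x) = Num.sqrt (Re (h x) ^+ 2 + Im (h x) ^+ 2) by case: (h x).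
apply: (cvgr_to_le c); apply: nearW => n.
have -> : Num.sqrt (Re (hn n x) ^+ 2 + Im (hn n x) ^+ 2) = normc (hn n x) by case: (hn n x).
by rewrite -lee_fin fineK.
Qed.

Let Re_sub (a b : R[i]) : Re (a - b) = Re a - Re b.
Proof. by case: a b => [? ?] [? ?]. Qed.

Let Im_sub (a b : R[i]) : Im (a - b) = Im a - Im b.
Proof. by case: a b => [? ?] [? ?]. Qed.

Let measurable_mul_expi (v : m.-tuple R -> R[i]) k :
  measurable_fun [set: m.-tuple R] (fun x => Re (v x)) ->
  measurable_fun [set: m.-tuple R] (fun x => Im (v x)) ->
  measurable_fun [set: m.-tuple R] (fun x => Re (v x * expi (- pairing k x))) /\
  measurable_fun [set: m.-tuple R] (fun x => Im (v x * expi (- pairing k x))).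
Proof.
move=> mr mi.
have [mc _] := trig_poly_bounded (@trig_cos R m k).
have [ms _] := trig_poly_bounded (@trig_sin R m k).
split.
  rewrite (_ : (fun x => _) = (fun x => Re (v x) * cos (pairing k x) + Im (v x) * sin (pairing k x))).
    by apply: measurable_funD; apply: measurable_funM.
  by apply/funext => x; rewrite Re_mul /= cosN sinN; ring.
rewrite (_ : (fun x => _) = (fun x => Im (v x) * cos (pairing k x) - Re (v x) * sin (pairing k x))).
  by apply: measurable_funB; apply: measurable_funM.
by apply/funext => x; rewrite Im_mul /= cosN sinN; ring.
Qed.

(** The sum h of the blocks is integrable, because so is the sum G of their moduli.
    Each Fourier coefficient of f is that of a partial sum from some rank on, hence
    that of h; by uniqueness f = h almost everywhere. *)
Lemma norm_le_sum_blocks : exists N : set (m.-tuple R),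
  [/\ measurable N, mu_m N = 0%E & forall x, torus x -> ~ N x ->
    ((normc (f x))%:E <= \esum_(s in [set: m.-tuple nat]) (normc (delta f s x))%:E)%E].
Proof.
have GE x : G x = \esum_(s in [set: m.-tuple nat]) (normc (delta f s x))%:E.
  rewrite -nneseries_pickle; last by move=> s; rewrite lee_fin normc_nneg.
  by apply: eq_eseriesr => n _; rewrite /D; case: pickle_inv => //; rewrite Normc.normc0.
have [f0 [N [mr mi mN N0 ff0]]] := torus_function_borel tf.
have normf0 := integral_normc_le q0 S0 qS mr mi mN N0 ff0 A0 fA.
have if0 := cintegrable_weak mr mi normf0.
pose NG := torus `&` [set x | G x = +oo%E].
have mNG : measurable NG.
  rewrite (_ : NG = torus `&` [set x | (+oo%E <= G x)%E]); last first.
    by apply/seteqP; split => x /= [xT]; rewrite ?leye_eq => /eqP.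
  apply: emeasurable_fun_c_infty => //; exact: measurable_funTS.
have NG0 : mu_m NG = 0%E.
  have [M [mM M0 sM]] := integrable_ae mT iG.
  apply: (subset_measure0 mNG mM _ M0) => x [xT Gx]; apply: sM => /= /(_ xT).
  by rewrite Gx.
(* every coefficient of f is eventually removed by the partial sums *)
have coef k : exists n0, forall n, (n0 <= n)%N ->
    torus_integral (fun x => (f0 x - hn n x) * expi (- pairing k x)) = 0.
  have TIhn n : torus_integral (fun x => (f0 x - hn n x) * expi (- pairing k x)) =
      torus_integral (fun x => f0 x * expi (- pairing k x)) -
      \sum_(0 <= i < n) torus_integral (fun x => D i x * expi (- pairing k x)).
    have iDe i : cintegrable (fun x => D i x * expi (- pairing k x)).
      exact: cintegrableM_expi.
    have [iS ES] := @cintegrable_sum R m _ (index_iota 0 n)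
      (fun i x => D i x * expi (- pairing k x)) (fun i _ => iDe i).
    have if0e := cintegrableM_expi k if0.
    have E x : (f0 x - g n x) * expi (- pairing k x) = f0 x * expi (- pairing k x) +
        -1 * \sum_(0 <= i < n) D i x * expi (- pairing k x).
      by rewrite mulrBl mulr_suml mulN1r.
    rewrite -ES -(mulN1r (torus_integral _)) -(torus_integralZ _ iS).
    rewrite -torus_integralD//; last exact: cintegrableZ.
    apply: (torus_integral_ae mNG NG0).
      by apply: cintegrableD => //; exact: cintegrableZ.
    move=> x xT Gx; rewrite -E /hn ifT// ltey; apply/eqP => Gxy.
    by apply: Gx.
  pose c : R[i] := real_complex R ((2 * pi) ^+ m).
  have TID i : torus_integral (fun x => D i x * expi (- pairing k x)) =
      if @pickle_inv (m.-tuple nat) i is Some s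
      then (if `[< rho s k >] then c * fourier_coef f k else 0) else 0.
    rewrite /D; case: pickle_inv => [s|]; first exact: torus_integral_delta.
    by under eq_fun do rewrite mul0r; rewrite torus_integral0.
  have [[j kj]|k0] := pselect (exists j, tnth k j = 0).
    exists 0%N => n _; rewrite TIhn (fourier_coef_mean_zero mr mi mN N0 ff0 if0 mf kj).
    rewrite big1 ?subr0// => i _; rewrite TID; case: pickle_inv => // s.
    by rewrite asboolF// => /rhoP[/(_ j)/eqP].
  have k0' j : tnth k j != 0 by apply/eqP => kj; apply: k0; exists j.
  exists (pickle (block_of k)).+1 => n kn; rewrite TIhn.
  have -> : torus_integral (fun x => f0 x * expi (- pairing k x)) = c * fourier_coef f k.
    rewrite /fourier_coef (@torus_integral_ae _ _ (fun x => f x * expi (- pairing k x))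
      (fun x => f0 x * expi (- pairing k x)) N) //.
    - by rewrite mulrA -rmorphM mulfV ?rmorph1 ?mul1r// expf_neq0// gt_eqF.
    - exact: cintegrableM_expi.
    - by move=> x xT Nx; rewrite ff0.
  rewrite (bigD1_seq (pickle (block_of k))) ?iota_uniq ?mem_index_iota//=.
  rewrite TID pickleK_inv asboolT; last by apply/rhoP.
  rewrite big1 ?addr0 ?subrr// => i ik; rewrite TID.
  case E: (@pickle_inv (m.-tuple nat) i) => [s|//]; rewrite asboolF// => /rhoP[_ sk].
  have := @pickle_invK (m.-tuple nat) i; rewrite E /= sk => ki.
  by rewrite ki eqxx in ik.
pose u x := f0 x - h x.
have mur : measurable_fun [set: m.-tuple R] (fun x => Re (u x)).
  by under eq_fun do rewrite Re_sub; apply: measurable_funB => //; case: mh.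
have mui : measurable_fun [set: m.-tuple R] (fun x => Im (u x)).
  by under eq_fun do rewrite Im_sub; apply: measurable_funB => //; case: mh.
have uk k : cintegrable (fun x => u x * expi (- pairing k x)) /\
    torus_integral (fun x => u x * expi (- pairing k x)) = 0.
  have [n0 cn0] := coef k.
  pose v n x := f0 x - hn n x.
  have mvr n : measurable_fun [set: m.-tuple R] (fun x => Re (v n x)).
    by under eq_fun do rewrite Re_sub; apply: measurable_funB => //; case: (mhn n).
  have mvi n : measurable_fun [set: m.-tuple R] (fun x => Im (v n x)).
    by under eq_fun do rewrite Im_sub; apply: measurable_funB => //; case: (mhn n).
  have mve n := measurable_mul_expi k (mvr n) (mvi n).
  have cvr x : Re (v n x) @[n --> \oo] --> Re (u x).
    under eq_cvg do rewrite Re_sub; rewrite Re_sub; apply: cvgB; first exact: cvg_cst.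
    exact: (hn_cvg x).1.
  have cvi x : Im (v n x) @[n --> \oo] --> Im (u x).
    under eq_cvg do rewrite Im_sub; rewrite Im_sub; apply: cvgB; first exact: cvg_cst.
    exact: (hn_cvg x).2.
  have iDom : mu_m.-integrable torus (fun x => (normc (f0 x))%:E + G x)%E.
    apply: integrableD => //; apply/integrableP; split.
      by apply/measurable_EFinP; apply: measurable_funTS; exact: measurable_normc.
    under eq_integral => x _ do rewrite gee0_abs ?lee_fin ?normc_nneg//.
    by apply: le_lt_trans normf0 _; rewrite ltry.
  have Dom n x : ((normc (v n x * expi (- pairing k x)))%:E <= (normc (f0 x))%:E + G x)%E.
    rewrite Normc.normcM normc_expi mulr1.
    apply: (@le_trans _ _ ((normc (f0 x))%:E + (normc (hn n x))%:E)%E).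
      by rewrite -EFinD lee_fin -(normcN (hn n x)) le_normcD.
    by rewrite leeD2l.
  have cvre x : Re (v n x * expi (- pairing k x)) @[n --> \oo] --> Re (u x * expi (- pairing k x)).
    under eq_cvg do rewrite Re_mul; rewrite Re_mul.
    by apply: cvgB; apply: cvgM => //; exact: cvg_cst.
  have cvie x : Im (v n x * expi (- pairing k x)) @[n --> \oo] --> Im (u x * expi (- pairing k x)).
    under eq_cvg do rewrite Im_mul; rewrite Im_mul.
    by apply: cvgD; apply: cvgM => //; exact: cvg_cst.
  have [|n n0n|ir Ir] := dominated_eventually_zero (n0 := n0) (fun n => (mve n).1) cvre iDom.
  - by move=> n x; apply: le_trans (Dom n x); rewrite lee_fin Re_le_normc.
  - by have := congr1 (@complex.Re R) (cn0 n n0n); rewrite /torus_integral /= => <-.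
  have [|n n0n|ii Ii] := dominated_eventually_zero (n0 := n0) (fun n => (mve n).2) cvie iDom.
  - by move=> n x; apply: le_trans (Dom n x); rewrite lee_fin Im_le_normc.
  - by have := congr1 (@complex.Im R) (cn0 n n0n); rewrite /torus_integral /= => <-.
  split; first by split.
  by apply: complex_eq; [exact: Ir|exact: Ii].
have [iur iui] : cintegrable u.
  have [+ _] := uk [tuple 0 | _ < m].
  suff -> : (fun x => u x * expi (- pairing [tuple 0 | _ < m] x)) = u by [].
  apply/funext => x; rewrite pairing0 oppr0 (_ : expi 0 = 1) ?mulr1//.
  by apply: complex_eq; rewrite /= ?cos0 ?sin0.
have ucs k : [/\ (\int[mu_m]_(x in torus) (Re (u x) * cos (pairing k x))%:E = 0)%E,
    (\int[mu_m]_(x in torus) (Re (u x) * sin (pairing k x))%:E = 0)%E,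
    (\int[mu_m]_(x in torus) (Im (u x) * cos (pairing k x))%:E = 0)%E &
    (\int[mu_m]_(x in torus) (Im (u x) * sin (pairing k x))%:E = 0)%E].
  have [mc _] := trig_poly_bounded (@trig_cos R m k).
  have [ms _] := trig_poly_bounded (@trig_sin R m k).
  have i1 := integrable_mul_bounded iur mc (fun x => cos_max (pairing k x)).
  have i2 := integrable_mul_bounded iur ms (fun x => sin_max (pairing k x)).
  have i3 := integrable_mul_bounded iui mc (fun x => cos_max (pairing k x)).
  have i4 := integrable_mul_bounded iui ms (fun x => sin_max (pairing k x)).
  pose k' : m.-tuple int := [tuple - tnth k j | j < m].
  have k'E (x : m.-tuple R) : pairing k' x = - pairing k x.
    rewrite /pairing -sumrN; apply: eq_bigr => j _.
    by rewrite tnth_mktuple rmorphN mulNr.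
  have [_ U] := uk k; have [_ U'] := uk k'.
  have e1 : \int[mu_m]_(x in torus) (Re (u x) * cos (pairing k x)) +
      \int[mu_m]_(x in torus) (Im (u x) * sin (pairing k x)) = 0.
    rewrite -(RintegralD mT i1 i4) -[RHS](congr1 (@complex.Re R) U) /=.
    by apply: eq_Rintegral => x _; rewrite Re_mul /= cosN sinN; ring.
  have e2 : \int[mu_m]_(x in torus) (Im (u x) * cos (pairing k x)) -
      \int[mu_m]_(x in torus) (Re (u x) * sin (pairing k x)) = 0.
    rewrite -(RintegralB mT i3 i2) -[RHS](congr1 (@complex.Im R) U) /=.
    by apply: eq_Rintegral => x _; rewrite Im_mul /= cosN sinN; ring.
  have e3 : \int[mu_m]_(x in torus) (Re (u x) * cos (pairing k x)) -
      \int[mu_m]_(x in torus) (Im (u x) * sin (pairing k x)) = 0.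
    rewrite -(RintegralB mT i1 i4) -[RHS](congr1 (@complex.Re R) U') /=.
    by apply: eq_Rintegral => x _; rewrite Re_mul /= k'E opprK; ring.
  have e4 : \int[mu_m]_(x in torus) (Im (u x) * cos (pairing k x)) +
      \int[mu_m]_(x in torus) (Re (u x) * sin (pairing k x)) = 0.
    rewrite -(RintegralD mT i3 i2) -[RHS](congr1 (@complex.Im R) U') /=.
    by apply: eq_Rintegral => x _; rewrite Im_mul /= k'E opprK; ring.
  have back v : mu_m.-integrable torus (fun x => (v x)%:E) ->
      \int[mu_m]_(x in torus) v x = 0 -> (\int[mu_m]_(x in torus) (v x)%:E = 0)%E.
    move=> iv; rewrite /Rintegral => v0.
    by rewrite -(fineK (integrable_fin_num mT iv)) v0.
  have [a0 b0 c0 d0] := cos_sin_cancel e1 e2 e3 e4.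
  by split; apply: back.
have ur0 : {ae mu_m, forall x, torus x -> Re (u x) = 0}.
  by apply: fourier_uniqueness => // k; have [] := ucs k.
have ui0 : {ae mu_m, forall x, torus x -> Im (u x) = 0}.
  by apply: fourier_uniqueness => // k; have [] := ucs k.
have [M [mM M0 sM]] : {ae mu_m, forall x, torus x -> u x = 0}.
  by apply: filterS2 ur0 ui0 => x xr xi xT; apply: complex_eq; [exact: xr|exact: xi].
exists (N `|` M); split; first exact: measurableU.
  by rewrite measureU0.
move=> x xT /not_orP[Nx Mx]; rewrite ff0// -GE.
have : u x = 0 by apply: contrapT => ux; apply: Mx; apply: sM => /= /(_ xT).
by move=> /eqP; rewrite subr_eq0 => /eqP ->.
Qed.

End sum_of_blocks.

(** * Sampling of trigonometric polynomials *)

Section sampling.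
Context {R : realType}.
Local Notation Re := complex.Re.
Local Notation Im := complex.Im.
Local Notation normc := Normc.normc.

(** Up to pi / 4 the derivative of sin is at least 1/2; beyond, sin is at least cos,
    hence its square is at least 1/2. *)
Lemma sin_ge_linear (z : R) : 0 <= z -> z <= 2^-1 -> z <= sin (pi * z).
Proof.
move=> z0 z1; have pi0 := @pi_gt0 R; have pige2 := @pi_ge2 R.
pose x := pi * z.
have x0 : 0 <= x by rewrite mulr_ge0// ltW.
have x1 : x <= pi / 2 by rewrite /x ler_pM2l.
have sc : sin x = cos (pi / 2 - x) by rewrite cosB cos_pihalf sin_pihalf mul0r add0r mul1r.
have s0 : 0 <= sin x by rewrite sin_ge0_pi// x0/=; lra.
have c0 : 0 <= cos x by rewrite cos_ge0_pihalf//; lra.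
have sq := cos2Dsin2 x.
have [x4|x4] := leP x (pi / 4).
  have half (y : R) : 0 <= y -> y <= pi / 4 -> 2^-1 <= cos y.
    move=> y0 y4; have cy : sin y <= cos y.
      rewrite (_ : sin y = cos (pi / 2 - y)); last first.
        by rewrite cosB cos_pihalf sin_pihalf mul0r add0r mul1r.
      by rewrite leNgt ltr_cos ?in_itv/= -?leNgt; lra.
    have sy : 0 <= sin y by rewrite sin_ge0_pi// y0/=; lra.
    have := cos2Dsin2 y; nra.
  have [->|xneq0] := eqVneq z 0; first by rewrite mulr0 sin0.
  have xgt0 : 0 < x by rewrite mulr_gt0// lt_neqAle eq_sym xneq0.
  have [c] := @MVT R sin cos 0 x xgt0 (fun y _ => is_derive_sin y)
    (continuous_subspaceT (@continuous_sin R)).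
  rewrite in_itv/= => /andP[c0' cx]; rewrite sin0 !subr0 => ->.
  have cc := half c (ltW c0') (ltW (lt_le_trans cx x4)).
  have cp : 1 <= cos c * pi by nra.
  by rewrite /x mulrA ler_peMl.
have cs : cos x <= sin x.
  by rewrite sc leNgt ltr_cos ?in_itv/= -?leNgt; lra.
by rewrite -/x; nra.
Qed.

Lemma expi0 : expi 0 = 1 :> R[i].
Proof. by apply: complex_eq; rewrite /= ?cos0 ?sin0. Qed.

Lemma expi_natmul (t : R) n : expi (n%:R * t) = expi t ^+ n :> R[i].
Proof.
elim: n => [|n IH]; first by rewrite mul0r expi0 expr0.
by rewrite exprS -IH -expiD -nat1r mulrDl mul1r.
Qed.

Lemma normc_expi_sub1 (z : R) : 0 <= z -> z < 1 ->
  2 * Num.min z (1 - z) <= normc (expi (2 * pi * z) - 1 : R[i]).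
Proof.
move=> z0 z1; have pi0 := @pi_gt0 R.
have s0 : 0 <= sin (pi * z) by rewrite sin_ge0_pi// mulr_ge0 ?(ltW pi0)//= ler_piMr ?ltW.
have -> : normc (expi (2 * pi * z) - 1 : R[i]) = 2 * sin (pi * z).
  rewrite /= oppr0 addr0; have -> : 2 * pi * z = (pi * z) *+ 2 by rewrite mulr2n; ring.
  have -> : (cos ((pi * z) *+ 2) - 1) ^+ 2 + sin ((pi * z) *+ 2) ^+ 2 = (2 * sin (pi * z)) ^+ 2.
    have := cos2Dsin2 ((pi * z) *+ 2).
    have := cos2Dsin2 (pi * z); rewrite cos_mulr2n => a b.
    have c2 : cos (pi * z) ^+ 2 = 1 - sin (pi * z) ^+ 2 by rewrite -a addrK.
    rewrite sqrrB -addrA; move: b; rewrite c2 => b; lra.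
  by rewrite sqrtr_sqr ger0_norm// mulr_ge0.
rewrite ler_pM2l//; have [zh|zh] := leP z 2^-1.
  by rewrite (le_trans _ (sin_ge_linear z0 zh))// ge_min lexx.
have -> : sin (pi * z) = sin (pi * (1 - z)).
  rewrite mulrBr mulr1 sinB sinpi cospi; ring.
by rewrite (le_trans _ (sin_ge_linear _ _))//; [rewrite ge_min lexx orbT|lra|lra].
Qed.

Lemma geometric_sum_root (w : R[i]) M : w != 1 -> w ^+ M = 1 -> \sum_(k < M) w ^+ k = 0.
Proof.
move=> w1 wM; have := subrX1 w M; rewrite wM subrr => /esym/eqP.
by rewrite mulf_eq0 subr_eq0 (negbTE w1) /= => /eqP.
Qed.

Lemma expi_frac_neq1 M r : (0 < r < M)%N -> expi (2 * pi * (r%:R / M%:R)) != 1 :> R[i].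
Proof.
move=> /andP[r0 rM]; apply/eqP => E.
have M0 : 0 < M%:R :> R by rewrite ltr0n (leq_trans _ rM).
have z0 : 0 < r%:R / M%:R :> R by rewrite divr_gt0// ltr0n.
have z1 : r%:R / M%:R < 1 :> R by rewrite ltr_pdivrMr// mul1r ltr_nat.
have := normc_expi_sub1 (ltW z0) z1; rewrite E subrr Normc.normc0.
by apply/negP; rewrite -ltNge mulr_gt0// lt_min z0 subr_gt0.
Qed.

Lemma expi_frac_inj M e l : (e < M)%N -> (l < M)%N ->
  expi (2 * pi / M%:R) ^+ e = expi (2 * pi / M%:R) ^+ l :> R[i] -> e = l.
Proof.
wlog le_le : e l / (l <= e)%N => [hw eM lM E|eM lM].
  by case/orP: (leq_total l e) => h; [apply: hw|apply/esym; apply: hw].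
rewrite -{1}(subnK le_le) exprD => E; apply/eqP; rewrite eqn_leq le_le andbT.
rewrite -subn_eq0 -leqn0 leqNgt; apply/negP => el0.
have := @expi_frac_neq1 M (e - l); rewrite el0 (leq_ltn_trans (leq_subr _ _) eM) => /(_ isT)/eqP; apply.
have -> : 2 * pi * ((e - l)%:R / M%:R) = (e - l)%:R * (2 * pi / M%:R) :> R by ring.
rewrite expi_natmul; apply: (mulIf (expf_neq0 l (expi_neq0 (2 * pi / M%:R)))).
by rewrite E mul1r.
Qed.

Lemma sampling_orthogonality (theta : R) M e l : (0 < M)%N -> (e < M)%N -> (l < M)%N ->
  \sum_(k < M) expi (2 * pi * (theta + k%:R / M%:R)) ^+ e *
    (expi (2 * pi * (theta + k%:R / M%:R)))^-1 ^+ l = if e == l then M%:R else 0 :> R[i].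
Proof.
move=> M0 eM lM; have M0' : M%:R != 0 :> R by rewrite pnatr_eq0 -lt0n.
pose u : R[i] := expi (2 * pi * theta); pose zeta : R[i] := expi (2 * pi / M%:R).
have yE k : expi (2 * pi * (theta + k%:R / M%:R)) = u * zeta ^+ k :> R[i].
  by rewrite -expi_natmul -expiD; congr expi; ring.
case: eqP => [<-|/eqP el].
  transitivity (\sum_(k < M) (1 : R[i])); last by rewrite sumr_const card_ord.
  by apply: eq_bigr => k _; rewrite -exprMn mulfV ?expr1n ?expi_neq0.
have zM : zeta ^+ M = 1.
  rewrite -expi_natmul (_ : M%:R * _ = 0 + 1%:~R * (2 * pi)).
    by apply: complex_eq; rewrite /= ?(sin_cos_period 1 0).1 ?(sin_cos_period 1 0).2 ?sin0 ?cos0.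
  by rewrite add0r mul1r mulrC divfK.
pose w := zeta ^+ e * zeta^-1 ^+ l.
transitivity (u ^+ e * u^-1 ^+ l * \sum_(k < M) w ^+ k).
  rewrite mulr_sumr; apply: eq_bigr => k _; rewrite yE invfM /w !exprMn.
  by rewrite -(exprVn zeta k) (exprAC zeta) (exprAC zeta^-1) mulrACA.
rewrite geometric_sum_root ?mulr0//.
  apply/eqP => w1; apply/negP: el; rewrite negbK; apply/eqP.
  apply: (@expi_frac_inj M) => //; rewrite -/zeta.
  move/(congr1 (fun v => v * zeta ^+ l)): w1; rewrite /w -mulrA -exprMn mulVf ?expi_neq0//.
  by rewrite expr1n mulr1 mul1r.
by rewrite /w exprMn (exprAC zeta) zM (exprAC zeta^-1) exprVn zM invr1 !expr1n mulr1.
Qed.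

(** A trigonometric polynomial of degree less than N is recovered from its values at
    the p.+2 * N nodes theta + k / M. A Dirichlet kernel of M frequencies does this by
    orthogonality; multiplying it by the p-th power of a normalised kernel of N
    frequencies keeps the identity, because the sum of the coefficients of that power
    is 1, and makes the weights decrease with the distance of the nodes to 0 modulo 1. *)
Lemma sampling_formula (p N : nat) (theta : R) : (0 < N)%N ->
  0 <= theta -> theta < ((p.+2 * N)%:R)^-1 ->
  exists W : 'I_(p.+2 * N) -> R[i],
    (forall k, normc (W k) <= (2 * p.+2%:R / (1 + (minn k (p.+2 * N - 1 - k))%:R)) ^+ p) /\
    (forall n : int, (`|n| < N)%N ->
      \sum_k W k * expi (2 * pi * (n%:~R * (theta + k%:R / (p.+2 * N)%:R))) = 1).
Proof.
move=> N0 th0 th1; pose M := (p.+2 * N)%N.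
have M0 : (0 < M)%N by rewrite muln_gt0.
have NC : N%:R != 0 :> R[i] by rewrite pnatr_eq0 -lt0n.
have MC : M%:R != 0 :> R[i] by rewrite pnatr_eq0 -lt0n.
pose y (k : 'I_M) : R[i] := expi (2 * pi * (theta + k%:R / M%:R)).
have yn0 k : y k != 0 by exact: expi_neq0.
have normy k : normc (y k) = 1 by exact: normc_expi.
have normX (a : R[i]) n : normc (a ^+ n) = normc a ^+ n.
  by elim: n => [|n IH]; rewrite ?expr0 ?Normc.normc1// !exprS Normc.normcM IH.
have normsum n (F : nat -> R[i]) : (forall i, normc (F i) <= 1) -> normc (\sum_(i < n) F i) <= n%:R.
  move=> F1; rewrite -(big_mkord xpredT F).
  apply: le_trans (normc_sum_le _ _) _; rewrite -[X in X%:R]subn0 -sumr_const_nat.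
  exact: ler_sum.
pose Q (z : R[i]) := (N%:R^-1 * \sum_(a < N) z ^+ a) ^+ p.
pose Dk (z : R[i]) := \sum_(l < M) z^-1 ^+ l.
have normcnat n : normc (n%:R : R[i]) = n%:R by rewrite normcMn Normc.normc1.
(* The factor y k ^+ N makes all the frequencies n + N nonnegative. *)
exists (fun k => M%:R^-1 * (Q (y k) * (y k ^+ N * Dk (y k)))); split.
  move=> k; have MR : 0 < M%:R :> R by rewrite ltr0n.
  have NR : 0 < N%:R :> R by rewrite ltr0n.
  have nQ0 : 0 <= normc (Q (y k)) by exact: normc_nneg.
  apply: (@le_trans _ _ (normc (Q (y k)))).
    rewrite !Normc.normcM Normc.normcV normcnat normX normy expr1n mul1r.
    rewrite mulrCA ler_piMr// ler_pdivrMl// mulr1.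
    by apply: normsum => l; rewrite normX Normc.normcV normy invr1 expr1n.
  rewrite /Q normX; apply: lerXn2r; rewrite ?nnegrE; [exact: normc_nneg| |].
    by apply: divr_ge0; [apply: mulr_ge0|rewrite addr_ge0]; rewrite ?ler0n ?ler01.
  rewrite Normc.normcM Normc.normcV normcnat ler_pdivrMl//.
  set d := minn _ _; set Sa := \sum_(a < N) _.
  have SN : normc Sa <= N%:R by apply: normsum => a; rewrite normX normy expr1n.
  have [d0|d0] := posnP d.
    rewrite d0 addr0 divr1; apply: le_trans SN _; rewrite ler_peMr//.
    by rewrite -natrM ler1n.
  pose z := theta + k%:R / M%:R.
  have kM : k%:R + 1 <= M%:R :> R by rewrite natr1 ler_nat.
  have dk : d%:R <= k%:R :> R by rewrite ler_nat geq_minl.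
  have dk' : d%:R <= M%:R - 1 - k%:R :> R.
    have kM0 : (k < M)%N := ltn_ord k.
    have := geq_minr k (M - 1 - k); rewrite -/d -(ler_nat R) natrB; last by lia.
    by rewrite natrB.
  have thM : theta * M%:R < 1 by rewrite -ltr_pdivlMr// div1r.
  have zM : z * M%:R = theta * M%:R + k%:R by rewrite mulrDl divfK// gt_eqF.
  have thM0 : 0 <= theta * M%:R by rewrite mulr_ge0// ltW.
  have z0 : 0 <= z by rewrite addr_ge0// divr_ge0.
  have z1 : z < 1 by rewrite -(ltr_pM2r MR) zM mul1r; lra.
  have zmin : d%:R <= Num.min z (1 - z) * M%:R.
    by case: (leP z (1 - z)) => _; rewrite ?mulrBl ?mul1r zM; lra.
  have ysub : normc (y k - 1) * normc Sa <= 2.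
    rewrite -Normc.normcM -subrX1; apply: le_trans (le_normcD _ _) _.
    by rewrite normcN Normc.normc1 normX normy expr1n.
  have := normc_expi_sub1 z0 z1; rewrite -/(y k) => ylow.
  have S0 : 0 <= normc Sa by exact: normc_nneg.
  have dR : 1 <= d%:R :> R by rewrite ler1n.
  have dS : d%:R * normc Sa <= M%:R.
    have h1 : Num.min z (1 - z) * normc Sa <= 1.
      have := ler_wpM2r S0 ylow; lra.
    apply: (@le_trans _ _ (Num.min z (1 - z) * M%:R * normc Sa)).
      exact: ler_wpM2r.
    by rewrite mulrAC ler_piMl// ltW.
  have ME : M%:R = p.+2%:R * N%:R :> R by rewrite -natrM.
  have d1 : 0 < 1 + d%:R :> R by rewrite ltr_pwDl.
  have -> : N%:R * (2 * p.+2%:R / (1 + d%:R)) = N%:R * (2 * p.+2%:R) / (1 + d%:R) :> R.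
    by rewrite !mulrA.
  rewrite ler_pdivlMr//.
  have : p.+2%:R >= 1 :> R by rewrite ler1n.
  move: dS SN NR dR S0; rewrite ME; clear.
  move: (normc Sa) (d%:R : R) (p.+2%:R : R) (N%:R : R) => a b c e; nra.
move=> n nN; pose c := absz (n + N%:Z)%R.
have cE : c%:Z = n + N%:Z by rewrite /c; lia.
have c2 : (c < 2 * N)%N by lia.
have c0 : (0 < c)%N by lia.
pose P : {poly R[i]} := (\poly_(a < N) N%:R^-1) ^+ p.
have PQ z : Q z = P.[z].
  rewrite /Q /P horner_exp; congr (_ ^+ _); rewrite horner_poly mulr_sumr.
  by [].
have sP : (size P <= p * N.-1 + 1)%N.
  apply: leq_trans (size_poly_exp_leq _ _) _; rewrite addn1 ltnS mulnC leq_mul2l.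
  apply/orP; right; have := size_poly N (fun=> N%:R^-1 : R[i]).
  by rewrite -(ltn_predK N0) /=; move: (size _) => [|?].
pose B := (p * N.-1 + 1)%N.
have BM b : (b < B)%N -> (b + c < M)%N by rewrite /B /M; nia.
have key k : y k ^+ N * expi (2 * pi * (n%:~R * (theta + k%:R / M%:R))) = y k ^+ c.
  rewrite /y -!expi_natmul -expiD; congr expi.
  have -> : (c%:R : R) = n%:~R + N%:R.
    by rewrite -[c%:R]/((c%:Z)%:~R) cE intrD.
  ring.
transitivity (\sum_(b < B) P`_b).
  transitivity (\sum_(k < M) \sum_(b < B) \sum_(l < M)
      M%:R^-1 * P`_b * (y k ^+ (b + c) * (y k)^-1 ^+ l)).
    apply: eq_bigr => k _; rewrite PQ (horner_coef_wide _ sP).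
    have shuffle (a b c' d e : R[i]) : a * (b * (c' * d)) * e = b * (a * (d * (c' * e))) by ring.
    rewrite shuffle key mulr_suml; apply: eq_bigr => b _.
    rewrite /Dk mulr_suml 2!mulr_sumr; apply: eq_bigr => l _.
    have shuffle2 (a b' c' d e : R[i]) : b' * d * (a * (e * c')) = a * b' * (d * c' * e) by ring.
    by rewrite exprD shuffle2.
  rewrite exchange_big/=; apply: eq_bigr => b _.
  rewrite exchange_big/=.
  have bc := BM b (ltn_ord b).
  rewrite (bigD1 (Ordinal bc))//= [X in _ + X]big1 ?addr0.
    rewrite -mulr_sumr sampling_orthogonality// eqxx mulrAC mulVf ?mul1r//.
  move=> l lb; rewrite -mulr_sumr sampling_orthogonality// ifF ?mulr0//.
  by apply/negbTE; rewrite eq_sym.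
have := horner_coef_wide 1 sP; rewrite -PQ /Q.
under eq_bigr do rewrite expr1n.
rewrite sumr_const card_ord mulVf// expr1n => ->.
by apply: eq_bigr => b _; rewrite expr1n mulr1.
Qed.

End sampling.

(** * The Nikolskii inequality for iterated rearrangements *)

Section sampling_rearrangement.
Context {R : realType}.
Local Notation mu := (@lebesgue_measure R).

Lemma sum_inverse_squares n : \sum_(k < n) ((k.+1%:R) ^- 2 : R) <= 2 - n%:R^-1.
Proof.
elim: n => [|n IH]; first by rewrite big_ord0 invr0; lra.
rewrite big_ord_recr/=; case: n IH => [|n] IH; first by rewrite big_ord0; lra.
apply: le_trans (lerD IH (lexx _)) _.
have a0 : 0 < n.+1%:R :> R by rewrite ltr0n.
have -> : n.+2%:R = n.+1%:R + 1 :> R by rewrite natr1.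
move: a0; move: (n.+1%:R : R) => a a0.
have E : a^-1 - (a + 1)^-1 - (a + 1) ^- 2 = a^-1 * (a + 1) ^- 2 :> R.
  by field; rewrite !gt_eqF//; lra.
have : 0 <= a^-1 * (a + 1) ^- 2 :> R.
  by rewrite mulr_ge0// ?invr_ge0 ?exprn_ge0 ?ltW//; lra.
rewrite -E; lra.
Qed.

(** One more than the distance of k to the ends of the range: up to a factor M, the
    distance of the node theta + k / M to the integers. *)
Definition end_distance M (k : 'I_M) : R := 1 + (minn k (M - 1 - k))%:R.

Lemma end_distance_ge1 M (k : 'I_M) : 1 <= end_distance k.
Proof. by rewrite /end_distance lerDl. Qed.

Lemma sum_end_distance M : \sum_(k < M) end_distance k ^- 2 <= 4.
Proof.
apply: (@le_trans _ _ (\sum_(k < M) (k.+1%:R ^- 2 + (rev_ord k).+1%:R ^- 2))).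
  apply: ler_sum => k _; rewrite /end_distance.
  have -> : rev_ord k = (M - 1 - k)%N :> nat by rewrite /=; lia.
  rewrite !nat1r; case: leqP => _; rewrite ?lerDl ?lerDr invr_ge0 exprn_ge0//.
have revE : \sum_(k < M) (rev_ord k).+1%:R ^- 2 = \sum_(k < M) k.+1%:R ^- 2 :> R.
  by rewrite [RHS](reindex_inj rev_ord_inj).
rewrite big_split/= revE.
have := sum_inverse_squares M; have : 0 <= M%:R^-1 :> R by rewrite invr_ge0.
lra.
Qed.

Lemma esum_ord M (a : 'I_M -> R) : (forall k, 0 <= a k) ->
  (\esum_(k in [set: 'I_M]) (a k)%:E)%E = (\sum_(k < M) a k)%:E.
Proof.
move=> a0; rewrite esum_fset; [|exact: finite_finset|by move=> k _; rewrite lee_fin].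
rewrite -sumEFin fsbig_finite/=; last exact: (@finite_finset (ordinal M)).
  rewrite -[RHS]big_enum; apply: perm_big; apply: uniq_perm => [||k].
  - exact: finmap.fset_uniq.
  - exact: enum_uniq.
  - rewrite mem_enum in_fset_set; last exact: finite_finset.
    by apply: asboolT.
Qed.

Context {m : nat}.

Lemma upd_comm (x : m.-tuple R) i j s t : i != j -> upd (upd x i s) j t = upd (upd x j t) i s.
Proof.
move=> ij; apply: eq_from_tnth => l; rewrite !tnth_upd.
by case: eqP => // ->; case: eqP => // E; rewrite E eqxx in ij.
Qed.

Lemma foldl_rearr_periodic (F : m.-tuple R -> \bar R) j r : j \notin r ->
  (forall (x : m.-tuple R), F (upd x j (tnth x j + 1)) = F x) ->
  forall (x : m.-tuple R), foldl rearrangement_in F r (upd x j (tnth x j + 1)) =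
    foldl rearrangement_in F r x.
Proof.
elim: r F => [|i r IH] F//=; rewrite inE negb_or => /andP[ji jr] FP.
apply: IH => // x; rewrite /rearrangement_in tnth_upd eq_sym (negbTE ji).
congr rearrangement; apply/funext => t.
rewrite upd_comm// -[in RHS]FP tnth_upd (negbTE ji)//.
Qed.

(** Given a level l above the right-hand side, the set of the u such that v k * G(u) >
    l at the scaled point has measure less than t k. Since the t k add up to less than
    1 / (2 M), some theta below 1 / M makes every node avoid these sets, and then l
    bounds the value at x. *)
Lemma rearr_in_sampling (M : nat) (F : m.-tuple R -> \bar R) (v e t : 'I_M -> R) j r :
  (0 < M)%N -> uniq r -> j \notin r -> (forall x, 0 <= F x)%E ->
  (forall (x : m.-tuple R), F (upd x j (tnth x j + 1)) = F x) ->
  (forall theta : R, 0 <= theta -> theta < M%:R^-1 -> forall (x : m.-tuple R),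
    (F x <= ereal_sup [set (v k)%:E * F (upd x j (tnth x j + theta + k%:R / M%:R))%R |
       k in [set: 'I_M]])%E) ->
  (forall k, 0 < v k) -> (forall k, 0 < e k) -> \sum_k e k <= 2^-1 ->
  (forall k, 0 < t k) -> \sum_k t k < 2^-1 * M%:R^-1 ->
  forall (y : m.-tuple R), 0 < tnth y j ->
  (rearrangement_in (foldl rearrangement_in F r) j y <=
   ereal_sup [set (v k)%:E * rearrangement_in (foldl rearrangement_in F r) j
     (coordwise (fun i => if i == j then fun=> t k else if i \in r then *%R (e k) else id) y) |
     k in [set: 'I_M]])%E.
Proof.
move=> M0 ur jr F0 FP samp v0 e0 e2 t0 t2 y yj0.
set G := foldl _ _ _; set S := ereal_sup _.
have G0 x : (0 <= G x)%E by exact: foldl_rearr_ge0.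
have GP := foldl_rearr_periodic jr FP.
pose i0 : 'I_M := Ordinal M0.
pose z k := coordwise (fun i => if i == j then fun=> t k else if i \in r then *%R (e k) else id) y.
have S0 : (0 <= S)%E.
  apply: le_trans (ereal_sup_ubound _); last by exists i0.
  by apply: mule_ge0; [rewrite lee_fin ltW|exact: rearr_ge0].
apply: rearr_le => // l l0 Sl.
rewrite (_ : _ `&` _ = set0) ?measure0 ?lte_fin//.
apply/seteqP; split => // x [x01 /= lx].
pose h k (u : R) := G (upd (z k) j u).
have hper k u : h k (u + 1) = h k u.
  by rewrite /h; have := GP (upd (z k) j u); rewrite upd_upd tnth_upd eqxx -/G.
pose E k := `[0%R, 1%R]%classic `&` [set u | (l / v k)%:E < h k u]%E.
have muE k : (mu (E k) < (t k)%:E)%E.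
  have := @rearr_lt _ (h k) (t k) (l / v k); apply.
  have : ((v k)%:E * rearrangement_in G j (z k) < l%:E)%E.
    by apply: le_lt_trans Sl; apply: ereal_sup_ubound; exists k.
  rewrite muleC -lte_pdivlMr// -EFinM /rearrangement_in tnth_coordwise eqxx.
  by rewrite mulrC.
have MR : 0 < M%:R :> R by rewrite ltr0n.
pose D := `[0%R, M%:R^-1[%classic : set R.
pose A k := D `&` [set th : R | ((l / v k)%:E < h k (x + th + k%:R / M%:R)%R)%E].
have muA k : (mu (A k) <= (2 * t k)%:E)%E.
  (* The node x + th + k / M lies in [0, 2]; its translate by 0 or by -1 is in E k. *)
  have sub : A k `<=` (fun u : R => (1 * u + (- x - k%:R / M%:R))%R) @` E k `|`
                      (fun u : R => (1 * u + (1 - x - k%:R / M%:R))%R) @` E k.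
    move=> th [/= thD hth].
    have th0 : 0 <= th by move: thD; rewrite /D /= in_itv/= => /andP[].
    have th1 : th < M%:R^-1 by move: thD; rewrite /D /= in_itv/= => /andP[].
    have x0 : 0 <= x by move: x01; rewrite /= in_itv/= => /andP[].
    have x1 : x <= 1 by move: x01; rewrite /= in_itv/= => /andP[].
    have kM : th + k%:R / M%:R <= 1.
      have k1 : k%:R + 1 <= M%:R :> R by rewrite natr1 ler_nat.
      have thM : th * M%:R <= 1 by rewrite -ler_pdivlMr// div1r ltW.
      rewrite -(ler_pM2r MR) mulrDl divfK ?gt_eqF// mul1r; lra.
    have kM0 : 0 <= k%:R / M%:R :> R by rewrite divr_ge0.
    have [le1|gt1] := leP (x + th + k%:R / M%:R) 1.
      left; exists (x + th + k%:R / M%:R); last by rewrite mul1r; ring.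
      by split => //; rewrite /= in_itv/= le1 andbT; lra.
    right; exists (x + th + k%:R / M%:R - 1); last by rewrite mul1r; ring.
    split; first by rewrite /= in_itv/=; apply/andP; split; lra.
    by rewrite /= -hper subrK.
  apply: le_trans (le_outer_measure ((wlength idfun)^*)%mu _ _ sub) _.
  apply: le_trans (outer_measureU2 _ _ _) _.
  have -> : 2 * t k = t k + t k :> R by ring.
  rewrite EFinD.
  by apply: leeD; (apply: le_trans (lebesgue_affine_le _ _ _) _; first exact: ltr01);
    rewrite mul1e ltW.
have [th thD thA] : exists2 th, D th & forall k, ~ A k th.
  apply: outer_pigeonhole.
  rewrite (_ : mu D = (M%:R^-1)%:E); last first.
    by rewrite /D lebesgue_measure_itv/= lte_fin invr_gt0 MR sube0.
  apply: (@le_lt_trans _ _ (\esum_(k in [set: 'I_M]) (2 * t k)%:E)%E).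
    by apply: le_esum => k _; exact: muA.
  rewrite esum_ord; last by move=> k; rewrite mulr_ge0// ltW.
  rewrite lte_fin -mulr_sumr; move: t2; move: (\sum_k _) (M%:R^-1 : R) => a b; lra.
apply/negP: lx; rewrite -leNgt.
have th0 : 0 <= th by move: thD; rewrite /D /= in_itv/= => /andP[].
have th1 : th < M%:R^-1 by move: thD; rewrite /D /= in_itv/= => /andP[].
have esumE : (\esum_(k in [set: 'I_M]) (e k)%:E <= (2^-1)%:E)%E.
  by rewrite esum_ord ?lee_fin// => k; rewrite ltW.
pose sh (k : 'I_M) (i : 'I_m) : R -> R :=
  if i == j then (fun u => u + th + k%:R / M%:R) else id.
have := @foldl_rearr_sup R m _ i0 F (fun k x => (v k)%:E * F x)%E sh e r e0 esumE ur.
move=> /(_ _ _ (upd y j x)) H; apply: le_trans (H _ _) _.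
- move=> k i ir; rewrite /sh ifF//; apply/eqP => ij; by rewrite -ij ir in jr.
- move=> w _; apply: le_trans (samp th th0 th1 w) _.
  rewrite le_eqVlt; apply/orP; left; apply/eqP; congr ereal_sup.
  apply: eq_imagel => k _; congr (_ * F _)%E.
  apply: eq_from_tnth => i; rewrite tnth_upd tnth_coordwise /sh; case: eqP => // ->.
  by [].
- apply: ge_ereal_sup => _ [k _ <-]; rewrite foldl_rearrZ// -/G.
  rewrite muleC -lee_pdivlMr//.
  have -> : coordwise (fun i => if i \in r then *%R (e k) else sh k i) (upd y j x) =
     upd (z k) j (x + th + k%:R / M%:R).
    apply: eq_from_tnth => i; rewrite tnth_coordwise !tnth_upd /z tnth_coordwise /sh.
    by case: eqP => [->|//]; rewrite (negbTE jr).
  rewrite leNgt; apply/negP => hk; apply: (thA k); split => //.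
Qed.

End sampling_rearrangement.

Section nikolskii.
Context {R : realType} {m : nat}.

(** Satisfied by 1 / phi for a concave phi. *)
Definition slowly_decreasing (q : R -> R) : Prop :=
  (forall s t, 0 < s -> s <= t -> t <= 1 -> 0 <= q t <= q s) /\
  (forall e t, 0 < e -> e <= 1 -> 0 < t -> t <= 1 -> q (e * t) <= q t / e).

Lemma slowly_decreasing_max (q : R -> R) a : 0 < a -> a <= 1 ->
  slowly_decreasing q -> slowly_decreasing (fun u => q (Num.max u a)).
Proof.
move=> a0 a1 [qd qe]; split=> [s t s0 st t1|e t e0 e1 t0 t1].
  apply: qd; first by rewrite lt_max s0.
    by rewrite ge_max !le_max st lexx orbT.
  by rewrite ge_max t1.
have M0 : 0 < Num.max t a by rewrite lt_max t0.
have M1 : Num.max t a <= 1 by rewrite ge_max t1.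
apply: le_trans (qe _ _ e0 e1 M0 M1).
have [|||_ h] := andP (qd (e * Num.max t a) (Num.max (e * t) a) _ _ _).
- by rewrite mulr_gt0.
- by case: (leP t a) => _; rewrite le_max ?lexx// ler_piMl ?orbT// ltW.
- by rewrite ge_max a1 andbT mulr_ile1// ltW.
- exact: h.
Qed.

(** The exceptional steps in the other variables do not change the j-th one. *)
Lemma exceptional_nonpos j (r : seq 'I_m) (Z : m.-tuple R -> Prop) : j \notin r ->
  (forall x, Z x -> tnth x j <= 0) ->
  forall x, foldl exceptional_step Z r x -> tnth x j <= 0.
Proof.
elim: r Z => [|i r IH] Z //=; rewrite inE negb_or => /andP[ji jr] ZP.
apply: IH => // x; rewrite /exceptional_step /coordinate_op => H.
rewrite leNgt; apply/negP => xj; apply: H.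
rewrite (_ : _ `&` _ = set0) ?measure0//; apply/seteqP; split => // t [_ /ZP].
by rewrite tnth_upd (negbTE ji) leNgt xj.
Qed.

(** Uses rearr_in_sampling in the j-th variable, followed by the rearrangements in the
    later variables. Scaling the other variables by e k and taking the j-th one at t k
    costs a power of the end distance of k, which the weights compensate. *)
Lemma nikolskii_step (K N : nat) (V A : R) (F : m.-tuple R -> \bar R) (q : 'I_m -> R -> R) j :
  (0 < K)%N -> (0 < N)%N -> 0 < V -> 0 <= A ->
  (forall x, 0 <= F x)%E ->
  (forall (x : m.-tuple R), F (upd x j (tnth x j + 1)) = F x) ->
  (forall theta : R, 0 <= theta -> theta < (K * N)%:R^-1 -> forall (x : m.-tuple R),
    (F x <= ereal_sup [set (V * end_distance k ^- (2 * m + 2))%:E *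
         F (upd x j (tnth x j + theta + k%:R / (K * N)%:R))%R |
       k in [set: 'I_(K * N)]])%E) ->
  (forall i, slowly_decreasing (q i)) ->
  (forall u : m.-tuple R, (forall i, 0 < tnth u i <= 1) ->
    (foldl rearrangement_in F (enum 'I_m) u <= (A * \prod_i q i (tnth u i))%:E)%E) ->
  forall u : m.-tuple R, (forall i, 0 < tnth u i <= 1) ->
    (foldl rearrangement_in F (enum 'I_m) u <=
     (V * (16 * K%:R) * 8 ^+ m * A * (q j N%:R^-1 * \prod_(i | i != j) q i (tnth u i)))%:E)%E.
Proof.
move=> K0 N0 V0 A0 F0 FP samp qsd bound u u01.
pose M := (K * N)%N; have M0 : (0 < M)%N by rewrite muln_gt0 K0.
have MR : 0 < M%:R :> R by rewrite ltr0n.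
have KR : 0 < K%:R :> R by rewrite ltr0n.
have NR : 0 < N%:R :> R by rewrite ltr0n.
pose d (k : 'I_M) : R := end_distance k.
have d1 k : 1 <= d k by exact: end_distance_ge1.
have d0 k : 0 < d k by exact: lt_le_trans (d1 k).
pose v k := V * d k ^- (2 * m + 2).
pose e k := 8^-1 * d k ^- 2.
pose c k := (16 * K%:R)^-1 * d k ^- 2.
pose t k := c k * N%:R^-1.
have dd0 k : 0 < d k ^- 2 by rewrite invr_gt0 exprn_gt0.
have dd1 k : d k ^- 2 <= 1 by rewrite invf_le1 ?exprn_gt0// exprn_ege1.
have v0 k : 0 < v k by rewrite mulr_gt0// invr_gt0 exprn_gt0.
have e0 k : 0 < e k by rewrite mulr_gt0.
have c0 k : 0 < c k by rewrite mulr_gt0// invr_gt0 mulr_gt0.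
have t0 k : 0 < t k by rewrite mulr_gt0// invr_gt0.
have e2 : \sum_k e k <= 2^-1.
  by rewrite -mulr_sumr; have := @sum_end_distance R M; rewrite -/d; lra.
have t2 : \sum_k t k < 2^-1 * M%:R^-1.
  rewrite -mulr_suml -mulr_sumr natrM !invfM.
  have S4 := @sum_end_distance R M.
  have a0 : 0 < K%:R^-1 * N%:R^-1 :> R by rewrite mulr_gt0 ?invr_gt0.
  have := ler_wpM2r (ltW a0) S4; rewrite -/d; lra.
have e1 k : e k <= 1 by have := dd1 k; rewrite /e; lra.
have c1 k : c k <= 1.
  have h : (16 * K%:R)^-1 <= 1 :> R.
    rewrite invf_le1 ?mulr_gt0//; have : 1 <= K%:R :> R by rewrite ler1n.
    lra.
  by rewrite /c mulr_ile1 ?invr_ge0 ?mulr_ge0 ?exprn_ge0 ?ler0n ?(ltW (d0 k))// dd1.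
have NV1 : N%:R^-1 <= 1 :> R by rewrite invf_le1// ler1n.
have NV0 : 0 < N%:R^-1 :> R by rewrite invr_gt0.
have t1 k : t k <= 1 by rewrite mulr_ile1// ltW.
have := enum_uniq 'I_m.
have memE i : i \in enum 'I_m by rewrite mem_enum.
have jE := memE j; move: bound memE; case/splitPr: jE => r1 r2 bound memE.
rewrite cat_uniq/= => /and3P[ur1 /norP[jr1 /hasPn r12] /andP[jr2 ur2]].
have memr i : i != j -> (i \in r1) || (i \in r2).
  by move=> ij; have := memE i; rewrite mem_cat inE (negbTE ij).
have uj : 0 < tnth u j by case/andP: (u01 j).
pose G2 := rearrangement_in (foldl rearrangement_in F r1) j.
have G20 (x : m.-tuple R) : (0 <= G2 x)%E by exact: rearr_ge0.
(* Rearrangements are +oo at nonpositive arguments, but the j-th coordinate of u is positive. *)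
pose F' (x : m.-tuple R) := if 0 < tnth x j then G2 x else 0%E.
have foldE G : foldl rearrangement_in G (r1 ++ j :: r2) =
    foldl rearrangement_in (rearrangement_in (foldl rearrangement_in G r1) j) r2.
  by rewrite foldl_cat.
pose w k := coordwise (fun i => if i == j then fun=> t k else *%R (e k)) u.
have H : (foldl rearrangement_in F (r1 ++ j :: r2) u <= ereal_sup
    [set (v k)%:E * foldl rearrangement_in F (r1 ++ j :: r2) (w k) | k in [set: 'I_M]])%E.
  rewrite foldE -/G2.
  apply: (@le_trans _ _ (foldl rearrangement_in F' r2 u)).
    apply: (@foldl_rearr_ae _ _ _ _ (fun x => tnth x j <= 0)) => [x _ /negP|].
      by rewrite -ltNge /F' => ->.
    by move/(exceptional_nonpos jr2 (fun _ h => h)); rewrite leNgt uj.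
  pose s k i := if i == j then (fun=> t k) else if i \in r1 then *%R (e k) else id : R -> R.
  have esumE : (\esum_(k in [set: 'I_M]) (e k)%:E <= (2^-1)%:E)%E.
    by rewrite esum_ord ?lee_fin// => k; rewrite ltW.
  have := @foldl_rearr_sup R m _ (Ordinal M0) F' (fun k x => (v k)%:E * G2 x)%E s e r2 e0 esumE ur2.
  move=> /(_ _ _ u) H; apply: le_trans (H _ _) _.
  - move=> k i ir; rewrite /s ifF ?ifF//; last by apply/eqP => ij; rewrite -ij ir in jr2.
    by apply/negP => ir1; have := r12 _ ir; rewrite ir1.
  - move=> x _; rewrite /F'; case: ifP => xj.
      exact: (rearr_in_sampling M0 ur1 jr1 F0 FP samp v0 e0 e2 t0 t2).
    apply: (@le_trans _ _ ((v (Ordinal M0))%:E * G2 (coordwise (s (Ordinal M0)) x))%E).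
      by apply: mule_ge0; [rewrite lee_fin ltW|exact: G20].
    by apply: ereal_sup_ubound; exists (Ordinal M0).
  - apply: ge_ereal_sup => _ [k _ <-]; apply: ereal_sup_ubound; exists k => //.
    rewrite foldl_rearrZ//.
    rewrite (_ : coordwise _ u = w k)//; apply: eq_from_tnth => i; rewrite !tnth_coordwise /s.
    have [->|ij] := eqVneq i j; first by rewrite (negbTE jr2).
    by case/orP: (memr i ij) => ->//; case: ifP.
apply: le_trans H _; apply: ge_ereal_sup => _ [k _ <-].
have w01 i : 0 < tnth (w k) i <= 1.
  rewrite tnth_coordwise; case: ifP => _; first by rewrite t0 t1.
  have /andP[a b] := u01 i; rewrite mulr_gt0//= mulr_ile1// ltW//.
apply: le_trans (lee_wpmul2l _ (bound (w k) w01)) _; first by rewrite lee_fin ltW.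
rewrite -EFinM lee_fin.
rewrite (bigD1 j)//= tnth_coordwise eqxx.
have qt : q j (t k) <= q j N%:R^-1 * (16 * K%:R * d k ^+ 2).
  have [_ h] := qsd j; apply: le_trans (h _ _ (c0 k) (c1 k) NV0 NV1) _.
  by rewrite /c invfM !invrK.
have q0 i x : 0 < x -> x <= 1 -> 0 <= q i x.
  by move=> x0 x1; have [h _] := qsd i; have /andP[] := h x x x0 (lexx x) x1.
have P0 : 0 <= \prod_(i | i != j) q i (tnth u i).
  by apply: prodr_ge0 => i _; have /andP[a b] := u01 i; exact: q0.
have b1 : 1 <= 8 * d k ^+ 2.
  by have := @exprn_ege1 R 2 (d k) (d1 k); lra.
have qP : \prod_(i | i != j) q i (tnth (w k) i) <=
    (\prod_(i | i != j) q i (tnth u i)) * (8 * d k ^+ 2) ^+ m.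
  apply: (@le_trans _ _ (\prod_(i | i != j) (q i (tnth u i) * (8 * d k ^+ 2)))).
    apply: ler_prod => i ij; have /andP[a b] := u01 i.
    rewrite tnth_coordwise (negbTE ij); apply/andP; split.
      by apply: q0; [rewrite mulr_gt0|rewrite mulr_ile1// ltW].
    have [_ h] := qsd i; apply: le_trans (h _ _ (e0 k) (e1 k) a b) _.
    by rewrite /e invfM !invrK.
  rewrite big_split/= prodr_const ler_wpM2l// ler_weXn2l//.
  by rewrite -[X in (_ <= X)%N]card_ord; exact: max_card.
have qt0 : 0 <= q j (t k) by exact: q0.
have qw0 : 0 <= \prod_(i | i != j) q i (tnth (w k) i).
  by apply: prodr_ge0 => i _; have /andP[a b] := w01 i; exact: q0.
have := ler_pM qt0 qw0 qt qP.
move=> /(ler_wpM2l A0) /(ler_wpM2l (ltW (v0 k))) h; apply: le_trans h _.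
rewrite le_eqVlt; apply/orP; left; apply/eqP.
rewrite /v exprMn.
have dE : (d k ^+ (2 * m + 2))^-1 * (d k ^+ 2 * (d k ^+ 2) ^+ m) = 1.
  by rewrite -exprM -exprD addnC mulVf// gt_eqF// exprn_gt0.
set x := _^-1 in dE *; set y := _ ^+ 2 in dE *; set z := y ^+ m in dE *.
rewrite -[RHS]mul1r -dE; ring.
Qed.

Definition nikolskii_const (K : nat) (V : R) := V * (16 * K%:R) * 8 ^+ m.

(** Treats the variables one after the other. For t_j at least 1 / N_j there is
    nothing to do, and below nikolskii_step gives the value at 1 / N_j. *)
Lemma nikolskii (K : nat) (N : 'I_m -> nat) (V A : R) (F : m.-tuple R -> \bar R)
    (q : 'I_m -> R -> R) :
  (0 < K)%N -> (forall j, 0 < N j)%N -> 1 <= V -> 0 <= A ->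
  (forall x, 0 <= F x)%E ->
  (forall j (x : m.-tuple R), F (upd x j (tnth x j + 1)) = F x) ->
  (forall j (theta : R), 0 <= theta -> theta < (K * N j)%:R^-1 -> forall (x : m.-tuple R),
    (F x <= ereal_sup [set (V * end_distance k ^- (2 * m + 2))%:E *
         F (upd x j (tnth x j + theta + k%:R / (K * N j)%:R))%R |
       k in [set: 'I_(K * N j)]])%E) ->
  (forall i, slowly_decreasing (q i)) ->
  (forall u : m.-tuple R, (forall i, 0 < tnth u i <= 1) ->
    (foldl rearrangement_in F (enum 'I_m) u <= (A * \prod_i q i (tnth u i))%:E)%E) ->
  forall u : m.-tuple R, (forall i, 0 < tnth u i <= 1) ->
    (foldl rearrangement_in F (enum 'I_m) u <= (nikolskii_const K V ^+ m * A *
       \prod_i q i (Num.max (tnth u i) (N i)%:R^-1))%:E)%E.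
Proof.
move=> K0 N0 V1 A0 F0 FP samp qsd bound.
have V0 : 0 < V by exact: lt_le_trans V1.
have C1 : 1 <= nikolskii_const K V.
  rewrite /nikolskii_const !mulr_ege1 ?exprn_ege1//; [lra|by rewrite ler1n|lra].
have NV1 i : (N i)%:R^-1 <= 1 :> R by rewrite invf_le1 ?ltr0n// ler1n.
have NV0 i : 0 < (N i)%:R^-1 :> R by rewrite invr_gt0 ltr0n.
pose q' k (i : 'I_m) (u : R) := if (i < k)%N then q i (Num.max u (N i)%:R^-1) else q i u : R.
have q'sd k i : slowly_decreasing (q' k i).
  by rewrite /q'; case: (i < k)%N; [exact: slowly_decreasing_max|exact: qsd].
have H k : (k <= m)%N -> forall u : m.-tuple R, (forall i, 0 < tnth u i <= 1) ->
    (foldl rearrangement_in F (enum 'I_m) u <= (nikolskii_const K V ^+ k * A *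
       \prod_i q' k i (tnth u i))%:E)%E.
  elim: k => [_|k IH km] u u01; first by rewrite expr0 mul1r; exact: bound.
  pose j := Ordinal km; have {}IH := IH (ltnW km).
  have q'E i x : i != j -> q' k.+1 i x = q' k i x.
    move=> ij; rewrite /q' ltnS leq_eqVlt.
    by have -> : (val i == k) = false by apply/negbTE.
  have prodE : \prod_i q' k.+1 i (tnth u i) =
      q j (Num.max (tnth u j) (N j)%:R^-1) * \prod_(i | i != j) q' k i (tnth u i).
    rewrite (bigD1 j)//=; congr (_ * _); first by rewrite /q' ltnS leqnn.
    by apply: eq_bigr => i ij; exact: q'E.
  have P0 : 0 <= \prod_i q' k.+1 i (tnth u i).
    apply: prodr_ge0 => i _; have /andP[a b] := u01 i.
    by have [h _] := q'sd k.+1 i; have /andP[] := h _ _ a (lexx _) b.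
  have Ck : 0 <= nikolskii_const K V ^+ k by rewrite exprn_ge0// (le_trans ler01).
  have [uj|uj] := leP (N j)%:R^-1 (tnth u j).
    apply: le_trans (IH u u01) _; rewrite lee_fin.
    have E : \prod_i q' k i (tnth u i) = \prod_i q' k.+1 i (tnth u i).
      rewrite prodE max_l// (bigD1 j)//=; congr (_ * _).
      by rewrite /q' ltnn.
    rewrite E ler_wpM2r// ler_wpM2r// exprS ler_peMl//.
  have CA : 0 <= nikolskii_const K V ^+ k * A by rewrite mulr_ge0.
  apply: le_trans (nikolskii_step K0 (N0 j) V0 CA F0 (FP j) (samp j) (q'sd k) IH u01) _.
  rewrite lee_fin prodE max_r ?(ltW uj)// -/(nikolskii_const K V) exprS.
  have -> : q' k j (N j)%:R^-1 = q j (N j)%:R^-1 by rewrite /q' ltnn.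
  by rewrite !mulrA.
move=> u u01; apply: le_trans (H m (leqnn m) u u01) _; rewrite lee_fin.
rewrite le_eqVlt; apply/orP; left; apply/eqP; congr (_ * _).
by apply: eq_bigr => i _; rewrite /q' ltn_ord.
Qed.

End nikolskii.

Section delta_nikolskii.
Context {R : realType} {m : nat}.
Local Notation normc := Normc.normc.
Variables (f : m.-tuple R -> R[i]) (s : m.-tuple nat).

Lemma rho_lt k j : rho s k -> (absz (tnth k j) < 2 ^ tnth s j)%N.
Proof. by move=> /(_ j); rewrite dyadic_condition => /and3P[]. Qed.

Lemma pairing_shift k j (x : m.-tuple R) (t : R) :
  pairing k (upd x j (tnth x j + t)) = pairing k x + (tnth k j)%:~R * t.
Proof.
rewrite pairing_upd mulrDr addrA -pairing_upd; congr (pairing k _ + _).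
by apply: eq_from_tnth => i; rewrite tnth_upd; case: eqP => // ->.
Qed.

Lemma delta_periodic j (x : m.-tuple R) :
  delta f s (upd x j (tnth x j + 2 * pi)) = delta f s x.
Proof.
rewrite /delta; apply: eq_fsbigr => k _; congr (_ * _).
by rewrite pairing_shift /expi (sin_cos_period _ _).1 (sin_cos_period _ _).2.
Qed.

Lemma delta_sampling (p : nat) j (theta : R) : 0 <= theta ->
  theta < ((p.+2 * 2 ^ tnth s j)%:R)^-1 ->
  exists W : 'I_(p.+2 * 2 ^ tnth s j) -> R[i],
    (forall k, normc (W k) <= (2 * p.+2%:R / end_distance k) ^+ p) /\
    forall x : m.-tuple R, delta f s x = \sum_k W k *
      delta f s (upd x j (tnth x j + 2 * pi * (theta + k%:R / (p.+2 * 2 ^ tnth s j)%:R))).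
Proof.
move=> th0 th1.
have N0 : (0 < 2 ^ tnth s j)%N by rewrite expn_gt0.
have [W [WB WE]] := sampling_formula N0 th0 th1; exists W; split=> // x.
rewrite deltaE /=; under [RHS]eq_bigr do rewrite mulr_sumr.
rewrite exchange_big/=; apply: eq_big_seq => k ks.
have kN : (absz (tnth k j) < 2 ^ tnth s j)%N.
  apply: rho_lt; move: ks; rewrite in_fset_set; last exact: finite_rho.
  by move/set_mem.
rewrite -[LHS]mulr1 -(WE _ kN) mulr_sumr; apply: eq_bigr => l _.
rewrite pairing_shift expiD.
have -> : (tnth k j)%:~R * (2 * pi * (theta + l%:R / (p.+2 * 2 ^ tnth s j)%:R)) =
  2 * pi * ((tnth k j)%:~R * (theta + l%:R / (p.+2 * 2 ^ tnth s j)%:R)) :> R by ring.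
have sh (a b c d : R[i]) : a * b * (c * d) = c * (a * (b * d)) by ring.
by rewrite sh.
Qed.

(** The degree p = 2 m + 4 of the sampling kernel makes the weights decrease fast
    enough for the 2 m + 4 powers of the end distance lost: two in the sum over the
    nodes, two in the sampled variable and at most 2 m in the others. *)
Lemma delta_nikolskii (q : 'I_m -> R -> R) (A : R) (p := (2 * m + 4)%N) :
  (forall i, slowly_decreasing (q i)) -> 0 <= A -> weak_bound q A (delta f s) ->
  forall u : m.-tuple R, (forall j, 0 < tnth u j <= 1) ->
  (iterated_rearrangement (delta f s) u <=
    (nikolskii_const (m := m) p.+2 (4 * (2 * p.+2%:R : R) ^+ p) ^+ m * A *
      \prod_i q i (Num.max (tnth u i) (2 ^- tnth s i)))%:E)%E.
Proof.
move=> qsd A0 bound u u01.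
have KR : 1 <= p.+2%:R :> R by rewrite ler1n.
pose F (x : m.-tuple R) : \bar R := (normc (delta f s [tuple 2 * pi * tnth x i | i < m]))%:E.
have := @nikolskii R m p.+2 (fun i => 2 ^ tnth s i)%N (4 * (2 * p.+2%:R) ^+ p) A F q isT.
have dil (x : m.-tuple R) j t : [tuple 2 * pi * tnth (upd x j (tnth x j + t)) i | i < m] =
    upd [tuple 2 * pi * tnth x i | i < m] j (2 * pi * tnth x j + 2 * pi * t) :> m.-tuple R.
  apply: eq_from_tnth => i; rewrite tnth_mktuple !tnth_upd; case: eqP => _.
    by rewrite mulrDr.
  by rewrite tnth_mktuple.
have dilj (x : m.-tuple R) j : 2 * pi * tnth x j = tnth [tuple 2 * pi * tnth x i | i < m] j :> R.
  by rewrite tnth_mktuple.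
move=> /(_ _ _ A0 _ _ _ qsd bound u u01) H.
apply: le_trans (H _ _ _ _ _) _.
- by move=> j; rewrite expn_gt0.
- have : 1 <= (2 * p.+2%:R : R) ^+ p by rewrite exprn_ege1//; lra.
  lra.
- by move=> x; rewrite lee_fin normc_nneg.
- by move=> j x; rewrite /F dil mulr1 dilj delta_periodic.
- move=> j th th0 th1 x; set S := ereal_sup _.
  have [W [WB WE]] := delta_sampling (p := p) th0 th1.
  have FS (k : 'I_(p.+2 * 2 ^ tnth s j)) : ((4 * (2 * p.+2%:R) ^+ p * end_distance k ^- (2 * m + 2))%:E *
      F (upd x j (tnth x j + th + k%:R / (p.+2 * 2 ^ tnth s j)%:R))%R <= S)%E.
    by apply: ereal_sup_ubound; exists k.
  case: S FS => [b||] FS; last 2 first.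
  - by rewrite leey.
  - have M0 : (0 < p.+2 * 2 ^ tnth s j)%N by rewrite muln_gt0 expn_gt0.
    by have := FS (Ordinal M0); rewrite /F -EFinM leeNy_eq.
  rewrite /F WE lee_fin.
  pose Fk (k : 'I_(p.+2 * 2 ^ tnth s j)) := normc (delta f s (upd [tuple 2 * pi * tnth x i | i < m] j
    (tnth [tuple 2 * pi * tnth x i | i < m] j + 2 * pi * (th + k%:R / (p.+2 * 2 ^ tnth s j)%:R)))).
  apply: (@le_trans _ _ (\sum_k normc (W k) * Fk k)).
    rewrite (eq_bigr (fun k : 'I_(p.+2 * 2 ^ tnth s j) => normc (W k * delta f s (upd [tuple 2 * pi * tnth x i | i < m] j
      (tnth [tuple 2 * pi * tnth x i | i < m] j + 2 * pi * (th + k%:R / (p.+2 * 2 ^ tnth s j)%:R)))))).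
      elim/big_rec2: _ => [|k y z _ yz]; first by rewrite Normc.normc0.
      by apply: le_trans (le_normcD _ _) _; rewrite lerD2l.
    by move=> k _; rewrite Normc.normcM.
  have F0 k : 0 <= Fk k by exact: normc_nneg.
  have h (k : 'I_(p.+2 * 2 ^ tnth s j)) : 4 * (2 * p.+2%:R) ^+ p * end_distance k ^- (2 * m + 2) * Fk k <= b.
    by have := FS k; rewrite /F -addrA dil -EFinM lee_fin dilj -/(Fk k).
  have b0 : 0 <= b.
    have M0 : (0 < p.+2 * 2 ^ tnth s j)%N by rewrite muln_gt0 expn_gt0.
    have d0 : 0 <= end_distance (Ordinal M0) :> R by rewrite (le_trans ler01)// end_distance_ge1.
    have K0 : 0 <= 4 * (2 * p.+2%:R) ^+ p :> R by rewrite mulr_ge0// exprn_ge0//; lra.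
    apply: le_trans (h (Ordinal M0)); apply: mulr_ge0 => //; apply: mulr_ge0 => //.
    by rewrite invr_ge0 exprn_ge0.
  apply: (@le_trans _ _ (\sum_(k < p.+2 * 2 ^ tnth s j) 4^-1 * b * end_distance k ^- 2)).
    apply: ler_sum => k _.
    apply: le_trans (ler_wpM2r (F0 k) (WB k)) _.
    have d0 : 0 < end_distance k :> R by exact: lt_le_trans (end_distance_ge1 k).
    have dn n : end_distance k ^+ n != 0 :> R by rewrite gt_eqF// exprn_gt0.
    rewrite ler_pdivlMr ?exprn_gt0//.
    have i4 : 0 <= 4^-1 :> R by rewrite invr_ge0.
    apply: le_trans (ler_wpM2l i4 (h k)).
    rewrite le_eqVlt; apply/orP; left; apply/eqP.
    rewrite expr_div_n (_ : end_distance k ^+ p = end_distance k ^+ (2 * m + 2) * end_distance k ^+ 2).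
      have cancel (a D1 D2 c : R) : D1 != 0 -> D2 != 0 ->
        a / (D1 * D2) * c * D2 = 4^-1 * (4 * a / D1 * c).
        by move=> D10 D20; field; rewrite D10 D20.
      by apply: cancel; exact: dn.
    by rewrite -exprD /p -addnA.
  rewrite -mulr_sumr; have := @sum_end_distance R (p.+2 * 2 ^ tnth s j).
  move: (\sum_(k < _) _) b0 => c; clear; move=> b0 c4; nra.
- rewrite lee_fin le_eqVlt; apply/orP; left; apply/eqP; congr (_ * _).
  by apply: eq_bigr => i _; rewrite natrX.
Qed.

End delta_nikolskii.

(** * Weak type estimates in symmetric spaces *)

Section fundamental_functions.
Context {R : realType}.
Local Notation mu := (@lebesgue_measure R).
Implicit Types (phi psi : R -> R) (X : symmetric_space R).

Lemma Phi_mono phi s t : Phi_function phi -> 0 <= s -> s <= t -> t <= 1 -> phi s <= phi t.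
Proof.
move=> [_ ph _ _ _] s0 st t1; apply: ph => //; rewrite in_itv/=.
  by rewrite s0 (le_trans st).
by rewrite t1 (le_trans s0).
Qed.

Lemma Phi_scale phi e t : Phi_function phi -> 0 <= e -> e <= 1 -> 0 <= t -> t <= 1 ->
  e * phi t <= phi (e * t).
Proof.
move=> [cvx _ _ ph0 _] e0 e1 t0 t1.
have e01 : e \in `[0, 1] by rewrite in_itv/= e0.
have i0 : (0 : R) \in (`[0, 1]%classic : set R^o).
  by apply/mem_set; rewrite /= in_itv/= lexx ler01.
have it : t \in (`[0, 1]%classic : set R^o) by apply/mem_set; rewrite /= in_itv/= t0.
have := cvx (Itv01 e0 e1) t 0 it i0.
rewrite !convRE/= ph0 oppr0 !mulr0 !addr0 mulrN lerN2.
by rewrite /conv/= /convex.conv/= scaler0 addr0.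
Qed.

Lemma Phi_gt0 phi t : Phi_function phi -> 0 < t -> t <= 1 -> 0 < phi t.
Proof.
move=> Pp t0 t1; have [_ _ _ ph0 [u]] := Pp.
rewrite in_itv/= => /andP[u0 u1] pu.
have pu0 : 0 < phi u by rewrite lt_neqAle eq_sym pu -ph0 Phi_mono.
apply: (@lt_le_trans _ _ (t * phi u)); first by rewrite mulr_gt0.
apply: le_trans (Phi_scale Pp (ltW t0) t1 u0 u1) _.
by rewrite Phi_mono ?mulr_ge0 ?ler_piMr// ltW.
Qed.

Lemma slowly_decreasing_inv phi : Phi_function phi ->
  slowly_decreasing (fun t => (phi t)^-1).
Proof.
move=> Pp; split=> [s t s0 st t1|e t e0 e1 t0 t1].
  have t0 := lt_le_trans s0 st; have s1 := le_trans st t1.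
  rewrite invr_ge0 ltW ?Phi_gt0//= lef_pV2 ?posrE ?Phi_gt0//.
  by rewrite Phi_mono// ltW.
have et0 : 0 < e * t by rewrite mulr_gt0.
have et1 : e * t <= 1 by rewrite mulr_ile1// ltW.
have p1 := Phi_gt0 Pp t0 t1; have p2 := Phi_gt0 Pp et0 et1.
rewrite -invfM lef_pV2 ?posrE//; last by rewrite mulr_gt0.
by rewrite mulrC; apply: Phi_scale => //; exact: ltW.
Qed.

(** By the ideal property, c times the indicator of the interval from 0 to t0 has a
    smaller norm than g. *)
Lemma ss_enorm_ge X phi (g : R -> \bar R) (c t0 : R) :
  fundamental_function X phi -> 0 <= c -> 0 < t0 -> t0 <= 1 ->
  (forall t, 0 < t -> t <= t0 -> (c%:E <= g t)%E) ->
  ((c * phi t0)%:E <= ss_enorm X g)%E.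
Proof.
move=> ff c0 t00 t01 cg; have it0 : t0 \in `[0, 1] by rewrite in_itv/= t01 ltW.
have [mt ->] := ff t0 it0.
apply: le_ereal_inf_tmp => _ [h [mh gh] <-]; rewrite lee_fin.
have := ss_normZ c mt; rewrite ger0_norm// => <-.
have mct := @ss_memZ R X c _ mt.
apply: (ss_ideal (ss_measurable mct) mh _).2.
have n0 : {ae mu, forall t : R, t != 0}.
  exists [set 0]; split; [exact: measurable_set1|exact: lebesgue_measure_set1|].
  by move=> t /negP; rewrite negbK => /eqP.
move: gh n0; apply: (@filterS2 _ _ (ae_filter_ringOfSetsType mu)) => t gt tn t01'.
rewrite /= indicE; have [|_] := boolP (t \in _); last by rewrite mulr0 normr0.
move=> /set_mem; rewrite /= in_itv/= => /andP[tt0 tt1]; rewrite mulr1 ger0_norm//.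
have : (c%:E <= (h t)%:E)%E.
  by rewrite -gt//; apply: cg => //; rewrite lt_neqAle eq_sym tn.
by rewrite lee_fin => /le_trans; apply; exact: ler_norm.
Qed.

Context {m : nat}.

(** Applies ss_enorm_ge to the successive norms, c being multiplied by phi_j(t_j) each
    time. *)
Lemma foldl_ss_enorm_ge (X : 'I_m -> symmetric_space R) (phi : 'I_m -> R -> R) (r : seq 'I_m)
    (F : m.-tuple R -> \bar R) (c : R) (t y : m.-tuple R) :
  (forall j, Phi_function (phi j) /\ fundamental_function (X j) (phi j)) ->
  (forall j, 0 < tnth t j <= 1) -> 0 <= c ->
  (forall z : m.-tuple R, (forall i, i \in r -> 0 < tnth z i <= tnth t i) ->
    (forall i, i \notin r -> tnth z i = tnth y i) -> (c%:E <= F z)%E) ->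
  ((c * \prod_(j <- r) phi j (tnth t j))%:E <=
    foldl (fun (G : m.-tuple R -> \bar R) j x => ss_enorm (X j) (fun s => G (upd x j s))) F r y)%E.
Proof.
move=> PX t01; elim: r F c => [|j r IH] F c c0 cF /=.
  by rewrite big_nil mulr1; apply: cF.
have [Pj fj] := PX j; have /andP[tj0 tj1] := t01 j.
rewrite big_cons mulrA; apply: IH => [|z zr zy].
  by rewrite mulr_ge0// ltW// Phi_gt0.
apply: ss_enorm_ge => // s s0 st; apply: cF => i.
  rewrite inE tnth_upd; case: eqP => [-> _|_ /= ir]; first by rewrite s0.
  exact: zr.
by rewrite inE tnth_upd negb_or; case: eqP => //= _ ir; exact: zy.
Qed.

Lemma X_norm_ge (X : 'I_m -> symmetric_space R) (phi : 'I_m -> R -> R)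
    (g : m.-tuple R -> R[i]) (c : R) (t : m.-tuple R) :
  (forall j, Phi_function (phi j) /\ fundamental_function (X j) (phi j)) ->
  (forall j, 0 < tnth t j <= 1) -> 0 <= c -> (c%:E <= iterated_rearrangement g t)%E ->
  ((c * \prod_j phi j (tnth t j))%:E <= X_norm X g)%E.
Proof.
move=> PX t01 c0 ct.
have -> : \prod_j phi j (tnth t j) = \prod_(j <- enum 'I_m) phi j (tnth t j).
  by rewrite big_enum.
apply: foldl_ss_enorm_ge => // z zt _; apply: le_trans ct _.
apply: foldl_rearr_anti => i; last by rewrite mem_enum.
by move=> ir; have /andP[] := zt i ir.
Qed.

Lemma X_norm_ge0 (X : 'I_m -> symmetric_space R) (phi : 'I_m -> R -> R) (g : m.-tuple R -> R[i]) :
  (forall j, Phi_function (phi j) /\ fundamental_function (X j) (phi j)) ->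
  (0 <= X_norm X g)%E.
Proof.
move=> PX; have := @X_norm_ge X phi g 0 [tuple 1 | _ < m] PX.
rewrite mul0r; apply => // [j|]; first by rewrite tnth_mktuple ltr01 lexx.
by apply: foldl_rearr_ge0 => x; rewrite lee_fin normc_nneg.
Qed.

Lemma X_norm_weak (X : 'I_m -> symmetric_space R) (phi : 'I_m -> R -> R)
    (g : m.-tuple R -> R[i]) (A : R) :
  (forall j, Phi_function (phi j) /\ fundamental_function (X j) (phi j)) ->
  (X_norm X g <= A%:E)%E -> weak_bound (fun j u => (phi j u)^-1) A g.
Proof.
move=> PX XA t t01; rewrite leNgt; apply/negP => lt.
have P0 : 0 < \prod_j phi j (tnth t j).
  by apply: prodr_gt0 => j _; have [? _] := PX j; have /andP[? ?] := t01 j; exact: Phi_gt0.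
have A0 : 0 <= A by rewrite -lee_fin; exact: le_trans (X_norm_ge0 g PX) XA.
move: lt; rewrite prodfV; set B := A * _ => lt.
have B0 : 0 <= B by rewrite mulr_ge0// invr_ge0 ltW.
have [c Bc cF] : exists2 c : R, B < c & (c%:E <= iterated_rearrangement g t)%E.
  move: lt; case: (iterated_rearrangement g t) => [r||]//.
    by rewrite lte_fin => Br; exists r.
  by move=> _; exists (B + 1); rewrite ?ltrDl ?ltr01// leey.
have := le_trans (X_norm_ge PX t01 (le_trans B0 (ltW Bc)) cF) XA.
rewrite lee_fin -ler_pdivlMr// leNgt; apply/negP; rewrite negbK.
exact: Bc.
Qed.

End fundamental_functions.

(** * Dyadic growth of fundamental functions *)

Section dyadic_growth.
Context {R : realType}.
Implicit Types (phi psi : R -> R).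

Lemma real_between (x y : \bar R) : (x < y)%E -> exists r : R, (x < r%:E)%E /\ (r%:E < y)%E.
Proof.
case: x => [a||]; case: y => [b||] //.
- by rewrite lte_fin => ab; exists ((a + b) / 2); rewrite !lte_fin midf_lt// midf_lt.
- by move=> _; exists (a + 1); rewrite lte_fin ltrDl ltr01 ltry.
- by move=> _; exists (b - 1); rewrite lte_fin gtrBl ltr01 ltNyr.
- by move=> _; exists 0; rewrite ltry ltNyr.
Qed.

Lemma at_right_interval (V : set R) : (0 : R)^'+ V -> exists2 e : R, 0 < e & forall t, 0 < t -> t < e -> V t.
Proof.
move=> /nbhs_ballP [e /= e0 eV]; exists e => // t t0 te; apply: eV => //.
by rewrite /ball/= sub0r normrN gtr0_norm.
Qed.

Lemma alpha_gt phi (a : R) : (a%:E < alpha phi)%E ->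
  exists2 e : R, 0 < e & forall t, 0 < t -> t < e -> a < phi (2 * t) / phi t.
Proof.
rewrite /alpha limf_einfE => /ereal_sup_gt [_ [V V0 <-] aV].
have [e e0 eV] := at_right_interval V0; exists e => // t t0 te.
rewrite -lte_fin; apply: lt_le_trans aV _; apply: ereal_inf_lbound.
by exists t => //; exact: eV.
Qed.

Lemma beta_lt phi (b : R) : (beta phi < b%:E)%E ->
  exists2 e : R, 0 < e & forall t, 0 < t -> t < e -> phi (2 * t) / phi t < b.
Proof.
rewrite /beta limf_esupE => /ereal_inf_lt [_ [V V0 <-] aV].
have [e e0 eV] := at_right_interval V0; exists e => // t t0 te.
rewrite -lte_fin; apply: le_lt_trans _ aV; apply: ereal_sup_ubound.
by exists t => //; exact: eV.
Qed.

Lemma dyadic_small (e : R) : 0 < e -> exists n0, forall n, (n0 <= n)%N -> 2 ^- n.+1 < e.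
Proof.
move=> e0; exists (Num.truncn e^-1) => n n0.
rewrite -[e]invrK ltf_pV2 ?posrE ?invr_gt0 ?exprn_gt0//.
apply: lt_le_trans (truncnS_gt _) _.
rewrite -natrX ler_nat (leq_trans _ (ltnW (ltn_expl _ _)))//.
Qed.

Lemma alpha_dyadic phi (a : R) : Phi_function phi -> (a%:E < alpha phi)%E ->
  exists n0, forall n, (n0 <= n)%N -> a * phi (2 ^- n.+1) <= phi (2 ^- n).
Proof.
move=> Pp /alpha_gt [e e0 H]; have [n0 Hn] := dyadic_small e0; exists n0 => n nn0.
have t0 : 0 < 2 ^- n.+1 :> R by rewrite invr_gt0 exprn_gt0.
have t1 : 2 ^- n.+1 <= 1 :> R by rewrite invf_le1 ?exprn_gt0// exprn_ege1// ler1n.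
have pt := Phi_gt0 Pp t0 t1.
have := H _ t0 (Hn _ nn0); rewrite ltr_pdivlMr//.
have -> : 2 * 2 ^- n.+1 = 2 ^- n :> R by rewrite exprS invfM mulrA mulfV// mul1r.
exact: ltW.
Qed.

Lemma beta_dyadic phi (b : R) : Phi_function phi -> (beta phi < b%:E)%E ->
  exists n0, forall n, (n0 <= n)%N -> phi (2 ^- n) <= b * phi (2 ^- n.+1).
Proof.
move=> Pp /beta_lt [e e0 H]; have [n0 Hn] := dyadic_small e0; exists n0 => n nn0.
have t0 : 0 < 2 ^- n.+1 :> R by rewrite invr_gt0 exprn_gt0.
have t1 : 2 ^- n.+1 <= 1 :> R by rewrite invf_le1 ?exprn_gt0// exprn_ege1// ler1n.
have pt := Phi_gt0 Pp t0 t1.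
have := H _ t0 (Hn _ nn0); rewrite ltr_pdivrMr//.
have -> : 2 * 2 ^- n.+1 = 2 ^- n :> R by rewrite exprS invfM mulrA mulfV// mul1r.
exact: ltW.
Qed.

(** The finitely many first terms only change the constant. *)
Lemma geometric_growth (u : nat -> R) (q : R) n0 : 0 < q -> (forall n, 0 < u n) ->
  (forall n, (n0 <= n)%N -> q * u n <= u n.+1) ->
  exists2 C : R, 0 < C & forall s k, u s * q ^+ k <= C * u (s + k)%N.
Proof.
move=> q0; elim: n0 u => [|n0 IH] u u0 H.
  exists 1 => // s; elim=> [|k IHk]; first by rewrite expr0 mulr1 mul1r addn0.
  rewrite exprS mulrCA addnS; apply: le_trans (ler_wpM2l (ltW q0) IHk) _.
  by rewrite !mul1r H.
have [||C C0 HC] := IH (fun n => u n.+1); [by move=> n|by move=> n nn0; exact: H|].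
pose D := 1 + C + u 0%N * q / u 1%N * C.
have D1 : 0 <= u 0%N * q / u 1%N * C by rewrite ltW// mulr_gt0// divr_gt0// mulr_gt0.
exists D => [|s k]; first by rewrite /D; lra.
have uk := u0 (s + k)%N.
case: s uk => [|s] uk; last first.
  apply: le_trans (HC s k) _; rewrite addSn in uk *; rewrite ler_wpM2r ?(ltW uk)// /D; lra.
case: k uk => [|k] uk.
  by rewrite expr0 mulr1 addn0 ler_peMl ?(ltW (u0 _))// /D; lra.
have := HC 0%N k; rewrite add0n => h.
have -> : u 0%N * q ^+ k.+1 = u 0%N * q / u 1%N * (u 1%N * q ^+ k).
  by rewrite exprS; field; rewrite gt_eqF.
apply: (@le_trans _ _ (u 0%N * q / u 1%N * (C * u k.+1))).
  by rewrite ler_wpM2l// ltW// divr_gt0// mulr_gt0.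
by rewrite mulrA ler_wpM2r ?(ltW (u0 _))// /D; lra.
Qed.

Lemma dyadic01 n : 0 < (2 ^- n : R) <= 1.
Proof. by rewrite invr_gt0 exprn_gt0//= invf_le1 ?exprn_gt0// exprn_ege1// ler1n. Qed.

Lemma Phi_dyadic_gt0 phi n : Phi_function phi -> 0 < phi (2 ^- n).
Proof. by move=> P; have /andP[a b] := dyadic01 n; exact: Phi_gt0. Qed.

Lemma Phi_dyadic_mono phi n : Phi_function phi -> phi (2 ^- n.+1) <= phi (2 ^- n).
Proof.
move=> P; have /andP[a _] := dyadic01 n.+1; have /andP[_ b] := dyadic01 n.
apply: (Phi_mono P (ltW a) _ b).
by rewrite lef_pV2 ?posrE ?exprn_gt0// exprS ler_peMl ?exprn_ge0// ler1n.
Qed.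

Definition weight phi psi n : R := psi (2 ^- n) / phi (2 ^- n).

(** The three bounds come from 1 < alpha_psi, beta_psi < alpha_phi and beta_phi < 2
    respectively. *)
Lemma dyadic_growth_rates phi psi : Phi_function phi -> Phi_function psi ->
  (1%:E < alpha psi)%E -> (beta psi < alpha phi)%E -> (beta phi < 2%:E)%E ->
  exists2 q : R, 1 < q & exists2 C : R, 0 < C & [/\
    forall s k, psi (2 ^- (s + k)) * q ^+ k <= C * psi (2 ^- s),
    forall s k, weight phi psi s * q ^+ k <= C * weight phi psi (s + k) &
    forall k, q ^+ k <= C * (2 ^+ k * phi (2 ^- k))].
Proof.
move=> Pp Ps a1 ba b2.
have p0 n := Phi_dyadic_gt0 n Pp; have r0 n := Phi_dyadic_gt0 n Ps.
have w0 n : 0 < weight phi psi n by rewrite divr_gt0.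
have [q1 [q11 /(alpha_dyadic Ps)[n1 H1]]] := real_between a1; rewrite lte_fin in q11.
have [b [/(beta_dyadic Ps)[n2 H2]]] := real_between ba.
move=> /real_between[a [ab /(alpha_dyadic Pp)[n3 H3]]]; rewrite lte_fin in ab.
have [c [/(beta_dyadic Pp)[n4 H4] c2]] := real_between b2; rewrite lte_fin in c2.
have b1 : 1 <= b.
  rewrite leNgt; apply/negP => b1; have := H2 n2 (leqnn _).
  have : psi (2 ^- n2.+1) <= psi (2 ^- n2).
    exact: Phi_dyadic_mono.
  have := r0 n2.+1; nra.
have c1 : 1 <= c.
  rewrite leNgt; apply/negP => c1; have := H4 n4 (leqnn _).
  have : phi (2 ^- n4.+1) <= phi (2 ^- n4).
    exact: Phi_dyadic_mono.
  have := p0 n4.+1; nra.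
have b0 : 0 < b by lra.
have c0 : 0 < c by lra.
pose q := Num.min q1 (Num.min (a / b) (2 / c)).
have q1' : 1 < q by rewrite !lt_min q11 !ltr_pdivlMr// !mul1r ab c2.
have q0 : 0 < q by lra.
have qq1 : q <= q1 by rewrite ge_min lexx.
have qab : q * b <= a by rewrite -ler_pdivlMr// !ge_min lexx orbT.
have qc : q * c <= 2 by rewrite -ler_pdivlMr// !ge_min lexx !orbT.
exists q => //.
have [|n nn|C1 C10 G1] := @geometric_growth (fun n => (psi (2 ^- n))^-1) q n1 q0.
- by move=> n; rewrite invr_gt0.
- have := H1 n nn; have := r0 n; have := r0 n.+1.
  move: (psi (2 ^- n)) (psi (2 ^- n.+1)) => x y y0 x0 xy.
  rewrite ler_pdivrMr// mulrC ler_pdivlMr//; apply: le_trans _ xy.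
  by rewrite ler_wpM2r// ltW.
have [n nn|C2 C20 G2] := @geometric_growth (weight phi psi) q (maxn n2 n3) q0 w0.
  have := H2 n (leq_trans (leq_maxl _ _) nn); have := H3 n (leq_trans (leq_maxr _ _) nn).
  rewrite /weight; have := r0 n; have := r0 n.+1; have := p0 n; have := p0 n.+1.
  move: (psi (2 ^- n)) (psi (2 ^- n.+1)) (phi (2 ^- n)) (phi (2 ^- n.+1)) => x y z t t0 z0 y0 x0 tz xy.
  rewrite mulrA ler_pdivrMr// mulrAC ler_pdivlMr//.
  apply: (@le_trans _ _ (q * (b * y) * t)); first by rewrite ler_wpM2r ?(ltW t0)// ler_wpM2l// ltW.
  rewrite mulrA -mulrA [y * t]mulrC mulrA mulrC ler_wpM2l ?(ltW y0)//.
  by apply: le_trans tz; rewrite ler_wpM2r// ltW.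
have [|n nn|C3 C30 G3] := @geometric_growth (fun n => 2 ^+ n * phi (2 ^- n)) q n4 q0.
- by move=> n; rewrite mulr_gt0// exprn_gt0.
- have := H4 n nn; have := p0 n; have := p0 n.+1.
  move: (phi (2 ^- n)) (phi (2 ^- n.+1)) => x y y0 x0 xy.
  rewrite mulrCA exprSr -mulrA ler_wpM2l ?exprn_ge0//.
  apply: (@le_trans _ _ (q * (c * y))); first by rewrite ler_wpM2l// ltW.
  by rewrite mulrA ler_wpM2r// ltW.
have p1 := p0 0%N.
pose D3 := C3 / phi (2 ^- 0); have D30 : 0 < D3 by rewrite divr_gt0.
exists (C1 + C2 + D3); first by rewrite !addr_gt0.
split=> [s k|s k|k].
- have := G1 s k; have := r0 s; have := r0 (s + k)%N.
  move: (psi (2 ^- s)) (psi (2 ^- (s + k))) => x y y0 x0.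
  rewrite mulrC ler_pdivrMr// mulrAC ler_pdivlMr// => h.
  by rewrite mulrC; apply: le_trans h _; rewrite ler_wpM2r ?(ltW x0)//; lra.
- by apply: le_trans (G2 s k) _; rewrite ler_wpM2r ?(ltW (w0 _))//; lra.
- have := G3 0%N k; rewrite expr0 mul1r add0n mulrC -ler_pdivlMr// => h.
  apply: le_trans h _; have : 0 < 2 ^+ k * phi (2 ^- k) by rewrite mulr_gt0// exprn_gt0.
  move: (2 ^+ k * _) => x x0; rewrite mulrAC -/D3 ler_wpM2r ?(ltW x0)//; lra.
Qed.

Definition gap (n s : nat) : nat := (n - s + (s - n))%N.

(** The first bound is needed with a large K, so as to have powers of rho to spare;
    the other two give the summability of the norms of the blocks and the
    integrability of functions with a weak type bound. *)
Definition kernel_bound phi psi K (C rho : R) : Prop :=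
  [/\ forall n s, psi (2 ^- n) * (phi (Num.max (2 ^- n) (2 ^- s)))^-1 <=
        C * weight phi psi s * rho ^+ (K * gap n s),
      forall s, (weight phi psi s)^-1 <= C * rho ^+ s &
      forall k, 2^-1 ^+ k * (phi (2^-1 ^+ k.+1))^-1 <= C * rho ^+ k].

(** For s <= n the maximum is 2^-s, and psi decreases geometrically between 2^-s and
    2^-n. For n < s the left-hand side is the weight at n, and the weights increase
    geometrically from n to s. *)
Lemma kernel_bounds phi psi : Phi_function phi -> Phi_function psi ->
  (1%:E < alpha psi)%E -> (beta psi < alpha phi)%E -> (beta phi < 2%:E)%E ->
  exists2 rho : R, 0 < rho < 1 & exists2 C : R, 0 < C & kernel_bound phi psi 1 C rho.
Proof.
move=> Pp Ps a1 ba b2.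
have [q q1 [C C0 [G1 G2 G3]]] := dyadic_growth_rates Pp Ps a1 ba b2.
have p0 n := Phi_dyadic_gt0 n Pp; have r0 n := Phi_dyadic_gt0 n Ps.
have w0 n : 0 < weight phi psi n by rewrite divr_gt0.
have q0 : 0 < q by lra.
have qn n : 0 < q ^+ n by rewrite exprn_gt0.
have maxE n s : Num.max (2 ^- n) (2 ^- s) = 2 ^- minn n s :> R.
  have mono a b : (a <= b)%N -> 2 ^- b <= 2 ^- a :> R.
    by move=> ab; rewrite lef_pV2 ?posrE ?exprn_gt0// ler_weXn2l// ler1n.
  by case: (leqP n s) => [/mono|/ltnW/mono] h; [rewrite max_l|rewrite max_r].
exists q^-1; first by rewrite invr_gt0 q0 invf_lt1.
have w00 := w0 0%N.
pose D := C / weight phi psi 0; have D0 : 0 < D by rewrite divr_gt0.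
exists (C + D + 2 * C); first by rewrite !addr_gt0// mulr_gt0.
split=> [n s|s|k].
- rewrite mul1n maxE exprVn.
  apply: (@le_trans _ _ (C * weight phi psi s / q ^+ gap n s)); last first.
    rewrite ler_wpM2r ?invr_ge0 ?(ltW (qn _))// ler_wpM2r ?(ltW (w0 _))//; lra.
  rewrite ler_pdivlMr//; rewrite /gap; case: (leqP n s) => ns.
    have -> : (n - s + (s - n) = s - n)%N by lia.
    by have := G2 n (s - n)%N; rewrite subnKC.
  have -> : (n - s + (s - n) = n - s)%N by lia.
  have := G1 s (n - s)%N; rewrite (subnKC (ltnW ns)) => h.
  rewrite /weight mulrAC mulrA ler_wpM2r ?invr_ge0 ?(ltW (p0 _))//.
- apply: (@le_trans _ _ (D * q^-1 ^+ s)); last first.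
    by rewrite ler_wpM2r ?exprn_ge0 ?invr_ge0 ?(ltW q0)//; lra.
  have := G2 0%N s; rewrite add0n; move: (w0 s); move: (weight phi psi s) => w ws h.
  rewrite exprVn -[leLHS]mul1r ler_pdivrMr// mulrAC ler_pdivlMr// mul1r.
  by rewrite /D mulrAC ler_pdivlMr// mulrC.
- apply: (@le_trans _ _ (2 * C * q^-1 ^+ k)); last first.
    by rewrite ler_wpM2r ?exprn_ge0 ?invr_ge0 ?(ltW q0)//; lra.
  have := G3 k.+1; rewrite !exprVn; move: (p0 k.+1); move: (phi _) => x x0 h.
  have tk : 0 < 2 ^+ k :> R by rewrite exprn_gt0.
  rewrite -invfM -[leLHS]mul1r ler_pdivrMr ?mulr_gt0// mulrAC ler_pdivlMr// mul1r.
  apply: (@le_trans _ _ (q ^+ k.+1)); first by rewrite exprS ler_peMl ?(ltW (qn _))// ltW.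
  by apply: le_trans h _; rewrite exprS le_eqVlt; apply/orP; left; apply/eqP; ring.
Qed.

End dyadic_growth.

(** * Sums over multi-indices *)

Section sums_over_multi_indices.
Context {R : realType}.
Local Open Scope ereal_scope.

Lemma esum_swap (I J : choiceType) (a : I -> J -> \bar R) : (forall i j, 0 <= a i j) ->
  \esum_(i in [set: I]) \esum_(j in [set: J]) a i j =
  \esum_(j in [set: J]) \esum_(i in [set: I]) a i j.
Proof.
move=> a0; rewrite !esum_esum//.
rewrite (@reindex_esum _ _ _ ([set: J] `*`` (fun=> [set: I])) _ (fun p => (p.2, p.1)))//.
by split=> [p _|p q _ _ [] + +|p _] //; [case: p q => ? ? [? ?] /= -> ->|exists (p.2, p.1) => //; case: p].
Qed.

Lemma esum_tuple_cons m (a : m.+1.-tuple nat -> \bar R) : (forall s, 0 <= a s) ->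
  \esum_(s in [set: m.+1.-tuple nat]) a s =
  \esum_(s in [set: m.-tuple nat]) \esum_(k in [set: nat]) a [tuple of k :: s].
Proof.
move=> a0; rewrite esum_esum//.
rewrite (@reindex_esum _ _ _ ([set: m.-tuple nat] `*`` (fun=> [set: nat])) _
  (fun p : m.-tuple nat * nat => [tuple of p.2 :: p.1]))//.
split=> [p _|p q _ _ E|s _] //.
  case: p q E => p k [q l] /= /(congr1 val) /= [-> E]; congr pair.
  exact: val_inj.
exists ([tuple of behead s], thead s) => //=.
by rewrite [RHS]tuple_eta.
Qed.

Lemma esumZr_le (I : choiceType) (c : I -> R) (C : R) (y : \bar R) :
  (forall i, (0 <= c i)%R) -> (0 < C)%R -> 0 <= y ->
  \esum_(i in [set: I]) (c i)%:E <= C%:E ->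
  \esum_(i in [set: I]) ((c i)%:E * y) <= C%:E * y.
Proof.
move=> c0 C0; case: y => [y||] // y0 H; last by rewrite gt0_muley ?lte_fin// leey.
rewrite lee_fin in y0; under eq_esum do rewrite muleC.
apply: le_trans (esumZl_le _ y0 _) _; first by move=> i; rewrite lee_fin.
by rewrite muleC lee_wpmul2r.
Qed.

Lemma sum_gap (rho : R) (n N : nat) : (0 < rho < 1)%R ->
  (\sum_(s < N) rho ^+ gap n s <= 2 / (1 - rho))%R.
Proof.
move=> /andP[r0 r1]; have s0 : (0 < 1 - rho)%R by lra.
rewrite ler_pdivlMr//.
have H1 : forall M, (M <= n)%N -> ((\sum_(s < M) rho ^+ gap n s) * (1 - rho) <= rho ^+ (n - M))%R.
  elim=> [_|M IH Mn]; first by rewrite big_ord0 mul0r exprn_ge0// ltW.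
  rewrite big_ord_recr/= mulrDl; have := IH (ltnW Mn).
  have -> : gap n M = (n - M)%N by rewrite /gap; lia.
  have -> : (n - M = (n - M.+1).+1)%N by lia.
  rewrite exprS; have : (0 <= rho ^+ (n - M.+1))%R by rewrite exprn_ge0// ltW.
  set x := (rho ^+ (n - M.+1))%R; set y := (\sum_(_ < _) _)%R => x0 h.
  have := mulr_ge0 (sqr_ge0 (1 - rho)%R) x0; move: h; rewrite -!/x; clear; nra.
have H2 : forall k, ((\sum_(s < n + k) rho ^+ gap n s) * (1 - rho) <= 2 - rho ^+ k)%R.
  elim=> [|k IH].
    by rewrite addn0 expr0; have := H1 n (leqnn n); rewrite subnn expr0; lra.
  rewrite addnS big_ord_recr/= mulrDl.
  have -> : gap n (n + k) = k by rewrite /gap; lia.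
  by move: IH; rewrite exprS; set x := (rho ^+ k)%R; set y := (\sum_(_ < _) _)%R; clear; lra.
have [Nn|nN] := leqP N n.
  apply: le_trans (H1 N Nn) _; apply: (@le_trans _ _ 1%R); last lra.
  by rewrite exprn_ile1 ?ltW.
have := H2 (N - n)%N; rewrite subnKC ?(ltnW nN)// => h.
have : (0 <= rho ^+ (N - n))%R by rewrite exprn_ge0// ltW.
lra.
Qed.

Lemma gap_sym n s : gap n s = gap s n. Proof. by rewrite /gap addnC. Qed.

Lemma esum_gap (rho : R) n : (0 < rho < 1)%R ->
  \esum_(s in [set: nat]) (rho ^+ gap n s)%:E <= (2 / (1 - rho))%:E.
Proof.
move=> r01; have r0 : (0 <= rho)%R by case/andP: r01 => /ltW.
rewrite -nneseries_esumT; last by move=> s; rewrite lee_fin exprn_ge0.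
apply: nneseries_ub => [s|N]; first by rewrite lee_fin exprn_ge0.
by rewrite big_mkord sumEFin lee_fin; exact: sum_gap.
Qed.

Lemma esum_gap_tuple (rho : R) m (n : m.-tuple nat) : (0 < rho < 1)%R ->
  \esum_(s in [set: m.-tuple nat]) (\prod_(j < m) rho ^+ gap (tnth n j) (tnth s j))%:E <=
    ((2 / (1 - rho)) ^+ m)%:E.
Proof.
move=> r01; have r0 : (0 <= rho)%R by case/andP: r01 => /ltW.
have p0 k (u v : k.-tuple nat) : (0 <= \prod_(j < k) rho ^+ gap (tnth u j) (tnth v j))%R.
  by apply: prodr_ge0 => j _; rewrite exprn_ge0.
have C0 : (0 < 2 / (1 - rho))%R by apply: divr_gt0 => //; case/andP: r01; lra.
elim: m n => [|m IH] n.
  rewrite expr0 (_ : [set: 0.-tuple nat] = [set [tuple]]).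
    by rewrite esum_set1 ?big_ord0// lee_fin.
  by apply/seteqP; split=> s // _; rewrite /= tuple0.
rewrite esum_tuple_cons; last by move=> s; rewrite lee_fin.
case/tupleP: n => n0 n.
apply: (@le_trans _ _ (\esum_(s in [set: m.-tuple nat]) ((2 / (1 - rho))%:E *
    (\prod_(j < m) rho ^+ gap (tnth n j) (tnth s j))%:E))).
  apply: le_esum => s _.
  rewrite (eq_esum (b := fun k => (rho ^+ gap n0 k)%:E *
      (\prod_(j < m) rho ^+ gap (tnth n j) (tnth s j))%:E)); last first.
    move=> k _; rewrite big_ord_recl/= -EFinM; congr (_%:E); congr (_ * _)%R.
    by apply: eq_bigr => j _; rewrite !tnthS.
  apply: esumZr_le => //; first by move=> k; rewrite exprn_ge0.
    by rewrite lee_fin.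
  exact: esum_gap.
apply: le_trans (esumZl_le _ (ltW C0) _) _; first by move=> s; rewrite lee_fin.
rewrite exprS [leRHS]EFinM; apply: lee_wpmul2l; last exact: IH.
by rewrite lee_fin ltW.
Qed.

End sums_over_multi_indices.

(** * Discretisation of the Lorentz functional *)

Section lorentz.
Context {R : realType}.
Local Notation mu := (@lebesgue_measure R).
Local Open Scope ereal_scope.

Lemma poweR_mono (r : R) (x y : \bar R) : (0 <= r)%R -> 0 <= x -> x <= y -> x `^ r <= y `^ r.
Proof.
move=> r0 x0 xy; apply: gt0_ler_poweR => //; rewrite in_itv/= ?leey ?andbT//.
exact: le_trans xy.
Qed.

Lemma poweRK (r : R) (x : \bar R) : (1 <= r)%R -> 0 <= x -> (x `^ r) `^ r^-1 = x.
Proof.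
by move=> r1 x0; rewrite -poweRrM mulfV ?poweRe1// gt_eqF// (lt_le_trans ltr01).
Qed.

Lemma poweRVK (r : R) (x : \bar R) : (1 <= r)%R -> 0 <= x -> (x `^ r^-1) `^ r = x.
Proof.
by move=> r1 x0; rewrite -poweRrM mulVf ?poweRe1// gt_eqF// (lt_le_trans ltr01).
Qed.

Definition shell n : set R := [set t | (2 ^- n.+1 < t <= 2 ^- n)%R].

Lemma shell_itv n : shell n = `]2 ^- n.+1, 2 ^- n]%classic.
Proof. by apply/seteqP; split => t; rewrite /= in_itv. Qed.

Lemma shell_measure n : mu (shell n) = (2 ^- n.+1)%:E.
Proof.
rewrite shell_itv lebesgue_measure_itv/= lte_fin.
have -> : (2 ^- n = 2 * 2 ^- n.+1 :> R)%R by rewrite exprS invfM mulrA mulfV// mul1r.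
have t0 : (0 < 2 ^- n.+1 :> R)%R by rewrite invr_gt0 exprn_gt0.
rewrite ifT; last by move: t0; move: (2 ^- n.+1)%R => x; lra.
by rewrite -EFinB; congr _%:E; ring.
Qed.

Lemma shell01 n t : shell n t -> (0 < t <= 1)%R.
Proof.
move=> /andP[a b]; have /andP[t0 _] := @dyadic01 R n.+1; have /andP[_ t1] := @dyadic01 R n.
by rewrite (lt_trans t0 a) (le_trans b).
Qed.

Lemma shellP (t : R) : (0 < t)%R -> (t <= 1)%R -> exists n, shell n t.
Proof.
move=> t0 t1; have [n0 H] := dyadic_small t0.
have ex : exists n, (2 ^- n.+1 < t)%R by exists n0; exact: H.
case: (ex_minnP ex) => -[|n] nt nmin.
  by exists 0%N; rewrite /shell/= nt expr0 invr1.
exists n.+1; rewrite /shell/= nt leNgt /=; apply/negP => /nmin.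
by rewrite ltnn.
Qed.

(** The Lorentz integral is split over the shells, on which psi t <= psi (2^-n) and
    the measure 2^-(n+1) balances 1 / t <= 2^(n+1). *)
Lemma lorentz_shell psi (tau : R) (g : R -> \bar R) (b : nat -> \bar R) :
  Phi_function psi -> (1 <= tau)%R -> (forall t, 0 <= g t) ->
  (forall n t, shell n t -> (psi (2 ^- n))%:E * g t <= b n) ->
  lorentz_functional psi tau g <= l_functional tau b.
Proof.
move=> Ps tau1 g0 gb.
have tau0 : (0 <= tau)%R by rewrite (le_trans ler01).
have b0 n : 0 <= b n.
  have st : shell n (2 ^- n : R).
    rewrite /shell/= lexx andbT ltf_pV2 ?posrE ?exprn_gt0// exprS ltr_pMl ?exprn_gt0// ltr1n//.
  apply: le_trans (gb n _ st); apply: mule_ge0 => //.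
  by rewrite lee_fin ltW// Phi_dyadic_gt0.
pose c n := (b n `^ tau * (2 ^+ n.+1)%:E).
have c0 n : 0 <= c n by apply: mule_ge0; rewrite ?poweR_ge0// lee_fin exprn_ge0.
pose h n := (cst (c n)) \_ (shell n).
have h0 n t : 0 <= h n t by rewrite /h patchE; case: (t \in shell n) => /=; [exact: c0|exact: lexx].
have i0 t : (0 <= t)%R -> 0 <= (psi t `^ tau)%:E * g t `^ tau * (t^-1)%:E.
  move=> t0; apply: mule_ge0; last by rewrite lee_fin invr_ge0.
  by apply: mule_ge0; rewrite ?poweR_ge0// lee_fin powR_ge0.
rewrite /lorentz_functional /l_functional; apply: poweR_mono.
- by rewrite invr_ge0.
- by apply: integral_ge0 => t; rewrite /= in_itv/= => /andP[t0 _]; exact: i0.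
apply: (@le_trans _ _ (\int[mu]_(t in `[0%R, 1%R]) \sum_(0 <= n <oo) h n t)).
  apply: ge0_le_integral_nm => [t|t]; rewrite /= in_itv/= => /andP[t0 t1]; first exact: i0.
  (* At t = 0 the integrand is 0, because 0^-1 = 0. *)
  have [->|tn0] := eqVneq t 0%R.
    by rewrite invr0 mule0; apply: nneseries_ge0 => n _ _.
  have {}t0 : (0 < t)%R by rewrite lt_neqAle eq_sym tn0.
  have [n sn] := shellP t0 t1.
  apply: le_trans (nneseries_term n (fun k => h0 k t)).
  rewrite /h patchE mem_set// /cst /c.
  have /andP[a1 a2] := sn.
  have /andP[d0 d1] := @dyadic01 R n.+1.
  apply: lee_pmul.
  - by apply: mule_ge0; rewrite ?poweR_ge0// lee_fin powR_ge0.
  - by rewrite lee_fin invr_ge0 ltW.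
  - rewrite -poweR_EFin -poweRM//; last by rewrite lee_fin ltW// Phi_gt0.
    apply: poweR_mono => //; first by apply: mule_ge0 => //; rewrite lee_fin ltW// Phi_gt0.
    apply: le_trans (gb n t sn); apply: lee_wpmul2r => //; rewrite lee_fin.
    by apply: Phi_mono => //; [exact: ltW|have /andP[] := @dyadic01 R n].
  - by rewrite lee_fin -[leRHS]invrK lef_pV2 ?posrE ?invr_gt0 ?exprn_gt0// ltW.
have sm n : measurable (shell n) by rewrite shell_itv; exact: measurable_itv.
rewrite integral_nneseries//; last first.
  move=> n; apply: measurable_funTS; rewrite /h.
  apply: (measurable_restrictT (cst (c n)) (sm n)).1; exact: measurable_cst.
apply: lee_nneseries => [n _ _|n _].
  by apply: integral_ge0.
rewrite /h -integral_mkcondr integral_cst; last by apply: (@measurableI _ (measurableTypeR R)); [exact: measurable_itv|exact: sm].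
have -> : `[0%R, 1%R]%classic `&` shell n = shell n.
  apply/seteqP; split => [t []//|t st]; split => //; rewrite /= in_itv/=.
  by have /andP[/ltW -> ->] := shell01 st.
rewrite (_ : _ (shell n) = (2 ^- n.+1)%:E); last exact: shell_measure.
rewrite /c -muleA -EFinM mulfV ?gt_eqF ?exprn_gt0// mule1 gee0_abs//.
Qed.

Lemma l_functional_ge0 tau (a : nat -> \bar R) : 0 <= l_functional tau a.
Proof. exact: poweR_ge0. Qed.

Lemma l_functionalE tau (a : nat -> \bar R) : (1 <= tau)%R -> (forall k, 0 <= a k) ->
  l_functional tau a `^ tau = \esum_(k in [set: nat]) a k `^ tau.
Proof.
move=> t1 a0; rewrite /l_functional poweRVK//.
  rewrite nneseries_esumT; last by move=> k; exact: poweR_ge0.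
  by apply: eq_esum => k _; rewrite gee0_abs.
by apply: nneseries_ge0 => k _ _; exact: poweR_ge0.
Qed.

Lemma esum_term (T : choiceType) (a : T -> \bar R) i : (forall j, 0 <= a j) ->
  a i <= \esum_(j in [set: T]) a j.
Proof.
move=> a0; apply: (@le_trans _ _ (\esum_(j in [set i]) a j)).
  by rewrite esum_set1.
rewrite esum_mkcond; apply: le_esum => j _; by case: ifP.
Qed.

(** The tau-th power of the supremum is at most the sum of the tau-th powers. This sum
    is taken first over n, where rho makes it converge, then over k, where it gives an
    l_tau functional, and last over i, where one factor e i makes it converge while
    the other is left in the supremum. *)
Lemma lorentz_step psi (tau rho : R) (I : choiceType) (i0 : I) (e : I -> R) (E A : R)
    (a : nat -> I -> \bar R) (g : R -> \bar R) :
  Phi_function psi -> (1 <= tau)%R -> (0 < rho < 1)%R ->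
  (forall i, 0 < e i <= 1)%R -> (0 < E)%R -> (0 <= A)%R ->
  \esum_(i in [set: I]) (e i)%:E <= E%:E ->
  (forall k i, 0 <= a k i) -> (forall t, 0 <= g t) ->
  (forall n t, shell n t -> (psi (2 ^- n))%:E * g t <=
    A%:E * ereal_sup [set (rho ^+ gap n p.1 * e p.2 ^+ 2)%:E * a p.1 p.2 |
      p in [set: nat * I]]) ->
  lorentz_functional psi tau g <= (A * (1 + 2 / (1 - rho) * E))%:E *
    ereal_sup [set (e i)%:E * l_functional tau (a^~ i) | i in [set: I]].
Proof.
move=> Ps t1 r01 e01 E0 A0 eE a0 g0 gA.
have tau0 : (0 <= tau)%R by rewrite (le_trans ler01).
have r0 : (0 < rho)%R by case/andP: r01.
have r1 : (rho < 1)%R by case/andP: r01.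
have e0 i : (0 < e i)%R by case/andP: (e01 i).
have e1 i : (e i <= 1)%R by case/andP: (e01 i).
set C := (2 / (1 - rho))%R; have C0 : (0 < C)%R by rewrite divr_gt0//; lra.
have CE0 : (0 < C * E)%R by rewrite mulr_gt0.
set S := ereal_sup [set (e i)%:E * _ | i in _].
have S0 : 0 <= S.
  apply: le_trans (ereal_sup_ubound _); last by exists i0.
  by apply: mule_ge0; [rewrite lee_fin ltW|exact: l_functional_ge0].
(* As tau >= 1, rho ^+ gap n k and e i dominate their tau-th powers. *)
pose Y k i := (e i)%:E * ((e i)%:E `^ tau * a k i `^ tau).
have Y0 k i : 0 <= Y k i.
  by apply: mule_ge0; [rewrite lee_fin ltW|apply: mule_ge0; exact: poweR_ge0].
pose T n := \esum_(i in [set: I]) \esum_(k in [set: nat]) ((rho ^+ gap n k)%:E * Y k i).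
have gt0 n k i : 0 <= (rho ^+ gap n k)%:E * Y k i.
  by apply: mule_ge0 => //; rewrite lee_fin exprn_ge0// ltW.
have T0 n : 0 <= T n by apply: esum_ge0 => i _; apply: esum_ge0.
have termT n k i : ((rho ^+ gap n k * e i ^+ 2)%:E * a k i) `^ tau <= T n.
  have r2 : (0 <= rho ^+ gap n k)%R by rewrite exprn_ge0// ltW.
  have r3 : (rho ^+ gap n k <= 1)%R by rewrite exprn_ile1// ltW.
  have pw (x : R) : (0 <= x)%R -> (x <= 1)%R -> (x `^ tau <= x)%R.
    move=> x0 x1; have [->|xn] := eqVneq x 0%R.
      by rewrite powR0// gt_eqF// (lt_le_trans ltr01).
    rewrite -[leRHS]powRr1//; apply: ger_powR => //.
    by rewrite lt_neqAle eq_sym xn x0.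
  apply: (@le_trans _ _ ((rho ^+ gap n k)%:E * Y k i)).
    rewrite poweRM//; last by rewrite lee_fin mulr_ge0// exprn_ge0// ltW.
    rewrite poweR_EFin powRM//; last by rewrite exprn_ge0// ltW.
    rewrite expr2 powRM ?(ltW (e0 i))//.
    rewrite /Y !muleA poweR_EFin -!EFinM; apply: lee_wpmul2r; first exact: poweR_ge0.
    rewrite lee_fin mulrA ler_wpM2r ?powR_ge0//.
    by apply: ler_pM; rewrite ?powR_ge0// pw// ltW.
  apply: le_trans (esum_term i (fun i' => esum_ge0 (fun k' _ => gt0 n k' i'))).
  exact: (esum_term k (fun k' => gt0 n k' i)).
have [b bE] : exists b : nat -> \bar R, b = fun n => ereal_sup
  [set (rho ^+ gap n p.1 * e p.2 ^+ 2)%:E * a p.1 p.2 | p in [set: nat * I]] by eexists.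
have b0 n : 0 <= b n.
  rewrite bE; apply: le_trans (ereal_sup_ubound _); last by exists (0%N, i0).
  by apply: mule_ge0; rewrite //= lee_fin mulr_ge0// exprn_ge0// ltW.
have bT n : b n `^ tau <= T n.
  rewrite -[leRHS](poweRVK t1)//; apply: poweR_mono => //.
  rewrite bE; apply: ge_ereal_sup => _ [[k i] _ <-] /=.
  have x0 : 0 <= (rho ^+ gap n k * e i ^+ 2)%:E * a k i.
    by apply: mule_ge0; rewrite //= lee_fin mulr_ge0// exprn_ge0// ltW.
  rewrite -(poweRK t1 x0); apply: poweR_mono; [by rewrite invr_ge0|exact: poweR_ge0|].
  exact: termT.
have sumT : \esum_(n in [set: nat]) T n <= (E * C)%:E * S `^ tau.
  rewrite /T esum_swap; last by move=> n i; apply: esum_ge0.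
  rewrite EFinM -muleA.
  have CS0 : 0 <= C%:E * S `^ tau by apply: mule_ge0; rewrite ?poweR_ge0// lee_fin ltW.
  have ele0 i : (0 <= e i)%R by rewrite ltW.
  apply: le_trans (esumZr_le ele0 E0 CS0 eE); apply: le_esum => i _.
  rewrite esum_swap//.
  apply: (@le_trans _ _ (\esum_(k in [set: nat]) (C%:E * Y k i))).
    apply: le_esum => k _; apply: esumZr_le => //.
      by move=> n; rewrite exprn_ge0// ltW.
    by under eq_esum do rewrite gap_sym; exact: esum_gap.
  apply: le_trans (esumZl_le _ (ltW C0) _) _; first by move=> k.
  rewrite muleCA; apply: lee_wpmul2l; first by rewrite lee_fin ltW.
  apply: le_trans (esumZl_le _ (ele0 i) _) _.
    by move=> k; apply: mule_ge0; exact: poweR_ge0.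
  apply: lee_wpmul2l; first by rewrite lee_fin.
  rewrite poweR_EFin; apply: le_trans (esumZl_le _ (powR_ge0 _ _) _) _.
    by move=> k; exact: poweR_ge0.
  rewrite -l_functionalE// -poweR_EFin -poweRM ?lee_fin//; last exact: l_functional_ge0.
  apply: poweR_mono => //; first by apply: mule_ge0; rewrite ?lee_fin//; exact: l_functional_ge0.
  by apply: ereal_sup_ubound; exists i.
apply: (le_trans (@lorentz_shell psi tau g (fun n => A%:E * b n) Ps t1 g0 _)).
  by move=> n t st; rewrite bE; exact: gA.
have AbE n : (A%:E * b n) `^ tau = (A `^ tau)%:E * b n `^ tau.
  by rewrite poweRM// poweR_EFin.
have Ab0 n : 0 <= A%:E * b n by apply: mule_ge0.
have D1 : (1 <= 1 + C * E)%R by rewrite lerDl ltW.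
have RHS0 : 0 <= (A * (1 + C * E))%:E * S.
  by apply: mule_ge0; rewrite // lee_fin mulr_ge0// (le_trans ler01).
rewrite -(poweRK t1 (l_functional_ge0 _ _)) -(poweRK t1 RHS0).
apply: poweR_mono; [by rewrite invr_ge0|exact: poweR_ge0|].
rewrite l_functionalE// poweRM//; last by rewrite lee_fin mulr_ge0// (le_trans ler01).
rewrite poweR_EFin powRM//; last by rewrite (le_trans ler01).
under eq_esum do rewrite AbE.
apply: le_trans (esumZl_le _ (powR_ge0 _ _) _) _; first by move=> n; exact: poweR_ge0.
rewrite EFinM -muleA; apply: lee_wpmul2l; first by rewrite lee_fin powR_ge0.
apply: le_trans (le_esum (fun n _ => bT n)) _.
apply: le_trans sumT _; apply: lee_wpmul2r; first exact: poweR_ge0.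
rewrite lee_fin mulrC; apply: (@le_trans _ _ (1 + C * E)%R); first by rewrite lerDr.
rewrite -[leLHS]powRr1; last by rewrite (le_trans ler01).
by apply: ler_powR.
Qed.

Lemma lorentz_functional_ge0 psi tau (g : R -> \bar R) : 0 <= lorentz_functional psi tau g.
Proof. exact: poweR_ge0. Qed.

(** Induction on the number of variables, the innermost one being eliminated by
    lorentz_step. Each elimination halves the exponent of the geometric factors of the
    remaining variables, whence the power of 2. *)
Lemma lorentz_iterate m (psi : 'I_m -> R -> R) (tau : 'I_m -> R) (rho : R) :
  (forall j, Phi_function (psi j)) -> (forall j, 1 <= tau j)%R -> (0 < rho < 1)%R ->
  exists2 K : R, (0 < K)%R & forall (A : R) (F : m.-tuple R -> \bar R) (a : m.-tuple nat -> \bar R) x0 s0,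
    (0 <= A)%R -> (forall t, 0 <= F t) -> (forall s, 0 <= a s) ->
    (forall (n : m.-tuple nat) (t : m.-tuple R), (forall j, shell (tnth n j) (tnth t j)) ->
      (\prod_j psi j (2 ^- tnth n j))%:E * F t <= A%:E *
      ereal_sup [set (\prod_j rho ^+ (2 ^ m * gap (tnth n j) (tnth s j)))%:E * a s | s in [set: m.-tuple nat]]) ->
    iterate (fun j => lorentz_functional (psi j) (tau j)) x0 F <=
      (A * K)%:E * iterate (fun j => l_functional (tau j)) s0 a.
Proof.
move=> + + r01; elim: m psi tau => [|m IH] psi tau Ppsi tau1.
  exists 1%R => // A F a x0 s0 A0 F0 a0 H.
  have := H [tuple] x0 (fun j : 'I_0 => match j with Ordinal k Hk => ltac:(by []) end).
  rewrite big_ord0 mul1e /iterate enum_ord0 /= mulr1 => h; apply: le_trans h _.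
  apply: lee_wpmul2l; first by rewrite lee_fin.
  apply: ge_ereal_sup => _ [s _ <-]; rewrite big_ord0 mul1e.
  by rewrite (tuple0 s) (tuple0 s0).
have [K K0 HK] := IH (fun j => psi (lift ord0 j)) (fun j => tau (lift ord0 j))
  (fun j => Ppsi _) (fun j => tau1 _).
have r0 : (0 < rho)%R by case/andP: r01.
have r1 : (rho < 1)%R by case/andP: r01.
pose rm := (rho ^+ (2 ^ m))%R; pose rm1 := (rho ^+ (2 ^ m.+1))%R.
have rn n : (0 < rho ^+ (2 ^ n) < 1)%R.
  by rewrite exprn_gt0//= exprn_ilt1 ?ltW// -lt0n expn_gt0.
have [rm01 rm101] : (0 < rm < 1)%R /\ (0 < rm1 < 1)%R by split; exact: rn.
pose E := ((2 / (1 - rm)) ^+ m)%R.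
have E0 : (0 < E)%R.
  by rewrite exprn_gt0// divr_gt0//; case/andP: rm01 => _; rewrite subr_gt0.
pose D := (1 + 2 / (1 - rm1) * E)%R.
have D0 : (0 < D)%R.
  by rewrite ltr_pwDl// mulr_ge0 ?(ltW E0)// divr_ge0//; case/andP: rm101 => _ /ltW; rewrite subr_ge0.
exists (D * K)%R; first by rewrite mulr_gt0.
move=> A F a x0 s0 A0 F0 a0 H.
case/tupleP: x0 => t0 x0; case/tupleP: s0 => k0 s0.
rewrite !iterate_cons.
pose G (y : m.-tuple R) := lorentz_functional (psi ord0) (tau ord0) (fun t => F [tuple of t :: y]).
pose a' (s : m.-tuple nat) := l_functional (tau ord0) (fun k => a [tuple of k :: s]).
rewrite mulrA; apply: (HK (A * D)%R G a').
- by rewrite mulr_ge0// ltW.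
- by move=> y; exact: lorentz_functional_ge0.
- by move=> s; exact: l_functional_ge0.
move=> n y ny.
pose P := (\prod_(j < m) psi (lift ord0 j) (2 ^- tnth n j))%R.
have P0 : (0 < P)%R by apply: prodr_gt0 => j _; exact: Phi_dyadic_gt0.
pose e (s : m.-tuple nat) := (\prod_(j < m) rho ^+ (2 ^ m * gap (tnth n j) (tnth s j)))%R.
have eE s : e s = (\prod_(j < m) rm ^+ gap (tnth n j) (tnth s j))%R.
  by apply: eq_bigr => j _; rewrite exprM.
have e01 s : (0 < e s <= 1)%R.
  rewrite prodr_gt0 => [|j _]; last by rewrite exprn_gt0.
  by rewrite prodr_ile1// => j _; rewrite exprn_ge0 ?exprn_ile1 ?ltW.
rewrite -/P.
suff : G y <= (A / P * D)%:E * ereal_sup [set (e i)%:E * a' i | i in [set: m.-tuple nat]].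
  move=> h; apply: (@le_trans _ _ (P%:E * ((A / P * D)%:E *
      ereal_sup [set (e i)%:E * a' i | i in [set: m.-tuple nat]]))).
    by apply: lee_wpmul2l => //; rewrite lee_fin ltW.
  rewrite muleA -EFinM (_ : (P * (A / P * D))%R = (A * D)%R)//.
  by field; rewrite gt_eqF.
apply: (@lorentz_step (psi ord0) (tau ord0) rm1 (m.-tuple nat) s0 e E (A / P)%R
  (fun k s => a [tuple of k :: s])) => //.
- by rewrite divr_ge0// ltW.
- under eq_esum do rewrite eE; exact: esum_gap_tuple.
move=> k t st.
have := H [tuple of k :: n] [tuple of t :: y].
have sh j : shell (tnth [tuple of k :: n] j) (tnth [tuple of t :: y] j).
  by have [i ->|->] := unliftP ord0 j; rewrite ?tnthS.
move=> /(_ sh); rewrite big_ord_recl.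
have -> : (\prod_(i < m) psi (lift ord0 i) (2 ^- tnth [tuple of k :: n] (lift ord0 i)) = P)%R.
  by apply: eq_bigr => i _; rewrite tnthS.
rewrite (_ : tnth [tuple of k :: n] ord0 = k)// => h.
have P1 : (0 <= P^-1)%R by rewrite invr_ge0 ltW.
move: h; rewrite mulrC EFinM -muleA => /(lee_wpmul2l (x := (P^-1)%:E)).
rewrite lee_fin => /(_ P1); rewrite !muleA -!EFinM mulVf ?gt_eqF// mul1r => h.
apply: le_trans h _; rewrite [(P^-1 * A)%R]mulrC; apply: lee_wpmul2l.
  by rewrite lee_fin divr_ge0// ltW.
apply: ge_ereal_sup => _ [s _ <-]; case/tupleP: s => l s.
apply: ereal_sup_ubound; exists (l, s) => //=; congr (_%:E * _).
rewrite big_ord_recl/= exprM; congr (_ * _)%R.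
rewrite /e -prodrXl; apply: eq_bigr => i _.
by rewrite !tnthS -exprM expnS [(_ * 2)%N]mulnC mulnA.
Qed.

End lorentz.

(** * Combination of the estimates *)

Section combination.
Context {R : realType} {m : nat}.
Local Notation normc := Normc.normc.

Lemma esum_le_sup (I : choiceType) (i0 : I) (c : I -> R) (a : I -> \bar R) :
  (forall i, 0 < c i) -> (\esum_(i in [set: I]) (c i)%:E <= 1)%E ->
  (forall i, 0 <= a i)%E ->
  (\esum_(i in [set: I]) a i <= ereal_sup [set ((c i)^-1)%:E * a i | i in [set: I]])%E.
Proof.
move=> c0 c1 a0; set S := ereal_sup _.
have SE i : (((c i)^-1)%:E * a i <= S)%E by apply: ereal_sup_ubound; exists i.
have S0 : (0 <= S)%E.
  by apply: le_trans (SE i0); apply: mule_ge0; rewrite // lee_fin invr_ge0 ltW.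
rewrite -[S]mul1e; apply: le_trans (esumZr_le _ ltr01 S0 c1); last by move=> i; exact: ltW.
apply: le_esum => i _; apply: (@le_trans _ _ ((c i)%:E * (((c i)^-1)%:E * a i))%E).
  by rewrite muleA -EFinM mulfV ?gt_eqF// mul1e.
by apply: lee_wpmul2l => //; rewrite lee_fin ltW.
Qed.

Lemma l_iterate_ge (tau : 'I_m -> R) (a : m.-tuple nat -> \bar R) s0 s :
  (forall j, 1 <= tau j) -> (forall s, 0 <= a s)%E ->
  (a s <= iterate (fun j => l_functional (tau j)) s0 a)%E.
Proof.
elim: m tau a s0 s => [|k IH] tau a s0 s t1 a0.
  by rewrite /iterate enum_ord0/= (tuple0 s) (tuple0 s0).
case/tupleP: s0 => l0 s0; case/tupleP: s => l s; rewrite iterate_cons.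
apply: le_trans (IH _ (fun s => l_functional (tau ord0) (fun i => a [tuple of i :: s])) s0 s
  (fun j => t1 _) (fun s => l_functional_ge0 _ _)).
rewrite -[leLHS](poweRK (t1 ord0))//.
have tp : 0 <= tau ord0 by rewrite (le_trans ler01).
rewrite -[leRHS](poweRK (t1 ord0)) ?l_functional_ge0//.
apply: poweR_mono; [by rewrite invr_ge0|exact: poweR_ge0|].
rewrite l_functionalE//.
exact: (esum_term l (fun j => poweR_ge0 _ _)).
Qed.

(** Among finitely many kernel bounds one takes the largest rates; and th <= rho ^+ K
    for rho close enough to 1, by the Bernoulli inequality. *)
Lemma common_kernel_bounds (phi psi : 'I_m -> R -> R) (K : nat) : (0 < K)%N ->
  (forall j, Phi_function (phi j)) -> (forall j, Phi_function (psi j)) ->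
  (forall j, (1%:E < alpha (psi j))%E) -> (forall j, (beta (psi j) < alpha (phi j))%E) ->
  (forall j, (beta (phi j) < 2%:E)%E) ->
  exists2 rho : R, 0 < rho < 1 & exists2 C : R, 0 < C & forall j, kernel_bound (phi j) (psi j) K C rho.
Proof.
move=> K0 Pp Ps a1 ba b2.
have ex j : exists p : R * R, (0 < p.1 < 1) /\ (0 < p.2) /\ kernel_bound (phi j) (psi j) 1 p.2 p.1.
  have [rho r01 [C C0 H]] := kernel_bounds (Pp j) (Ps j) (a1 j) (ba j) (b2 j).
  by exists (rho, C).
have [p pP] := fin_all_exists ex.
pose th := \big[Num.max/2^-1]_j (p j).1.
have th1 : th < 1 by apply: bigmax_lt => [|j _]; [lra|have [/andP[]] := pP j].
have th0 : 0 < th by apply: (@lt_le_trans _ _ 2^-1); [lra|exact: bigmax_ge_id].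
have pth j : (p j).1 <= th by exact: le_bigmax.
pose C := 1 + \sum_j (p j).2.
have pC j : (p j).2 <= C.
  rewrite /C (bigD1 j)//= addrCA lerDl addr_ge0// sumr_ge0// => i _.
  by have [_ [/ltW]] := pP i.
have C0 : 0 < C by rewrite ltr_pwDl// sumr_ge0// => i _; have [_ [/ltW]] := pP i.
have KR : 1 <= K%:R :> R by rewrite ler1n.
pose rho := 1 - (1 - th) / K%:R.
have d1 : (1 - th) / K%:R <= 1 - th by rewrite ler_pdivrMr ?ler_peMr//; lra.
have d0 : 0 < (1 - th) / K%:R by rewrite divr_gt0//; lra.
have r01 : 0 < rho < 1 by rewrite /rho; apply/andP; split; lra.
have thr : th <= rho ^+ K.
  have := @bernoulli_le R (- ((1 - th) / K%:R)) K; rewrite -/rho => H.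
  apply: le_trans (H _); last by lra.
  by rewrite mulrN mulrCA mulfV ?mulr1 ?gt_eqF//; lra.
have r0 : 0 <= rho by case/andP: r01 => /ltW.
exists rho => //; exists C => // j.
have [/andP[q0 q1] [D0 [H1 H2 H3]]] := pP j.
have w0 s : 0 <= weight (phi j) (psi j) s.
  by rewrite ltW// divr_gt0//; exact: Phi_dyadic_gt0.
have pr n : (p j).1 ^+ n <= rho ^+ (K * n).
  by rewrite exprM lerXn2r ?nnegrE ?exprn_ge0 ?(ltW q0)//; exact: le_trans (pth j) thr.
have pr1 n : (p j).1 ^+ n <= rho ^+ n.
  apply: le_trans (pr n) _; rewrite ler_wiXn2l//; first by case/andP: r01 => _ /ltW.
  by rewrite leq_pmull.
have pn n : 0 <= (p j).1 ^+ n by rewrite exprn_ge0// ltW.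
split=> [n s|s|k].
- apply: le_trans (H1 n s) _; rewrite mul1n; apply: ler_pM => //; first by rewrite mulr_ge0// ltW.
  by rewrite ler_wpM2r.
- by apply: le_trans (H2 s) _; apply: ler_pM => //; exact: ltW.
- by apply: le_trans (H3 k) _; apply: ler_pM => //; exact: ltW.
Qed.

(** The arguments c * t_j and then t_j are replaced by 2^-n_j at the cost of a factor
    2 / c for each variable, so that the kernel bounds apply. *)
Lemma block_rearrangement_le (phi psi : 'I_m -> R -> R) (rho C : R) (f : m.-tuple R -> R[i])
    (s n : m.-tuple nat) (t : m.-tuple R) (c B : R)
    (C1 := nikolskii_const (m := m) (2 * m + 4).+2 (4 * (2 * (2 * m + 4).+2%:R : R) ^+ (2 * m + 4)) ^+ m) :
  (forall j, Phi_function (phi j)) -> (forall j, Phi_function (psi j)) ->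
  0 < rho < 1 -> 0 < C ->
  (forall j n s, psi j (2 ^- n) * (phi j (Num.max (2 ^- n) (2 ^- s)))^-1 <=
      C * weight (phi j) (psi j) s * rho ^+ ((2 ^ m + m.+1) * gap n s)) ->
  0 <= B -> weak_bound (fun j u => (phi j u)^-1) B (delta f s) ->
  0 < c <= 1 -> (forall j, shell (tnth n j) (tnth t j)) ->
  ((\prod_j psi j (2 ^- tnth n j))%:E *
   ((c^-1)%:E * iterated_rearrangement (delta f s) [tuple (c * tnth t j)%R | j < m]) <=
   (C1 * (2 * C) ^+ m * (c ^- m.+1 *
     \prod_j rho ^+ ((2 ^ m + m.+1) * gap (tnth n j) (tnth s j))) *
      ((\prod_j weight (phi j) (psi j) (tnth s j)) * B))%:E)%E.
Proof.
move=> Pp Ps r01 C0 kern B0 fB /andP[c0 c1] nt.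
have sd j := slowly_decreasing_inv (Pp j).
have t01 j : 0 < tnth t j <= 1 by exact: shell01 (nt j).
pose u : m.-tuple R := [tuple c * tnth t j | j < m].
have u01 j : 0 < tnth u j <= 1.
  have /andP[a b] := t01 j; rewrite tnth_mktuple mulr_gt0//= mulr_ile1// ltW//.
have := delta_nikolskii sd B0 fB u01; rewrite -/C1 => H.
pose M j := Num.max (2 ^- tnth n j) (2 ^- tnth s j) : R.
have M01 j : 0 < M j <= 1.
  have /andP[a b] := @dyadic01 R (tnth n j); have /andP[a' b'] := @dyadic01 R (tnth s j).
  by rewrite /M lt_max a ge_max b.
have factor j : (phi j (Num.max (tnth u j) (2 ^- tnth s j)))^-1 <= 2 * c^-1 * (phi j (M j))^-1.
  have /andP[a' b'] := @dyadic01 R (tnth s j).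
  have [qd qe] := slowly_decreasing_max a' b' (sd j).
  have /andP[t0 t1] := t01 j; rewrite tnth_mktuple.
  apply: le_trans (qe _ _ c0 c1 t0 t1) _; rewrite mulrAC mulrC [leRHS]mulrC.
  rewrite ler_wpM2l ?invr_ge0 ?(ltW c0)//.
  have /andP[d0 d1] := @dyadic01 R (tnth n j).
  have /andP[l1 l2] := nt j.
  have hE : 2 ^- (tnth n j).+1 = 2^-1 * 2 ^- tnth n j :> R by rewrite exprS invfM.
  have h0 : 0 < 2 ^- (tnth n j).+1 :> R by rewrite invr_gt0 exprn_gt0.
  have /andP[_] := qd _ _ h0 (ltW l1) t1; move/le_trans; apply.
  rewrite hE; have i2 : 2^-1 <= 1 :> R by lra.
  have i20 : 0 < 2^-1 :> R by [].
  by apply: le_trans (qe _ _ i20 i2 d0 d1) _; rewrite invrK mulrC.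
have P0 : 0 <= \prod_j psi j (2 ^- tnth n j).
  by apply: prodr_ge0 => j _; rewrite ltW// Phi_dyadic_gt0.
have phi0 j : 0 < (phi j (M j))^-1.
  by rewrite invr_gt0; have /andP[a b] := M01 j; exact: Phi_gt0.
have C10 : 0 <= C1.
  rewrite /C1 /nikolskii_const exprn_ge0// !mulr_ge0 ?exprn_ge0//.
have prodle : \prod_j (phi j (Num.max (tnth u j) (2 ^- tnth s j)))^-1 <=
    (2 * c^-1) ^+ m * \prod_j (phi j (M j))^-1.
  apply: (@le_trans _ _ (\prod_j (2 * c^-1 * (phi j (M j))^-1))).
    apply: ler_prod => j _; rewrite factor andbT invr_ge0 ltW//.
    have /andP[a b] := u01 j; have /andP[a' b'] := @dyadic01 R (tnth s j).
    by apply: Phi_gt0 => //; rewrite ?lt_max ?a// ge_max b.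
  by rewrite big_split/= prodr_const card_ord.
have kernle : (\prod_j psi j (2 ^- tnth n j)) * \prod_j (phi j (M j))^-1 <=
   C ^+ m * (\prod_j weight (phi j) (psi j) (tnth s j)) *
     \prod_j rho ^+ ((2 ^ m + m.+1) * gap (tnth n j) (tnth s j)).
  rewrite -big_split/=.
  apply: (@le_trans _ _ (\prod_j (C * weight (phi j) (psi j) (tnth s j) *
     rho ^+ ((2 ^ m + m.+1) * gap (tnth n j) (tnth s j))))).
    apply: ler_prod => j _; rewrite kern andbT mulr_ge0 ?(ltW (phi0 j))//.
    by rewrite ltW// Phi_dyadic_gt0.
  by rewrite !big_split/= prodr_const card_ord.
apply: (@le_trans _ _ ((\prod_j psi j (2 ^- tnth n j))%:E * ((c^-1)%:E *
    (C1 * B * ((2 * c^-1) ^+ m * \prod_j (phi j (M j))^-1))%:E))%E).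
  apply: lee_wpmul2l; first by rewrite lee_fin.
  apply: lee_wpmul2l; first by rewrite lee_fin invr_ge0 ltW.
  by apply: le_trans H _; rewrite lee_fin ler_wpM2l// mulr_ge0.
rewrite -!EFinM lee_fin.
set Q := \prod_j psi j _ in kernle *; set V := \prod_j (phi j _)^-1 in kernle *.
set W := \prod_j weight _ _ _ in kernle *; set Z := \prod_j rho ^+ _ in kernle *.
have coef : 0 <= C1 * B * (2 ^+ m * c ^- m.+1).
  have ci : 0 <= c ^- m.+1 by rewrite invr_ge0 exprn_ge0// ltW.
  by apply: mulr_ge0; [exact: mulr_ge0|apply: mulr_ge0 => //; exact: exprn_ge0].
have := ler_wpM2l coef kernle; rewrite exprMn exprVn exprS invfM exprMn => h.
have -> : Q * (c^-1 * (C1 * B * (2 ^+ m * (c ^+ m)^-1 * V))) =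
  C1 * B * (2 ^+ m * (c^-1 * (c ^+ m)^-1)) * (Q * V) by ring.
apply: le_trans h _; rewrite le_eqVlt; apply/orP; left; apply/eqP; ring.
Qed.

(** The numbers c s serve twice, to replace the sum over the blocks by a supremum and
    to rearrange this supremum. *)
Lemma rearrangement_le_sup_blocks (f : m.-tuple R -> R[i]) (c : m.-tuple nat -> R)
    (N : set (m.-tuple R)) (t : m.-tuple R) :
  measurable N -> lebesgue_tuple N = 0%E ->
  (forall x, torus x -> ~ N x ->
    ((normc (f x))%:E <= \esum_(s in [set: m.-tuple nat]) (normc (delta f s x))%:E)%E) ->
  (forall s, 0 < c s) -> (\esum_(s in [set: m.-tuple nat]) (c s)%:E <= (2^-1)%:E)%E ->
  (iterated_rearrangement f t <= ereal_sup [set ((c s)^-1)%:E *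
    iterated_rearrangement (delta f s) [tuple (c s * tnth t j)%R | j < m] | s in [set: m.-tuple nat]])%E.
Proof.
move=> mN N0 fN c0 c2.
pose G (x : m.-tuple R) := (\esum_(s in [set: m.-tuple nat]) (normc (delta f s x))%:E)%E.
have := @iterated_rearrangement_ae R m (fun x => (normc (f x))%:E) G N mN N0 fN t.
move/le_trans; apply.
pose s0 := [tuple 0%N | _ < m].
have := @foldl_rearr_sup R m _ s0
  (fun x : m.-tuple R => G [tuple 2 * pi * tnth x i | i < m])
  (fun s x => ((c s)^-1)%:E * (normc (delta f s [tuple 2 * pi * tnth x i | i < m]))%:E)%E
  (fun _ _ => id) c (enum 'I_m) c0 c2 (enum_uniq _) (fun _ _ _ => erefl).
have cid (x : m.-tuple R) : coordwise (fun _ => id) x = x.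
  by apply: eq_from_tnth => i; rewrite tnth_coordwise.
have c1 : (\esum_(s in [set: m.-tuple nat]) (c s)%:E <= 1)%E.
  by apply: le_trans c2 _; rewrite lee_fin; lra.
move=> /(_ _ t) H; apply: le_trans (H _) _.
  move=> x _.
  under [X in ereal_sup X]eq_imagel do rewrite cid.
  by apply: esum_le_sup => // s; rewrite lee_fin normc_nneg.
apply: ge_ereal_sup => _ [s _ <-]; apply: ereal_sup_ubound; exists s => //.
rewrite foldl_rearrZ ?invr_gt0//; congr (_ * _)%E.
rewrite /iterated_rearrangement; congr (foldl _ _ _ _).
by apply: eq_from_tnth => i; rewrite tnth_coordwise tnth_mktuple mem_enum.
Qed.

(** With c s = kappa * prod_j rho^|n_j - s_j|, the m + 1 factors 1 / c s are
    compensated by as many powers of rho. *)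
Lemma weighted_rearrangement_le (phi psi : 'I_m -> R -> R) (rho C : R) :
  (forall j, Phi_function (phi j)) -> (forall j, Phi_function (psi j)) ->
  0 < rho < 1 -> 0 < C ->
  (forall j n s, psi j (2 ^- n) * (phi j (Num.max (2 ^- n) (2 ^- s)))^-1 <=
      C * weight (phi j) (psi j) s * rho ^+ ((2 ^ m + m.+1) * gap n s)) ->
  exists2 A : R, 0 < A & forall (f : m.-tuple R -> R[i]) (N : set (m.-tuple R)) (B : m.-tuple nat -> R)
    (n : m.-tuple nat) (t : m.-tuple R),
  measurable N -> lebesgue_tuple N = 0%E ->
  (forall x, torus x -> ~ N x ->
    ((normc (f x))%:E <= \esum_(s in [set: m.-tuple nat]) (normc (delta f s x))%:E)%E) ->
  (forall s, 0 <= B s) -> (forall s, weak_bound (fun j u => (phi j u)^-1) (B s) (delta f s)) ->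
  (forall j, shell (tnth n j) (tnth t j)) ->
  ((\prod_j psi j (2 ^- tnth n j))%:E * iterated_rearrangement f t <= A%:E *
   ereal_sup [set (\prod_j rho ^+ (2 ^ m * gap (tnth n j) (tnth s j)))%:E *
     ((\prod_j weight (phi j) (psi j) (tnth s j)) * B s)%:E | s in [set: m.-tuple nat]])%E.
Proof.
move=> Pp Ps r01 C0 kern.
have r0 : 0 < rho by case/andP: r01.
have r1 : rho < 1 by case/andP: r01.
pose E := (2 / (1 - rho)) ^+ m.
have E1 : 1 <= E by rewrite exprn_ege1// ler_pdivlMr; lra.
(* By esum_gap_tuple, the c s below add up to at most kappa * E = 1/2. *)
pose kappa := (2 * E)^-1; have k0 : 0 < kappa by rewrite invr_gt0; lra.
have k1 : kappa <= 1 by rewrite invf_le1; lra.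
pose C1 := nikolskii_const (m := m) (2 * m + 4).+2 (4 * (2 * (2 * m + 4).+2%:R : R) ^+ (2 * m + 4)) ^+ m.
have C10 : 0 < C1.
  by rewrite /C1 /nikolskii_const exprn_gt0// !mulr_gt0 ?exprn_gt0// mulr_gt0// ltr0n.
exists (C1 * (2 * C) ^+ m * kappa ^- m.+1).
  by rewrite !mulr_gt0// ?invr_gt0 exprn_gt0// mulr_gt0.
move=> f N B n t mN N0 fN B0 fB nt.
pose Z (s : m.-tuple nat) := \prod_j rho ^+ gap (tnth n j) (tnth s j).
have Z0 s : 0 < Z s by apply: prodr_gt0 => j _; rewrite exprn_gt0.
have Z1 s : Z s <= 1.
  by apply: prodr_ile1 => j _; rewrite exprn_ge0 ?exprn_ile1 ?ltW.
pose c s := kappa * Z s.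
have c0 s : 0 < c s by rewrite mulr_gt0.
have c1 s : c s <= 1 by rewrite mulr_ile1// ltW.
have c2 : (\esum_(s in [set: m.-tuple nat]) (c s)%:E <= (2^-1)%:E)%E.
  under eq_esum do rewrite /c EFinM.
  apply: le_trans (esumZl_le _ (ltW k0) _) _; first by move=> s; rewrite lee_fin ltW.
  apply: (@le_trans _ _ (kappa%:E * E%:E)%E).
    by apply: lee_wpmul2l; [rewrite lee_fin ltW|exact: esum_gap_tuple].
  by rewrite -EFinM lee_fin /kappa invfM -mulrA mulVf ?mulr1// gt_eqF//; lra.
have := rearrangement_le_sup_blocks t mN N0 fN c0 c2.
have P0 : 0 < \prod_j psi j (2 ^- tnth n j) by apply: prodr_gt0 => j _; exact: Phi_dyadic_gt0.
move=> /(lee_wpmul2l (x := (\prod_j psi j (2 ^- tnth n j))%:E)).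
rewrite lee_fin => /(_ (ltW P0)) /le_trans; apply.
rewrite muleC -lee_pdivlMr//; apply: ge_ereal_sup => _ [s _ <-].
rewrite lee_pdivlMr// muleC.
have c01 : 0 < c s <= 1 by rewrite c0 c1.
apply: le_trans (block_rearrangement_le Pp Ps r01 C0 kern (B0 s) (fB s) c01 nt) _.
rewrite -/C1.
apply: (@le_trans _ _ ((C1 * (2 * C) ^+ m / kappa ^+ m.+1)%:E *
    ((\prod_j rho ^+ (2 ^ m * gap (tnth n j) (tnth s j)))%:E *
      ((\prod_j weight (phi j) (psi j) (tnth s j)) * B s)%:E))%E); last first.
  apply: lee_wpmul2l; last by apply: ereal_sup_ubound; exists s.
  by rewrite lee_fin !mulr_ge0// ?invr_ge0 ?exprn_ge0// ltW// mulr_gt0.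
rewrite -!EFinM lee_fin le_eqVlt; apply/orP; left; apply/eqP.
have -> : \prod_j rho ^+ ((2 ^ m + m.+1) * gap (tnth n j) (tnth s j)) =
    Z s ^+ m.+1 * \prod_j rho ^+ (2 ^ m * gap (tnth n j) (tnth s j)).
  rewrite /Z -prodrXl -big_split/=; apply: eq_bigr => j _.
  by rewrite -exprM -exprD mulnDl addnC [(_ * m.+1)%N]mulnC.
rewrite /c [(kappa * Z s) ^+ _]exprMn invfM.
have zn : Z s ^+ m.+1 != 0 by rewrite gt_eqF// exprn_gt0.
set z := Z s ^+ m.+1 in zn *; set k := kappa ^+ m.+1.
rewrite -[RHS]mulr1 -(mulVf zn); set z' := z^-1; ring.
Qed.

End combination.

Theorem theorem2 (R : realType) (m : nat) (X : 'I_m -> symmetric_space R)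
    (phi psi : 'I_m -> R -> R) (tau : 'I_m -> R) :
  (0 < m)%N ->
  (forall j, Phi_function (phi j) /\ fundamental_function (X j) (phi j)) ->
  (forall j, Phi_function (psi j)) ->
  (forall j, 1 <= tau j) ->
  (forall j, [/\ (1%:E < alpha (psi j))%E,
                 (alpha (psi j) <= beta (psi j))%E,
                 (beta (psi j) < alpha (phi j))%E,
                 (alpha (phi j) <= beta (phi j))%E &
                 (beta (phi j) < 2%:E)%E]) ->
  exists2 C : R, 0 < C &
    forall f : m.-tuple R -> R[i],
      X_space0 X f ->
      (l_norm tau (block_norms X phi psi f) < +oo)%E ->
      lorentz_space0 psi tau f /\
      (lorentz_norm psi tau f <=
         C%:E * l_norm tau (block_norms X phi psi f))%E.
Proof.
move=> _ PX Ps tau1 ab.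
have Pp j : Phi_function (phi j) by case: (PX j).
have [rho r01 [C C0 kern]] : exists2 rho : R, 0 < rho < 1 & exists2 C : R, 0 < C & forall j, kernel_bound (phi j) (psi j) (2 ^ m + m.+1) C rho.
  apply: common_kernel_bounds => // [|j|j|j]; first by rewrite addnS.
  - by case: (ab j).
  - by case: (ab j).
  - by case: (ab j).
have r0 : 0 < rho by case/andP: r01.
have r1 : rho < 1 by case/andP: r01.
have kern1 j := let: And3 h _ _ := kern j in h.
have [A A0 HA] := weighted_rearrangement_le Pp Ps r01 C0 kern1.
have [K K0 HK] := lorentz_iterate Ps tau1 r01.
exists (A * K); first exact: mulr_gt0.
move=> f [[tf fX] fm] lf.
set a := block_norms X phi psi f in lf *.
pose w (s : m.-tuple nat) := \prod_j weight (phi j) (psi j) (tnth s j).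
have w0 s : 0 < w s.
  by apply: prodr_gt0 => j _; rewrite divr_gt0//; exact: Phi_dyadic_gt0.
have aE s : a s = ((w s)%:E * X_norm X (delta f s))%E by [].
have Xn0 g : (0 <= X_norm X g)%E by exact: X_norm_ge0 PX.
have a0 s : (0 <= a s)%E by rewrite aE; apply: mule_ge0; rewrite // lee_fin ltW.
have al s : (a s <= l_norm tau a)%E by exact: l_iterate_ge.
have [L LE] : exists L : R, l_norm tau a = L%:E.
  have : (0 <= l_norm tau a)%E by exact: le_trans (a0 [tuple 0%N | _ < m]) (al _).
  by move: lf; case: (l_norm tau a) => // L _ _; exists L.
have Xfin g : (X_norm X g < +oo)%E -> X_norm X g = (fine (X_norm X g))%:E.
  by move=> gX; rewrite fineK// ge0_fin_numE.
(* The l_tau functional dominates each term, and the weights are positive. *)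
have blockfin s : (X_norm X (delta f s) < +oo)%E.
  have := al s; rewrite aE LE; case: (X_norm X (delta f s)) => [r _||_].
  - by rewrite ltry.
  - by rewrite gt0_muley ?lte_fin// leNgt ltry.
  - by [].
pose B s := fine (X_norm X (delta f s)).
have BE s : X_norm X (delta f s) = (B s)%:E by exact: Xfin.
have B0 s : 0 <= B s by rewrite -lee_fin -BE.
have fB s : weak_bound (fun j u => (phi j u)^-1) (B s) (delta f s).
  by apply: (X_norm_weak PX); rewrite BE.
have fA : weak_bound (fun j u => (phi j u)^-1) (fine (X_norm X f)) f.
  by apply: (X_norm_weak PX); rewrite -Xfin.
have Bfin : (\esum_(s in [set: m.-tuple nat]) (B s)%:E < +oo)%E.
  pose n0 := [tuple 0%N | _ < m].
  have L0 : 0 <= L by rewrite -lee_fin -LE; exact: le_trans (a0 n0) (al n0).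
  have BL s : B s <= L * C ^+ m * \prod_(j < m) rho ^+ gap (tnth n0 j) (tnth s j).
    have : w s * B s <= L by rewrite -lee_fin EFinM -BE -aE -LE.
    rewrite mulrC -ler_pdivlMr// => /le_trans; apply; rewrite -mulrA ler_wpM2l//.
    rewrite /w -prodfV; apply: (@le_trans _ _ (\prod_(j < m) (C * rho ^+ tnth s j))).
      apply: ler_prod => j _; have [_ -> _] := kern j; rewrite andbT.
      by rewrite invr_ge0 ltW// divr_gt0//; exact: Phi_dyadic_gt0.
    rewrite big_split/= prodr_const card_ord le_eqVlt; apply/orP; left; apply/eqP.
    by congr (_ * _); apply: eq_bigr => j _; rewrite tnth_mktuple /gap sub0n subn0.
  apply: (@le_lt_trans _ _ ((L * C ^+ m)%:E * \esum_(s in [set: m.-tuple nat])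
      (\prod_(j < m) rho ^+ gap (tnth n0 j) (tnth s j))%:E)%E).
    apply: le_trans (esumZl_le _ _ _).
      by apply: le_esum => s _; rewrite -EFinM lee_fin.
    - by rewrite mulr_ge0// exprn_ge0// ltW.
    - by move=> s; rewrite lee_fin prodr_ge0// => j _; rewrite exprn_ge0// ltW.
  apply: le_lt_trans (lee_wpmul2l _ (esum_gap_tuple _ r01)) _.
    by rewrite lee_fin mulr_ge0// exprn_ge0// ltW.
  by rewrite -EFinM ltry.
have q0 j (u : R) : 0 < u -> u <= 1 -> 0 <= (phi j u)^-1.
  by move=> u0 u1; rewrite invr_ge0 ltW// Phi_gt0.
have S0 (j : 'I_m) : 0 <= C * (2 / (1 - rho)).
  by rewrite mulr_ge0 ?(ltW C0)// divr_ge0// subr_ge0 ltW.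
have qS j : (\sum_(0 <= k <oo) (2^-1 ^+ k * (phi j (2^-1 ^+ k.+1))^-1)%:E <= (C * (2 / (1 - rho)))%:E)%E.
  have pos k : (0 <= (2^-1 ^+ k * (phi j (2^-1 ^+ k.+1))^-1)%:E)%E.
    by rewrite lee_fin mulr_ge0 ?exprn_ge0// q0 ?exprn_gt0// exprn_ile1// invf_le1// ler1n.
  rewrite nneseries_esumT//.
  apply: (@le_trans _ _ (C%:E * \esum_(k in [set: nat]) (rho ^+ gap 0 k)%:E)%E).
    apply: le_trans (esumZl_le _ (ltW C0) _); last by move=> k; rewrite lee_fin exprn_ge0// ltW.
    apply: le_esum => k _; rewrite -EFinM lee_fin /gap sub0n subn0.
    by have [_ _] := kern j.
  by rewrite EFinM; apply: lee_wpmul2l; [rewrite lee_fin ltW|exact: esum_gap].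
have [N [mN N0 fN]] := norm_le_sum_blocks q0 S0 qS tf fm (fine_ge0 (Xn0 f)) fA B0 fB Bfin.
have main : (lorentz_norm psi tau f <= (A * K)%:E * l_norm tau a)%E.
  apply: HK => //; first exact: ltW.
    by move=> t; apply: foldl_rearr_ge0 => x; rewrite lee_fin normc_nneg.
  move=> n t nt; have := HA f N B n t mN N0 fN B0 fB nt.
  rewrite (_ : [set _ | s in _] = [set ((\prod_j rho ^+ (2 ^ m * gap (tnth n j) (tnth s j)))%:E * a s)%E |
     s in [set: m.-tuple nat]])//.
  by apply: eq_imagel => s _; rewrite aE BE -EFinM.
split=> //; split=> //; split=> //.
by apply: le_lt_trans main _; rewrite LE -EFinM ltry.
Qed.
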